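(* Let $A$ be the generator of a bounded $C_0$-semigroup $(T(t))_{t\ge0}$ on a complex Banach space $X$ with Fourier type $p\in(1,2]$. Assume that the set $$M:=\Big\{x\in X:\ \lim_{\alpha\to0+}\alpha^{\frac{p-1}{p}}R(\alpha+i\beta,A)x=0\ \text{ for every }\beta\in\mathbb{R}\Big\}$$ is dense in $X$. Then $(T(t))_{t\ge0}$ is stable.
   Context: A $C_0$-semigroup is bounded if $\sup_{t\ge0}\|T(t)\|<\infty$; it is stable if $\lim_{t\to\infty}\|T(t)x\|=0$ for every $x\in X$. $R(\lambda,A)=(\lambda-A)^{-1}$ denotes the resolvent of $A$. A Banach space $X$ has Fourier type $p\in[1,2]$ if the Fourier transform $(\mathcal{F}\varphi)(\beta):=\int_{\mathbb{R}}e^{-i\beta t}\varphi(t)\,dt$, $\beta\in\mathbb{R}$, defined on the $X$-valued Schwartz space $\mathcal{S}(\mathbb{R};X)$, extends to a bounded linear operator from $L^p(\mathbb{R};X)$ into $L^q(\mathbb{R};X)$, where $\frac1p+\frac1q=1$. *)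

(* Defs.v *)
From HB Require Import structures.
From mathcomp Require Import all_boot all_order all_algebra.
From mathcomp Require Import complex.
From mathcomp Require Import all_classical all_reals all_analysis.
Set Implicit Arguments.
Unset Strict Implicit.
Unset Printing Implicit Defensive.
Import Order.TTheory GRing.Theory Num.Theory.
Import numFieldNormedType.Exports.
Local Open Scope classical_set_scope.
Local Open Scope ring_scope.
Local Open Scope complex_scope.

(* Complex Banach spaces are [completeNormedModType R[i]] with [R : realType].
   Their norm takes its values in [R[i]] (these values are nonnegative reals);
   [rnorm] is the same norm with values in [R]. *)
Definition rnorm (R : realType) (X : normedModType R[i]) (x : X) : R :=
  complex.Re `|x|.

Section Semigroups.
Context (R : realType) (X : completeNormedModType R[i]).
Implicit Types (T : R -> X -> X) (D : set X) (A : X -> X).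

(* Only the values [T t] with [0 <= t] are constrained, here and below. *)
Definition C0_semigroup T : Prop :=
  [/\ forall t, 0 <= t -> linear (T t) /\ continuous (T t),
      forall x, T 0 x = x,
      forall s t x, 0 <= s -> 0 <= t -> T (s + t) x = T s (T t x) &
      forall x, T t x @[t --> 0^'+] --> x].

Definition bounded_semigroup T : Prop :=
  exists K : R, forall t x, 0 <= t -> rnorm (T t x) <= K * rnorm x.

Definition stable_semigroup T : Prop :=
  forall x, rnorm (T t x) @[t --> +oo] --> (0 : R).

(* An unbounded operator is a function [A] together with its domain [D];
   the values of [A] outside [D] are irrelevant. *)
Definition is_generator T D A : Prop :=
  (forall x, D x <-> cvg ((t^-1)%:C *: (T t x - x) @[t --> 0^'+])) /\
  (forall x, D x -> (t^-1)%:C *: (T t x - x) @[t --> 0^'+] --> A x).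

(* The preimage of [x] under [l - A] (0 if there is none): this is
   (l - A)^-1 x whenever [l] belongs to the resolvent set of [A]. *)
Definition resolvent D A (l : R[i]) (x : X) : X :=
  xget 0 [set y | D y /\ l *: y - A y = x].

End Semigroups.

Section Bochner.
Context (R : realType) (X : completeNormedModType R[i]).
Implicit Types (f s : R -> X).
Local Notation mu := (@lebesgue_measure R).

Definition simple_fun s : Prop :=
  finite_set (range s) /\ forall x, measurable (s @^-1` [set x]).

Definition integrable_simple_fun s : Prop :=
  simple_fun s /\ forall x, x != 0 -> (mu (s @^-1` [set x]) < +oo)%E.

(* The fibre over 0 may have infinite measure; it contributes 0. *)
Definition simple_integral s : X :=
  \sum_(x \in [set: X]) (fine (mu (s @^-1` [set x])))%:C *: x.

(* Limits are taken everywhere rather than almost everywhere, so that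
   [rnorm \o f] is Borel; every Lebesgue class has such a representative. *)
Definition strongly_measurable f : Prop :=
  exists s : nat -> R -> X, (forall n, simple_fun (s n)) /\
    forall t, s n t @[n --> \oo] --> f t.

Definition is_bochner_integral f (y : X) : Prop :=
  strongly_measurable f /\
  exists s : nat -> R -> X,
    [/\ forall n, integrable_simple_fun (s n),
        (\int[mu]_t (rnorm (f t - s n t))%:E)%E @[n --> \oo] --> 0%E &
        simple_integral (s n) @[n --> \oo] --> y].

Definition bochner_integral f : X := xget 0 (is_bochner_integral f).

End Bochner.

Section FourierType.
Context (R : realType) (X : completeNormedModType R[i]).
Implicit Types (f g phi : R -> X).
Local Notation mu := (@lebesgue_measure R).

Definition LpX_norm (p : \bar R) f : \bar R :=
  Lnorm mu p (fun t => (rnorm (f t))%:E).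

(* L^p(R; X), as a set of functions rather than of classes modulo equality
   almost everywhere *)
Definition LpX (p : \bar R) : set (R -> X) :=
  [set f | strongly_measurable f /\ (LpX_norm p f < +oo)%E].

(* A bounded linear operator L^p(R; X) -> L^q(R; X), acting on
   representatives; linearity and the bound make it compatible with equality
   almost everywhere. *)
Definition bounded_linear_LpX (p q : \bar R) (F : (R -> X) -> R -> X) : Prop :=
  [/\ forall f, LpX p f -> LpX q (F f),
      forall (a : R[i]) f g, LpX p f -> LpX p g ->
        {ae mu, forall t, F (fun u => a *: f u + g u) t = a *: F f t + F g t} &
      exists K : R, forall f, LpX p f ->
        (LpX_norm q (F f) <= K%:E * LpX_norm p f)%E].

(* [X] is a module over [R[i]] whereas the variable is real, hence derivatives
   are written as limits of difference quotients instead of using ['D_v]. *)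
Definition difference_quotient f (t h : R) : X :=
  (h^-1)%:C *: (f (t + h) - f t).

Definition rderivable f : Prop :=
  forall t, cvg (difference_quotient f t h @[h --> 0^']).

Definition rderive f : R -> X :=
  fun t => lim (difference_quotient f t h @[h --> 0^']).

Definition schwartz phi : Prop :=
  forall k, rderivable (iter k rderive phi) /\
    forall m : nat, exists K : R, forall t,
      `|t| ^+ m * rnorm (iter k rderive phi t) <= K.

Definition expi (x : R) : R[i] := cos x +i* sin x.

Definition fourier phi : R -> X :=
  fun b => bochner_integral (fun t => expi (- (b * t)) *: phi t).

End FourierType.

Definition fourier_type (R : realType) (X : completeNormedModType R[i])
    (p : R) : Prop :=
  let q := hoelder_conjugate p%:E in
  exists F : (R -> X) -> R -> X, bounded_linear_LpX p%:E q F /\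
    forall phi, schwartz phi ->
      {ae @lebesgue_measure R, forall b, F phi b = fourier phi b}.

(* Main.v *)
Require Import Defs.
From mathcomp Require Import all_boot all_order all_algebra.
From mathcomp Require Import complex.
From mathcomp Require Import all_classical all_reals all_analysis.
From mathcomp Require Import measurable_realfun.
From mathcomp Require Import ring lra.
Set Implicit Arguments.
Unset Strict Implicit.
Unset Printing Implicit Defensive.
Import Order.TTheory GRing.Theory Num.Theory.
Import numFieldNormedType.Exports.
Local Open Scope classical_set_scope.
Local Open Scope ring_scope.
Local Open Scope complex_scope.

(** Fix [x] in the dense set. The orbit of [x] is cut into frequency bands:
    [spectral_part T r b x s] is the integral over [t] of [T (s + t) x] against
    [expi (b * t)] times the Fejer kernel [kappa r t], and retains the frequencies within
    [r] of [- b]. For large [r] the kernels form an approximate identity, so the orbit tends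
    to 0 as soon as every spectral part tends to 0 when [s] tends to infinity
    ([orbit_le_spectral]). Boundedness of the semigroup carries this from integer times to
    all times and from the dense set to the whole space.

    The Fourier transform of [kappa r] is a triangle, hence a combination, with coefficients
    in [0, 1], of translates of the triangle of half-width [rho = r / 2 ^ n]
    ([kappa_refine]): a band at scale [r] is a combination of bands at scale [rho] centred
    at the points [b_i = b - r + i rho]. Let [y_i] solve [(rho - i b_i - A) y_i = x].
    Replacing [x] by a difference quotient of the rescaled orbit of [y_i] and summing by
    parts moves the quotient to the kernel, where it yields a factor [rho] ([kappa_lip]).
    What is left is an integral of the semigroup applied to the trigonometric polynomial
    with frequencies [b_i] and coefficients [w_i y_i]. Fourier type bounds the average of
    the norm of such a polynomial by the [l^p] norm of its coefficients
    ([hausdorff_young_scaled]): the Fourier transform is tested on sums of translated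
    Gaussians, which it maps to trigonometric polynomials times a profile that does not
    vanish near 0. Altogether the combination of bands is asymptotically at most a constant
    times
      [rho (sum_i |w_i y_i| ^ p) ^ (1 / p)
        = (sum_i rho (rho ^ ((p - 1) / p) |w_i y_i|) ^ p) ^ (1 / p)]
    ([spectral_sum_le]).

    The last sum is a Riemann sum over the band for the [p]-th power of
    [growth rho b = rho ^ ((p - 1) / p) |R(rho - i b, A) x|], which tends to 0 with [rho] for
    each [b] by hypothesis. Dominated convergence would conclude, were the integrand
    bounded. The bound comes from a Baire category argument ([exists_quiet_node]). Suppose
    that some band does not tend to 0. By refinement it contains smaller bands with the same
    property, at all scales. If each of these contained another one with [growth > 1], one
    could descend along a sequence of bands with [growth > 1], shrinking to a frequency at
    which the hypothesis fails, since resolvents at points whose distance is comparable to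
    their real part are comparable ([resolves_comparison]). So some band does not tend to 0,
    while [growth <= 1] on all its descendants that do not tend to 0. For this band
    dominated convergence applies ([quiet_mass_cvg0]) and shows that it does tend to 0
    ([quiet_node_null]), a contradiction. *)

(** * Real-valued norms on complex spaces *)

Section RNorm.
Context (R : realType) (X : normedModType R[i]).
Implicit Types (x y : X) (a : R).

Lemma normE x : `|x| = (rnorm x)%:C.
Proof. by rewrite /rnorm; apply/esym/RRe_real/ger0_real. Qed.

Lemma rnorm_ge0 x : 0 <= rnorm x.
Proof. by rewrite -lecR -normE normr_ge0. Qed.

Lemma rnormD x y : rnorm (x + y) <= rnorm x + rnorm y.
Proof. by rewrite -lecR rmorphD /= -!normE ler_normD. Qed.

Lemma rnormZ (c : R[i]) x : rnorm (c *: x) = complex.Re `|c| * rnorm x.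
Proof.
apply/eqP; rewrite -(inj_eq (@complexI R)) rmorphM /= -!normE normrZ.
by rewrite (RRe_real (ger0_real (normr_ge0 c))).
Qed.

Lemma rnormZr a x : rnorm (a%:C *: x) = `|a| * rnorm x.
Proof. by rewrite rnormZ normc_def /= expr0n addr0 sqrtr_sqr. Qed.

Lemma rnormN x : rnorm (- x) = rnorm x.
Proof. by rewrite /rnorm normrN. Qed.

Lemma rnorm0 : rnorm (0 : X) = 0.
Proof. by rewrite /rnorm normr0. Qed.

Lemma rnorm_eq0 x : rnorm x = 0 -> x = 0.
Proof. by move=> h; apply/eqP; rewrite -normr_eq0 normE h. Qed.

Lemma rdistC x y : rnorm (x - y) = rnorm (y - x).
Proof. by rewrite -rnormN opprB. Qed.

Lemma rnormB x y : rnorm (x - y) <= rnorm x + rnorm y.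
Proof. by rewrite -(rnormN y) rnormD. Qed.

Lemma rdist_trans y x z : rnorm (x - z) <= rnorm (x - y) + rnorm (y - z).
Proof. by rewrite -[x - z](subrKA y) rnormD. Qed.

Lemma rnorm_sum I (s : seq I) (P : pred I) (F : I -> X) :
  rnorm (\sum_(i <- s | P i) F i) <= \sum_(i <- s | P i) rnorm (F i).
Proof.
elim/big_ind2: _ => [|u v w z huv hwz|//]; first by rewrite rnorm0.
exact: le_trans (rnormD _ _) (lerD huv hwz).
Qed.

Lemma ler_rdist x y : `|rnorm x - rnorm y| <= rnorm (x - y).
Proof.
rewrite ler_norml; apply/andP; split.
  by rewrite lerNl opprB lerBlDr rdistC (le_trans _ (rnormD _ _))// subrK.
by rewrite lerBlDr (le_trans _ (rnormD _ _))// subrK.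
Qed.

Lemma cvg_rnormP T (F : set_system T) (FF : Filter F) (f : T -> X) (l : X) :
  (f @ F --> l) <-> (forall e : R, 0 < e -> \forall t \near F, rnorm (f t - l) < e).
Proof.
split=> [/cvgrPdist_lt h e e0|h].
  have e0' : 0 < e%:C :> R[i] by rewrite ltcR.
  by apply: filterS (h _ e0') => t; rewrite normE ltcR rdistC.
apply/cvgrPdist_lt => e; case: e => e e' /[dup] /ltW/ger0_Im /= -> e0.
have {}e0 : 0 < e by rewrite -ltcR.
by apply: filterS (h _ e0) => t ht; rewrite normE ltcR rdistC.
Qed.

Lemma cvg_rnorm0P T (F : set_system T) (FF : Filter F) (f : T -> X) :
  (f @ F --> (0 : X)) <-> (rnorm (f t) @[t --> F] --> (0 : R)).
Proof.
split=> [/cvg_rnormP h|/cvgrPdist_lt h].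
  apply/cvgrPdist_lt => e e0; apply: filterS (h _ e0) => t.
  by rewrite subr0 sub0r normrN ger0_norm// rnorm_ge0.
apply/cvg_rnormP => e e0; apply: filterS (h _ e0) => t.
by rewrite subr0 sub0r normrN ger0_norm// rnorm_ge0.
Qed.

Lemma cvg_rnormBP T (F : set_system T) (FF : Filter F) (f : T -> X) (l : X) :
  (f @ F --> l) <-> (rnorm (f t - l) @[t --> F] --> (0 : R)).
Proof.
split=> [/cvg_rnormP h|/cvgrPdist_lt h].
  apply/cvgrPdist_lt => e e0; apply: filterS (h _ e0) => t.
  by rewrite sub0r normrN ger0_norm// rnorm_ge0.
apply/cvg_rnormP => e e0; apply: filterS (h _ e0) => t.
by rewrite sub0r normrN ger0_norm// rnorm_ge0.
Qed.

Lemma cvg_rnorm T (F : set_system T) (FF : Filter F) (f : T -> X) (l : X) :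
  f @ F --> l -> rnorm (f t) @[t --> F] --> rnorm l.
Proof.
move=> /cvg_rnormP h; apply/cvgrPdist_lt => e e0; apply: filterS (h _ e0) => t ht.
by rewrite distrC (le_lt_trans (ler_rdist _ _) ht).
Qed.

Lemma rcvg_unique T (F : set_system T) (FF : ProperFilter F) (f : T -> X)
  (l l' : X) : f @ F --> l -> f @ F --> l' -> l = l'.
Proof. by move=> h h'; exact: norm_cvg_unique h h'. Qed.

Lemma rlim T (F : set_system T) (FF : ProperFilter F) (f : T -> X)
  (l : X) : f @ F --> l -> lim (f @ F) = l.
Proof.
by move=> h; apply: rcvg_unique (h); apply: cvgP h.
Qed.

End RNorm.

Lemma rcauchy_cvg (R : realType) (X : completeNormedModType R[i]) (u : nat -> X) :
  (forall e : R, 0 < e -> exists N, forall m n, (N <= m)%N -> (N <= n)%N ->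
     rnorm (u m - u n) <= e) -> cvg (u @ \oo).
Proof.
move=> h; apply: cauchy_cvg; apply: cauchy_exP => -[e e'].
move=> /[dup] /ltW/ger0_Im /= -> e0.
have {}e0 : 0 < e by rewrite -ltcR.
have [N hN] := h _ (divr_gt0 e0 (ltr0n _ 2)).
exists (u N); exists N => // n /= Nn.
rewrite -ball_normE /= normE ltcR; apply: le_lt_trans (hN _ _ _ _) _ => //.
by rewrite ltr_pdivrMr// ltr_pMr// ltr1n.
Qed.

(** * Simple functions *)

Section SimpleFunctions.
Context (R : realType) (X : completeNormedModType R[i]).
Local Notation mu := (@lebesgue_measure R).

(** A simple function is presented as [v \o c] with a classifier [c] that numbers its fibres,
    so that several functions can share one classifier. *)
Section Classified.
Context (N : nat) (c : R -> 'I_N) (mc : forall k, measurable (c @^-1` [set k])).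
Let m k := mu (c @^-1` [set k]).

Lemma fiber_classified (T : choiceType) (v : 'I_N -> T) (x : T) :
  (v \o c) @^-1` [set x] = \big[setU/set0]_(k < N | v k == x) (c @^-1` [set k]).
Proof.
rewrite -bigcup_seq_cond; apply/seteqP; split=> [t /= <-|t [k] /=].
  by exists (c t) => //=; rewrite mem_index_enum eqxx.
by move=> /andP[_ /eqP <-] ->.
Qed.

Lemma measurable_fiber_classified (T : choiceType) (v : 'I_N -> T) (x : T) :
  measurable ((v \o c) @^-1` [set x]).
Proof.
by rewrite fiber_classified; apply: bigsetU_measurable => k _; exact: mc.
Qed.

Lemma measurable_classified (v : 'I_N -> R) : measurable_fun setT (v \o c).
Proof.
move=> _ B mB; rewrite setTI (_ : _ @^-1` B =
  \big[setU/set0]_(k < N | v k \in B) (c @^-1` [set k])).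
  by apply: bigsetU_measurable => k _; exact: mc.
rewrite -bigcup_seq_cond; apply/seteqP; split=> [t /= Bt|t [k] /=].
  by exists (c t) => //=; rewrite mem_index_enum; exact/mem_set.
by move=> /andP[_ /set_mem Bk] ->.
Qed.

Lemma measure_fiber_classified (T : choiceType) (v : 'I_N -> T) (x : T) :
  mu ((v \o c) @^-1` [set x]) = (\sum_(k < N | v k == x) m k)%E.
Proof.
rewrite fiber_classified; apply: measure_bigsetU_ord_cond => [k _|]; first exact: mc.
exact: trivIset_preimage1.
Qed.

Lemma simple_fun_classified (v : 'I_N -> X) : simple_fun (v \o c).
Proof.
split=> [|x]; last exact: measurable_fiber_classified.
apply: (@sub_finite_set _ _ (range v)) => [x [t _ <-]|]; first by exists (c t).
exact: finite_image.
Qed.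

Context (v : 'I_N -> X) (mfin : forall k, v k != 0 -> (m k < +oo)%E).

Lemma integrable_classified : integrable_simple_fun (v \o c).
Proof.
split=> [|x x0]; first exact: simple_fun_classified.
rewrite measure_fiber_classified; apply: lte_sum_pinfty => k /eqP vk.
by apply: mfin; rewrite vk.
Qed.

Lemma simple_integral_classified :
  simple_integral (v \o c) = \sum_(k < N) (fine (m k))%:C *: v k.
Proof.
rewrite /simple_integral (@fsbigE _ _ _ _ _ (undup (codom v))) ?undup_uniq//; last first.
  move=> x _; rewrite mem_undup => /negP xv.
  rewrite (_ : _ @^-1` _ = set0) ?measure0 ?scale0r//.
  by apply/seteqP; split=> // t /= vt; apply: xv; rewrite -vt codom_f.
transitivity (\sum_(x <- undup (codom v)) \sum_(k < N | v k == x) (fine (m k))%:C *: v k).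
  apply: eq_big => [x|x _]; first by rewrite in_setT.
   have [->|x0] := eqVneq x 0.
    by rewrite scaler0 big1// => k /eqP ->; rewrite scaler0.
  rewrite measure_fiber_classified.
  rewrite [RHS](eq_bigr (fun k => (fine (m k))%:C *: x)) => [|k /eqP -> //].
  rewrite -scaler_suml -rmorph_sum /= sum_fine// => k /eqP vk.
  by rewrite ge0_fin_numE ?measure_ge0//; apply: mfin; rewrite vk.
rewrite (exchange_big_dep xpredT)//=; apply: eq_bigr => k _.
rewrite big_mkcond (bigD1_seq (v k)) ?undup_uniq ?mem_undup ?codom_f//= eqxx.
by rewrite big1 ?addr0// => x /negPf; rewrite eq_sym => ->.
Qed.

End Classified.

Lemma integral_classified N (c : R -> 'I_N) (mc : forall k, measurable (c @^-1` [set k]))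
    (d : 'I_N -> R) : (forall k, 0 <= d k) ->
  (\int[mu]_t (d (c t))%:E)%E = (\sum_(k < N) (d k)%:E * mu (c @^-1` [set k]))%E.
Proof.
move=> d0.
transitivity (\int[mu]_t (\sum_(k < N) (d k * \1_(c @^-1` [set k]) t)%:E))%E.
  apply: eq_integral => t _; rewrite sumEFin (bigD1 (c t))//= indicE mem_set//= mulr1.
  rewrite big1 ?addr0// => k kc; rewrite indicE memNset ?mulr0//= => ckt.
  by rewrite -ckt eqxx in kc.
rewrite ge0_integral_sum//.
- apply: eq_bigr => k _; under eq_integral do rewrite EFinM.
  rewrite ge0_integralZl_EFin//.
    by rewrite integral_indic ?setIT//; exact: mc.
  by apply/measurable_EFinP; apply: measurable_indic; exact: mc.
- move=> k; apply/measurable_EFinP; apply: measurable_funM => //.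
  by apply: measurable_indic; exact: mc.
- by move=> k t _; rewrite lee_fin mulr_ge0.
Qed.

(** Two simple functions are refined by the classification of the line according
    to the pair of their values. *)
Lemma common_classification (s s' : R -> X) : simple_fun s -> simple_fun s' ->
  exists N (c : R -> 'I_N) (v v' : 'I_N -> X),
    [/\ forall k, measurable (c @^-1` [set k]), s = v \o c & s' = v' \o c].
Proof.
move=> [/finite_seqP[r rs] ms] [/finite_seqP[r' rs'] ms'].
have sr t : s t \in r by have : range s (s t) by [exists t]; rewrite rs.
have sr' t : s' t \in r' by have : range s' (s' t) by [exists t]; rewrite rs'.
pose P := (seq_sub r * seq_sub r')%type.
pose f t : P := (SeqSub (sr t), SeqSub (sr' t)).
exists #|{: P}|, (fun t => enum_rank (f t)),
  (fun k => ssval (enum_val k).1), (fun k => ssval (enum_val k).2); split.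
- move=> k; rewrite (_ : _ @^-1` _ =
    (s @^-1` [set ssval (enum_val k).1]) `&` (s' @^-1` [set ssval (enum_val k).2])).
    exact: measurableI.
  apply/seteqP; split=> [t /= <-|t /= [h h']]; first by rewrite enum_rankK.
  apply: enum_val_inj; rewrite enum_rankK [RHS]surjective_pairing /f.
  by congr pair; exact: val_inj.
- by apply/funext => t /=; rewrite enum_rankK.
- by apply/funext => t /=; rewrite enum_rankK.
Qed.

(** Once both functions are constant on the same finitely many sets, this is the triangle
    inequality for a finite sum. *)
Lemma simple_integral_dist (s s' : R -> X) :
  integrable_simple_fun s -> integrable_simple_fun s' ->
  ((rnorm (simple_integral s - simple_integral s'))%:E <=
    \int[mu]_t (rnorm (s t - s' t))%:E)%E.
Proof.
move=> [ss fs] [ss' fs'].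
have [N [c [v [v' [mc sv sv']]]]] := common_classification ss ss'.
pose m k := mu (c @^-1` [set k]).
have fin (w : 'I_N -> X) (f : R -> X) : f = w \o c ->
    (forall x : X, x != 0 -> (mu (f @^-1` [set x]) < +oo)%E) ->
    forall k, w k != 0 -> (m k < +oo)%E.
  move=> -> h k /h; apply: le_lt_trans; apply: le_measure; rewrite ?inE//.
  - exact: mc.
  - by apply: measurable_fiber_classified; exact: mc.
  - by move=> t /= ->.
have h := fin _ _ sv fs; have h' := fin _ _ sv' fs'.
rewrite {1}sv {1}sv' !simple_integral_classified// -sumrB.
under eq_bigr do rewrite -scalerBr.
rewrite (_ : (fun t => _) = fun t => (rnorm (v (c t) - v' (c t)))%:E); last first.
  by apply/funext => t; rewrite sv sv'.
rewrite (integral_classified mc (d := fun k => rnorm (v k - v' k))) => [|k]; last exact: rnorm_ge0.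
apply: (@le_trans _ _ (\sum_(k < N) rnorm ((fine (m k))%:C *: (v k - v' k)))%:E).
  by rewrite lee_fin rnorm_sum.
rewrite -sumEFin; apply: lee_sum => k _.
rewrite rnormZr ger0_norm ?fine_ge0 ?measure_ge0// mulrC EFinM.
have [vv|vv] := eqVneq (v k) (v' k); first by rewrite vv subrr rnorm0 !mul0e.
rewrite fineK// ge0_fin_numE ?measure_ge0//.
have [vk|] := eqVneq (v k) 0; last exact: h.
by apply: h'; rewrite -vk eq_sym.
Qed.

End SimpleFunctions.

(** * Step functions on a grid *)

Section Grid.
Context (R : realType).
Local Notation mu := (@lebesgue_measure R).

(** The cell of the grid [a, a + d, ..., a + N d] containing [t]; the points outside
    the grid get the extra index [N]. *)
Definition cell (a d : R) (N : nat) (t : R) : 'I_N.+1 :=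
  inord (if (a <= t) && (t < a + d * N%:R) then Num.trunc ((t - a) / d) else N).

Context (a d : R) (d0 : 0 < d) (N : nat).
Local Notation c := (cell a d N).

Lemma cell_outside t : ~~ ((a <= t) && (t < a + d * N%:R)) -> c t = ord_max.
Proof.
by move=> /negPf h; apply: val_inj; rewrite /cell h /= inordK.
Qed.

Lemma cell_inside t : (a <= t) && (t < a + d * N%:R) ->
  [/\ (c t < N)%N, a + d * (c t)%:R <= t & t < a + d * (c t).+1%:R].
Proof.
move=> h; rewrite /cell h; case/andP: h => at_ tN.
have q0 : 0 <= (t - a) / d by rewrite divr_ge0 ?subr_ge0// ltW.
have qN : (Num.trunc ((t - a) / d) < N)%N.
  by rewrite truncn_lt_nat// ltr_pdivrMr// ltrBlDr addrC mulrC.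
rewrite inordK; last exact: (ltn_trans qN).
have /andP[h1 h2] := truncn_itv q0; split=> //.
- by rewrite addrC -lerBrDr mulrC -ler_pdivlMr.
- by rewrite addrC -ltrBlDr mulrC -ltr_pdivrMr.
Qed.

Lemma cell_lt t : (c t < N)%N = (a <= t) && (t < a + d * N%:R).
Proof.
apply/idP/idP => [|/cell_inside[]//].
by apply: contraTT => /cell_outside ->; rewrite /= ltnn.
Qed.

Lemma fiber_cell (k : 'I_N.+1) : (k < N)%N ->
  c @^-1` [set k] = `[a + d * k%:R, a + d * k.+1%:R[%classic.
Proof.
move=> kN; apply/seteqP; split=> [t /= tk|t /=].
  have /cell_inside[_ h1 h2] : (a <= t) && (t < a + d * N%:R).
    by rewrite -cell_lt tk.
  by rewrite in_itv /= -tk h1.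
rewrite in_itv /= => /andP[h1 h2].
have /cell_inside[_ h3 h4] : (a <= t) && (t < a + d * N%:R).
  rewrite (le_trans _ h1) ?lerDl ?mulr_ge0 ?ler0n ?(ltW d0)//=.
  by rewrite (lt_le_trans h2)// lerD2l ler_pM2l// ler_nat.
have lt1 i j : a + d * i%:R <= t -> t < a + d * j.+1%:R -> (i <= j)%N.
  move=> h h'; have := le_lt_trans h h'.
  by rewrite ltrD2l ltr_pM2l// ltr_nat ltnS.
by apply/val_inj/eqP; rewrite eqn_leq !lt1.
Qed.

Lemma fiber_cell_max : c @^-1` [set ord_max] = ~` `[a, a + d * N%:R[%classic.
Proof.
apply/seteqP; split=> [t /= tk|t /= tk].
  by apply/negP; rewrite in_itv/= -cell_lt tk ltnn.
by apply: cell_outside; move/negP: tk; rewrite in_itv.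
Qed.

Lemma measurable_cell (k : 'I_N.+1) : measurable (c @^-1` [set k]).
Proof.
have [kN|] := ltnP k N; first by rewrite fiber_cell//; exact: measurable_itv.
move=> kN; rewrite (_ : k = ord_max); last first.
  by apply/val_inj/eqP; rewrite eqn_leq kN -ltnS ltn_ord.
by rewrite fiber_cell_max; apply: measurableC; exact: measurable_itv.
Qed.

Lemma measure_cell (k : 'I_N.+1) : (k < N)%N -> mu (c @^-1` [set k]) = d%:E.
Proof.
move=> kN; rewrite fiber_cell// lebesgue_measure_itv/= lte_fin.
rewrite ltrD2l ltr_pM2l// ltr_nat ltnSn -EFinB; congr EFin.
by rewrite -[k.+1%:R]natr1; ring.
Qed.

Definition step (T : Type) (x0 : T) (g : nat -> T) (t : R) : T :=
  if (c t < N)%N then g (c t) else x0.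

Lemma step_comp T (x0 : T) g : step x0 g = (fun k : 'I_N.+1 => if (k < N)%N then g k else x0) \o c.
Proof. by []. Qed.

Lemma measurable_step (g : nat -> R) : measurable_fun setT (step 0 g).
Proof. by rewrite step_comp; apply: measurable_classified; exact: measurable_cell. Qed.

Lemma integral_step (g : nat -> R) : (forall k, 0 <= g k) ->
  (\int[mu]_t (step 0 g t)%:E)%E = (\sum_(k < N) d * g k)%:E.
Proof.
move=> g0; rewrite (integral_classified measurable_cell
  (d := fun k : 'I_N.+1 => if (k < N)%N then g k else 0)); last by move=> k; case: ifP.
rewrite big_ord_recr /= ltnn mul0e adde0 -sumEFin.
apply: eq_bigr => k _; rewrite ltn_ord measure_cell//= ?ltn_ord// -EFinM.
by rewrite mulrC.
Qed.

Section Vector.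
Context (X : completeNormedModType R[i]).
Implicit Types g : nat -> X.

Lemma integrable_simple_step g : integrable_simple_fun (step 0 g).
Proof.
rewrite step_comp; apply: integrable_classified => [|k]; first exact: measurable_cell.
by case: ifP => [kN _|]; rewrite ?eqxx// measure_cell// ltry.
Qed.

Lemma simple_integral_step g :
  simple_integral (step 0 g) = \sum_(k < N) d%:C *: g k.
Proof.
rewrite step_comp simple_integral_classified; last 2 first.
- exact: measurable_cell.
- by move=> k; case: ifP => [kN _|]; rewrite ?eqxx// measure_cell// ltry.
rewrite big_ord_recr /= ltnn scaler0 addr0.
by apply: eq_bigr => k _; rewrite ltn_ord measure_cell//= ltn_ord.
Qed.

End Vector.

End Grid.

(** * Integrals of nonnegative functions and Bochner integrals *)

Section NonnegIntegral.
Context (R : realType).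
Local Notation mu := (@lebesgue_measure R).
Implicit Types f g : R -> R.

(** Only applied to nonnegative functions. *)
Definition nint f : \bar R := (\int[mu]_t (f t)%:E)%E.

Lemma eq_nint f g : f =1 g -> nint f = nint g.
Proof. by move=> fg; apply: eq_integral => t _; rewrite fg. Qed.

Lemma nint_ge0 f : (forall t, 0 <= f t) -> (0 <= nint f)%E.
Proof. by move=> f0; apply: integral_ge0 => t _; rewrite lee_fin. Qed.

Lemma le_nint f g : measurable_fun setT f -> measurable_fun setT g ->
  (forall t, 0 <= f t <= g t) -> (nint f <= nint g)%E.
Proof.
move=> mf mg fg; apply: ge0_le_integral => //.
- by move=> t _; rewrite lee_fin; case/andP: (fg t).
- exact/measurable_EFinP.
- exact/measurable_EFinP.
- by move=> t _; rewrite lee_fin; case/andP: (fg t).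
Qed.

Lemma nintD f g : measurable_fun setT f -> measurable_fun setT g ->
  (forall t, 0 <= f t) -> (forall t, 0 <= g t) ->
  nint (fun t => f t + g t) = (nint f + nint g)%E.
Proof.
move=> mf mg f0 g0; rewrite /nint; under eq_integral do rewrite EFinD.
rewrite ge0_integralD//.
- by move=> t _; rewrite lee_fin.
- exact/measurable_EFinP.
- by move=> t _; rewrite lee_fin.
- exact/measurable_EFinP.
Qed.

Lemma nintZ f (a : R) : measurable_fun setT f -> (forall t, 0 <= f t) -> 0 <= a ->
  nint (fun t => a * f t) = (a%:E * nint f)%E.
Proof.
move=> mf f0 a0; rewrite /nint; under eq_integral do rewrite EFinM.
rewrite ge0_integralZl_EFin//; last exact/measurable_EFinP.
by move=> t _; rewrite lee_fin.
Qed.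

(** The common majorant of all integrands: it is integrable, and comparable with its
    translates and its dilates. *)
Definition wgt (t : R) : R := (oneDsqr t)^-1.

Lemma wgt_gt0 t : 0 < wgt t.
Proof. by rewrite invr_gt0 (lt_le_trans ltr01)// oneDsqr_ge1. Qed.

Lemma wgt_ge0 t : 0 <= wgt t. Proof. exact/ltW/wgt_gt0. Qed.

Lemma continuous_wgt : continuous wgt.
Proof. exact: continuous_oneDsqrV. Qed.

Lemma measurable_wgt : measurable_fun setT wgt.
Proof. by apply: continuous_measurable_fun; exact: continuous_wgt. Qed.

Lemma nint_wgt : nint wgt = (pi : R)%:E.
Proof.
rewrite /nint ge0_symfun_integralT.
- rewrite (_ : [set x | _] = `[0, +oo[%classic); last first.
    by apply/seteqP; split => x /=; rewrite in_itv /= andbT.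
  by rewrite integral0y_oneDsqr -EFinM mulrC divfK// pnatr_eq0.
- exact: wgt_ge0.
- exact: continuous_wgt.
- by move=> x; rewrite /= /wgt /oneDsqr sqrrN.
Qed.

Lemma wgt_shift (s t : R) : `|s - t| <= 1 -> wgt s <= 3 * wgt t.
Proof.
move=> st; rewrite /wgt ler_pdivlMr ?(lt_le_trans ltr01) ?oneDsqr_ge1//.
rewrite mulrC ler_pdivrMr ?(lt_le_trans ltr01) ?oneDsqr_ge1// /oneDsqr.
have : (s - t) ^+ 2 <= 1 by move: st; rewrite ler_norml => /andP[? ?]; nra.
by move=> h; have := sqr_ge0 s; have := sqr_ge0 (s + (s - t)); lra.
Qed.

Lemma integrable_wgtZ (C : R) : mu.-integrable setT (fun t => (C * wgt t)%:E).
Proof.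
have : mu.-integrable setT (EFin \o wgt).
  apply/integrableP; split; first by apply/measurable_EFinP; exact: measurable_wgt.
  rewrite (_ : integral _ _ _ = nint wgt) ?nint_wgt ?ltry//.
  by rewrite -nint_wgt; apply: eq_integral => t _ /=; rewrite ger0_norm ?wgt_ge0.
move=> /(@integrableZl _ _ _ _ _ measurableT C); apply: eq_integrable => //.
Qed.

Lemma nint_wgt_cvg0 (F : nat -> R -> R) (C : R) :
  (forall n, measurable_fun setT (F n)) ->
  (forall n t, 0 <= F n t <= C * wgt t) ->
  (forall t, F n t @[n --> \oo] --> (0 : R)) ->
  nint (F n) @[n --> \oo] --> 0%E.
Proof.
move=> mF FC F0.
have := @dominated_cvg _ _ _ mu setT measurableT (fun n t => (F n t)%:E) (fun=> 0%E)
  (fun t => (C * wgt t)%:E).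
rewrite integral0; apply => //.
- by move=> n; apply/measurable_EFinP; exact: mF.
- by move=> t _; apply: cvg_EFin; [exact: nearW|exact: F0].
- exact: integrable_wgtZ.
- by move=> n t _; have /andP[? ?] := FC n t; rewrite /= ger0_norm// lee_fin.
Qed.

Lemma ecvg0P (u : nat -> \bar R) : (forall n, (0 <= u n)%E) ->
  u @ \oo --> 0%E <->
  (forall e : R, 0 < e -> exists N, forall n, (N <= n)%N -> (u n <= e%:E)%E).
Proof.
move=> u0; split=> [|h].
  move=> /fine_cvgP[[N1 _ fu] /cvgrPdist_le h] e /h[N2 _ hN2].
  exists (maxn N1 N2) => n; rewrite geq_max => /andP[n1 n2].
  rewrite -(fineK (fu _ n1)) lee_fin; have := hN2 _ n2.
  by rewrite /= sub0r normrN ger0_norm// fine_ge0.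
apply/fine_cvgP; split.
  have [N hN] := h _ ltr01; exists N => // n /= /hN un.
  by rewrite ge0_fin_numE// (le_lt_trans un)// ltry.
apply/cvgrPdist_le => e e0; have [N hN] := h _ e0; exists N => // n /= /hN un.
rewrite sub0r normrN ger0_norm ?fine_ge0//= -lee_fin fineK//.
by rewrite ge0_fin_numE// (le_lt_trans un)// ltry.
Qed.

End NonnegIntegral.

Section BochnerIntegral.
Context (R : realType) (X : completeNormedModType R[i]).
Local Notation mu := (@lebesgue_measure R).
Implicit Types (f g h : R -> X).

Lemma simple_strongly_measurable f : simple_fun f -> strongly_measurable f.
Proof. by move=> sf; exists (fun=> f); split=> // t; exact: cvg_cst. Qed.

Lemma measurable_rdist_simple f g : simple_fun f -> simple_fun g ->
  measurable_fun setT (fun t => rnorm (f t - g t)).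
Proof.
move=> sf sg; have [N [c [v [v' [mc -> ->]]]]] := common_classification sf sg.
exact: (measurable_classified mc (fun k => rnorm (v k - v' k))).
Qed.

Lemma measurable_rdist f g : strongly_measurable f -> strongly_measurable g ->
  measurable_fun setT (fun t => rnorm (f t - g t)).
Proof.
move=> [s [ss sf]] [s' [ss' sg]].
apply: (@measurable_fun_cvg _ _ _ _ (fun n t => rnorm (s n t - s' n t))).
  by move=> n; exact: measurable_rdist_simple.
by move=> t _; apply: cvg_rnorm; apply: cvgB; [exact: sf|exact: sg].
Qed.

Lemma simple_fun0 : simple_fun (fun _ : R => 0 : X).
Proof.
split=> [|x]; last by rewrite preimage_cst; case: ifP.
by apply: (@sub_finite_set _ _ [set 0]) => // _ [t _ <-].
Qed.

Lemma measurable_rnorm f : strongly_measurable f ->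
  measurable_fun setT (fun t => rnorm (f t)).
Proof.
move=> sf; have := measurable_rdist sf (simple_strongly_measurable simple_fun0).
by under eq_fun do rewrite subr0.
Qed.

Lemma nint_rdist_triangle f g h : strongly_measurable f -> strongly_measurable g ->
  strongly_measurable h ->
  (nint (fun t => rnorm (f t - h t)%R) <=
   nint (fun t => rnorm (f t - g t)%R) + nint (fun t => rnorm (g t - h t)%R))%E.
Proof.
move=> mf mg mh; have mfg := measurable_rdist mf mg; have mgh := measurable_rdist mg mh.
rewrite -nintD//; [|by move=> t; exact: rnorm_ge0..].
apply: le_nint; [exact: measurable_rdist|exact: measurable_funD|move=> t].
by rewrite rnorm_ge0 rdist_trans.
Qed.

Lemma is_bochner_unique f y y' :
  is_bochner_integral f y -> is_bochner_integral f y' -> y = y'.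
Proof.
move=> [mf [s [si sf sy]]] [_ [s' [si' sf' sy']]].
apply/eqP; rewrite -subr_eq0; apply/eqP.
apply: (@rcvg_unique _ _ _ \oo _ (fun n => simple_integral (s n) - simple_integral (s' n))).
  exact: cvgB.
apply/cvg_rnormP => e e0; have e2 : 0 < e / 3 by rewrite divr_gt0.
have [N1 h1] := (ecvg0P (fun n => nint_ge0 (fun t => rnorm_ge0 _))).1 sf _ e2.
have [N2 h2] := (ecvg0P (fun n => nint_ge0 (fun t => rnorm_ge0 _))).1 sf' _ e2.
exists (maxn N1 N2) => // n /=; rewrite geq_max subr0 => /andP[/h1 n1 /h2 n2].
rewrite -lte_fin; apply: le_lt_trans (simple_integral_dist (si n) (si' n)) _.
have m := simple_strongly_measurable (si n).1.
have m' := simple_strongly_measurable (si' n).1.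
apply: le_lt_trans (nint_rdist_triangle m mf m') _.
rewrite (eq_nint (g := fun t => rnorm (f t - s n t))); last by move=> t; exact: rdistC.
by apply: le_lt_trans (leeD n1 n2) _; rewrite -EFinD lte_fin; lra.
Qed.

Lemma bochnerE f y : is_bochner_integral f y -> bochner_integral f = y.
Proof.
move=> h; apply: (@is_bochner_unique f) => //.
exact: (xgetPex 0 (ex_intro _ y h)).
Qed.

Lemma rnorm_bochner f y : is_bochner_integral f y ->
  ((rnorm y)%:E <= nint (fun t => rnorm (f t)))%E.
Proof.
move=> [mf [s [si sf sy]]].
apply/lee_addgt0Pr => e e0; have e2 : 0 < e / 2 by rewrite divr_gt0.
have [N1 h1] := (ecvg0P (fun n => nint_ge0 (fun t => rnorm_ge0 _))).1 sf _ e2.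
have [N2 _ h2] := (cvg_rnormP _ _ _).1 sy _ e2.
have := h1 _ (leq_maxl N1 N2); have /= := h2 _ (leq_maxr N1 N2).
move: (maxn N1 N2) => n yn fn.
have i0 : integrable_simple_fun (fun _ : R => 0 : X).
  split=> [|x x0]; first exact: simple_fun0.
  rewrite preimage_cst; case: ifPn => [|_]; last by rewrite measure0.
  by rewrite inE /= => x0'; rewrite -x0' eqxx in x0.
have si0 : simple_integral (fun _ : R => 0 : X) = 0.
  rewrite /simple_integral fsbig1// => x _; have [->|x0] := eqVneq x 0.
    by rewrite scaler0.
  rewrite preimage_cst; case: ifPn => [|_]; last by rewrite measure0 scale0r.
  by rewrite inE /= => x0'; rewrite -x0' eqxx in x0.
have m := simple_strongly_measurable (si n).1.
have m0 := simple_strongly_measurable simple_fun0.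
apply: (@le_trans _ _ ((e / 2)%:E + (rnorm (simple_integral (s n)))%:E)%E).
  rewrite -EFinD lee_fin -lerBlDr; apply: le_trans (ltW yn).
  by rewrite (le_trans (ler_norm _))// rdistC ler_rdist.
apply: (@le_trans _ _ ((e / 2)%:E + ((e / 2)%:E + nint (fun t => rnorm (f t))))%E).
  apply: leeD => //; have := simple_integral_dist (si n) i0.
  rewrite si0 subr0 => /le_trans; apply.
  apply: le_trans (nint_rdist_triangle m mf m0) _; apply: leeD.
    by rewrite (eq_nint (g := fun t => rnorm (f t - s n t)))// => t; exact: rdistC.
  by under eq_nint do rewrite subr0.
by rewrite addeA -EFinD addeC leeD// lee_fin; lra.
Qed.

End BochnerIntegral.

(** * Bochner integrals of continuous functions as limits of Riemann sums *)

Section RiemannSums.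
Context (R : realType).
Local Notation mu := (@lebesgue_measure R).

(** Grid of mesh [1 / (n + 1)] on the interval of radius [n + 1] about [h]. The centre is a
    parameter because translating an integrand amounts to moving the grid. *)
Definition node (n : nat) (h : R) (k : nat) : R :=
  (h - n.+1%:R) + n.+1%:R^-1 * k%:R.

Definition nnodes (n : nat) : nat := (2 * n.+1 * n.+1)%N.

Definition stepf (T : Type) (x0 : T) (n : nat) (h : R) (f : R -> T) : R -> T :=
  step (h - n.+1%:R) n.+1%:R^-1 (nnodes n) x0 (fun k => f (node n h k)).

Lemma mesh_gt0 (n : nat) : 0 < n.+1%:R^-1 :> R.
Proof. by rewrite invr_gt0. Qed.

Lemma mesh_nnodes (n : nat) : n.+1%:R^-1 * (nnodes n)%:R = 2 * n.+1%:R :> R.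
Proof. by rewrite /nnodes !natrM mulrC mulfK. Qed.

Lemma stepfE T (x0 : T) n h (f : R -> T) t :
  (stepf x0 n h f t = x0 /\ n.+1%:R <= `|t - h|) \/
  exists s, stepf x0 n h f t = f s /\ `|s - t| <= n.+1%:R^-1.
Proof.
rewrite /stepf /step cell_lt ?mesh_gt0// mesh_nnodes.
case: ifPn => [ht|ht].
  have [_ h1 h2] : [/\ True, node n h (cell (h - n.+1%:R) n.+1%:R^-1 (nnodes n) t) <= t &
     t < h - n.+1%:R + n.+1%:R^-1 * (cell (h - n.+1%:R) n.+1%:R^-1 (nnodes n) t).+1%:R].
    by have [//|_ ? ?] := @cell_inside _ (h - n.+1%:R) _ (mesh_gt0 n) (nnodes n) t;
      rewrite ?mesh_nnodes.
  right; eexists; split; [by []|].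
  rewrite ler_norml; move: h1 h2; move: (nat_of_ord (cell _ _ _ t)) => k.
  rewrite /node -[k.+1%:R]natr1 mulrDr mulr1.
  have := mesh_gt0 n; move: (n.+1%:R^-1) => d d0 h1 h2.
  by apply/andP; split; lra.
left; split=> //; move: ht; rewrite negb_and -!real_ltNge ?num_real// -real_leNgt ?num_real//.
rewrite ler_normr => /orP[ht|ht]; apply/orP; [right|left]; lra.
Qed.

End RiemannSums.

Section BochnerContinuous.
Context (R : realType) (X : completeNormedModType R[i]).
Local Notation mu := (@lebesgue_measure R).
Implicit Types (f g : R -> X).

(** Among continuous functions, those with this majorant have Riemann sums that converge to
    their Bochner integral; both the windowed orbits and the Gaussian waves below belong to
    the class. *)
Definition wdominated f := exists C : R, forall t, rnorm (f t) <= C * wgt t.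

Definition riemann_sum (n : nat) (h : R) f : X :=
  \sum_(k < nnodes n) (n.+1%:R^-1 : R)%:C *: f (node n h k).

Lemma simple_integral_stepf n h f : simple_integral (stepf 0 n h f) = riemann_sum n h f.
Proof. by rewrite simple_integral_step// mesh_gt0. Qed.

Lemma simple_stepf n h f : integrable_simple_fun (stepf 0 n h f).
Proof. by apply: integrable_simple_step; exact: mesh_gt0. Qed.

Lemma stepf_cvg f (h : R) t : continuous f -> stepf 0 n h f t @[n --> \oo] --> f t.
Proof.
move=> cf; apply/cvg_rnormP => e e0.
have /cvg_rnormP/(_ e e0) := cf t.
rewrite -nbhs_nearE => /nbhs_ballP[d d0 hd].
have [N1 _ hN1] := near_infty_natSinv_lt (PosNum d0).
exists (maxn N1 (Num.bound `|t - h|)) => // n /=; rewrite geq_max => /andP[n1 n2].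
have [[_]|[s [-> hs]]] := stepfE (0 : X) n h f t.
  rewrite leNgt (lt_le_trans (archi_boundP (normr_ge0 _)))//.
  by rewrite ler_nat (leq_trans n2).
apply: hd; rewrite /ball /= distrC; apply: le_lt_trans hs _; exact: hN1.
Qed.

Lemma strongly_measurable_continuous f : continuous f -> strongly_measurable f.
Proof.
move=> cf; exists (fun n => stepf 0 n 0 f); split=> [n|t]; last exact: stepf_cvg.
exact: (simple_stepf n 0 f).1.
Qed.

Lemma rnorm_stepf_le f C n h t : (forall t, rnorm (f t) <= C * wgt t) ->
  rnorm (stepf 0 n h f t) <= 3 * C * wgt t.
Proof.
move=> fC; have C0 : 0 <= C.
  by have := le_trans (rnorm_ge0 _) (fC 0); rewrite pmulr_lge0// wgt_gt0.
have [[-> _]|[s [-> hs]]] := stepfE (0 : X) n h f t.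
  by rewrite rnorm0 !mulr_ge0 ?wgt_ge0.
apply: le_trans (fC s) _; rewrite (_ : 3 * C * wgt t = C * (3 * wgt t)); last by ring.
by rewrite ler_wpM2l// wgt_shift// (le_trans hs)// invf_le1 ?ler1n ?ltr0n.
Qed.

Lemma nint_stepf_cvg f (h : R) : continuous f -> wdominated f ->
  nint (fun t => rnorm (f t - stepf 0 n h f t)) @[n --> \oo] --> 0%E.
Proof.
move=> cf [C fC]; apply: (@nint_wgt_cvg0 _ _ (C + 3 * C)) => [n|n t|t].
- apply: measurable_rdist; first exact: strongly_measurable_continuous.
  by apply: simple_strongly_measurable; exact: (simple_stepf n h f).1.
- rewrite rnorm_ge0 mulrDl (le_trans (rnormB _ _))// lerD// rnorm_stepf_le//.
- apply/cvg_rnorm0P; rewrite -[X in _ --> X](subrr (f t)); apply: cvgB; first exact: cvg_cst.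
  exact: stepf_cvg.
Qed.

Lemma riemann_sum_cauchy f (h : R) : continuous f -> wdominated f ->
  cvg (riemann_sum n h f @[n --> \oo]).
Proof.
move=> cf df; apply: rcauchy_cvg => e e0; have e2 : 0 < e / 2 by rewrite divr_gt0.
have [N hN] := (ecvg0P (fun n => nint_ge0 (fun t => rnorm_ge0 _))).1 (nint_stepf_cvg h cf df) _ e2.
exists N => m n /hN hm /hN hn; rewrite -lee_fin -!simple_integral_stepf.
apply: le_trans (simple_integral_dist (simple_stepf _ _ _) (simple_stepf _ _ _)) _.
have ms k := simple_strongly_measurable (simple_stepf k h f).1.
apply: le_trans (nint_rdist_triangle (ms m) (strongly_measurable_continuous cf) (ms n)) _.
rewrite (eq_nint (g := fun t => rnorm (f t - stepf 0 m h f t))); last by move=> t; exact: rdistC.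
by apply: le_trans (leeD hm hn) _; rewrite -EFinD lee_fin; lra.
Qed.

Lemma is_bochner_lim f (h : R) : continuous f -> wdominated f ->
  is_bochner_integral f (lim (riemann_sum n h f @[n --> \oo])).
Proof.
move=> cf df; split; first exact: strongly_measurable_continuous.
exists (fun n => stepf 0 n h f); split=> [n||].
- exact: simple_stepf.
- exact: nint_stepf_cvg.
- under eq_fun do rewrite simple_integral_stepf.
  exact: riemann_sum_cauchy.
Qed.

Lemma riemann_sum_cvg f (h : R) : continuous f -> wdominated f ->
  riemann_sum n h f @[n --> \oo] --> bochner_integral f.
Proof.
move=> cf df; rewrite (bochnerE (is_bochner_lim h cf df)).
exact: riemann_sum_cauchy.
Qed.

Lemma is_bochner_continuous f : continuous f -> wdominated f ->
  is_bochner_integral f (bochner_integral f).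
Proof. by move=> cf df; rewrite (bochnerE (is_bochner_lim 0 cf df)); exact: is_bochner_lim. Qed.

Lemma rnorm_bochner_le f : continuous f -> wdominated f ->
  ((rnorm (bochner_integral f))%:E <= nint (fun t => rnorm (f t)))%E.
Proof. by move=> cf df; apply: rnorm_bochner; exact: is_bochner_continuous. Qed.

(** Riemann sums may be centred anywhere, and translating the integrand moves their centre. *)
Lemma bochner_shift f (h : R) : continuous f -> wdominated f ->
  bochner_integral (fun t => f (t + h)) = bochner_integral f.
Proof.
move=> cf df; have cg : continuous (fun t => f (t + h)).
  move=> t; apply: continuous_comp; last exact: cf.
  by apply: cvgD; [exact: cvg_id|exact: cvg_cst].
have dg : wdominated (fun t => f (t + h)).
  case: df => C fC; exists (C * (2 * (1 + h ^+ 2))) => t; apply: le_trans (fC _) _.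
  have C0 : 0 <= C.
    by have := le_trans (rnorm_ge0 _) (fC 0); rewrite pmulr_lge0// wgt_gt0.
  rewrite -mulrA ler_wpM2l// /wgt /oneDsqr.
  have p (s : R) : 0 < 1 + s ^+ 2 by rewrite ltr_pwDl// sqr_ge0.
  rewrite -lef_pV2 ?posrE ?mulr_gt0 ?invr_gt0// invfM !invrK.
  rewrite mulrC ler_pdivrMr ?mulr_gt0//.
  by have := sqr_ge0 (t + h + h); have := mulr_ge0 (sqr_ge0 (t + h)) (sqr_ge0 h); have := sqr_ge0 (t + h); lra.
apply: rcvg_unique (riemann_sum_cvg 0 cg dg) _.
rewrite [X in X @ _ --> _](_ : _ = fun n => riemann_sum n h f); first exact: riemann_sum_cvg.
apply/funext => n; apply: eq_bigr => k _; congr (_ *: f _); rewrite /node; ring.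
Qed.

Lemma continuous_linear_comb (a : R[i]) f g : continuous f -> continuous g ->
  continuous (fun t => a *: f t + g t).
Proof.
by move=> cf cg t; apply: cvgD; [apply: cvgZl_tmp; exact: cf|exact: cg].
Qed.

Lemma wdominated_linear_comb (a : R[i]) f g : wdominated f -> wdominated g ->
  wdominated (fun t => a *: f t + g t).
Proof.
move=> [C fC] [C' gC]; exists (complex.Re `|a| * C + C') => t.
rewrite mulrDl (le_trans (rnormD _ _))// lerD// rnormZ -mulrA ler_wpM2l//.
by rewrite -lecR (RRe_real (ger0_real (normr_ge0 a))) normr_ge0.
Qed.

Lemma bochner_linear_comb (a : R[i]) f g :
  continuous f -> wdominated f -> continuous g -> wdominated g ->
  bochner_integral (fun t => a *: f t + g t) =
  a *: bochner_integral f + bochner_integral g.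
Proof.
move=> cf df cg dg.
apply: rcvg_unique (riemann_sum_cvg 0 (continuous_linear_comb (a := a) cf cg)
  (wdominated_linear_comb a df dg)) _.
rewrite [X in X @ _ --> _](_ : _ =
    fun n => a *: riemann_sum n 0 f + riemann_sum n 0 g).
  by apply: cvgD; [apply: cvgZl_tmp|]; exact: riemann_sum_cvg.
apply/funext => n; rewrite scaler_sumr -big_split /=; apply: eq_bigr => k _.
by rewrite scalerDr !scalerA mulrC.
Qed.

Lemma wdominated0 : wdominated (fun=> 0).
Proof. by exists 0 => t; rewrite rnorm0 mul0r. Qed.

Lemma bochner0 : bochner_integral (fun _ : R => 0 : X) = 0.
Proof.
have c0 : continuous (fun _ : R => 0 : X) by move=> t; exact: cvg_cst.
apply: rcvg_unique (riemann_sum_cvg 0 c0 wdominated0) _.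
rewrite [X in X @ _ --> _](_ : _ = fun=> 0); first exact: cvg_cst.
by apply/funext => n; apply: big1 => k _; rewrite scaler0.
Qed.

Lemma bochner_sum (I : Type) (r : seq I) (a : I -> R[i]) (F : I -> R -> X) :
  (forall i, continuous (F i)) -> (forall i, wdominated (F i)) ->
  [/\ continuous (fun t => \sum_(i <- r) a i *: F i t),
      wdominated (fun t => \sum_(i <- r) a i *: F i t) &
  bochner_integral (fun t => \sum_(i <- r) a i *: F i t) =
  \sum_(i <- r) a i *: bochner_integral (F i)].
Proof.
move=> cF dF; elim: r => [|i r [cr dr br]].
  rewrite (_ : (fun t => _) = (fun _ : R => 0 : X)); last first.
    by apply/funext => t; rewrite big_nil.
  by rewrite big_nil bochner0; split; [move=> t; exact: cvg_cst|exact: wdominated0|].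
rewrite (_ : (fun t => _) = fun t => a i *: F i t + \sum_(i <- r) a i *: F i t); last first.
  by apply/funext => t; rewrite big_cons.
rewrite big_cons -br bochner_linear_comb//; split=> //.
- exact: continuous_linear_comb.
- exact: wdominated_linear_comb.
Qed.

(** No cancellation occurs when the values are nonnegative multiples of a fixed vector. *)
Lemma rnorm_bochner_collinear (psi : R -> R) (x : X) :
  continuous (fun t => (psi t)%:C *: x) -> wdominated (fun t => (psi t)%:C *: x) ->
  (forall t, 0 <= psi t) ->
  (nint (fun t => (psi t * rnorm x)%R) <= (rnorm (bochner_integral (fun t => (psi t)%:C *: x)))%:E)%E.
Proof.
set f := (fun t => _) => cf df psi0.
have fE t : rnorm (f t) = psi t * rnorm x by rewrite rnormZr ger0_norm.
apply/lee_addgt0Pr => e e0; have e2 : 0 < e / 2 by rewrite divr_gt0.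
have [N1 h1] := (ecvg0P (fun n => nint_ge0 (fun t => rnorm_ge0 _))).1 (nint_stepf_cvg 0 cf df) _ e2.
have [N2 _ h2] := (cvg_rnormP _ _ _).1 (riemann_sum_cvg 0 cf df) _ e2.
have := h1 _ (leq_maxl N1 N2); have /= := h2 _ (leq_maxr N1 N2).
move: (maxn N1 N2) => n yn fn.
have m0 := simple_strongly_measurable (simple_fun0 X).
have ms := simple_strongly_measurable (simple_stepf n 0 f).1.
have mf := strongly_measurable_continuous cf.
rewrite (eq_nint (g := fun t => rnorm (f t - 0))); last by move=> t; rewrite subr0 fE.
apply: le_trans (nint_rdist_triangle mf ms m0) _.
apply: le_trans (leeD fn (lexx _)) _.
rewrite (eq_nint (g := stepf 0 n 0 (fun s : R => rnorm (f s)))); last first.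
  by move=> t; rewrite subr0 /stepf /step; case: ifP; rewrite ?rnorm0.
rewrite /nint integral_step; [|exact: mesh_gt0|by move=> k; exact: rnorm_ge0].
rewrite -!EFinD lee_fin.
have -> : \sum_(k < nnodes n) n.+1%:R^-1 * (fun s : R => rnorm (f s)) (node n 0 k) = rnorm (riemann_sum n 0 f).
  transitivity ((\sum_(k < nnodes n) n.+1%:R^-1 * psi (node n 0 k)) * rnorm x).
    by rewrite mulr_suml; apply: eq_bigr => k _; rewrite /= fE mulrA.
  rewrite -[in LHS](ger0_norm (sumr_ge0 _ _)); last first.
    by move=> k _; rewrite mulr_ge0// ltW// mesh_gt0.
  rewrite -rnormZr rmorph_sum scaler_suml; congr rnorm; apply: eq_bigr => k _.
  by rewrite /f scalerA -rmorphM.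
have := le_lt_trans (ler_norm _) (le_lt_trans (ler_rdist _ _) yn); lra.
Qed.

End BochnerContinuous.

(** * The Fejer kernel *)

Section Expi.
Context (R : realType).
Implicit Types x y : R.

Lemma expiD x y : expi (x + y) = expi x * expi y.
Proof. by rewrite /expi cosD sinD; apply/eqP; rewrite eq_complex /= eqxx addrC mulrC eqxx. Qed.

Lemma expi0 : expi (0 : R) = 1.
Proof. by rewrite /expi cos0 sin0. Qed.

Lemma norm_expi x : complex.Re `|expi x| = 1.
Proof. by rewrite normc_def /= cos2Dsin2 sqrtr1. Qed.

Lemma rnorm_expi (X : normedModType R[i]) x (v : X) : rnorm (expi x *: v) = rnorm v.
Proof. by rewrite rnormZ norm_expi mul1r. Qed.

Lemma expi_half x : 1 + 2^-1 * expi x + 2^-1 * expi (- x) = (1 + cos x)%:C.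
Proof.
have h : (2^-1 : R[i]) = (2^-1)%:C by rewrite fmorphV /= rmorph_nat.
rewrite h /expi cosN sinN; apply/eqP; rewrite eq_complex; simpc => /=.
by apply/andP; split=> //; apply/eqP; field.
Qed.

Lemma sin_MVT x y : x < y -> exists2 c, x < c < y & sin y - sin x = cos c * (y - x).
Proof.
move=> xy; have [c] := @MVT R sin cos x y xy (fun c _ => is_derive_sin c)
  (continuous_subspaceT (@continuous_sin R)).
by rewrite in_itv /= => hc e; exists c.
Qed.

Lemma cos_MVT x y : x < y -> exists2 c, x < c < y & cos y - cos x = - sin c * (y - x).
Proof.
move=> xy; have [c] := @MVT R cos (fun c => - sin c) x y xy (fun c _ => is_derive_cos c)
  (continuous_subspaceT (@continuous_cos R)).
by rewrite in_itv /= => hc e; exists c.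
Qed.

Lemma sin_abs_le1 x : `|sin x| <= 1.
Proof. by rewrite ler_norml sin_geN1 sin_le1. Qed.

Lemma cos_abs_le1 x : `|cos x| <= 1.
Proof. by rewrite ler_norml cos_geN1 cos_le1. Qed.

Lemma sin_lip x y : `|sin x - sin y| <= `|x - y|.
Proof.
wlog xy : x y / x < y => [h|].
  have [|yx|->] := ltgtP x y; [exact: h| |by rewrite !subrr].
  by rewrite distrC [leRHS]distrC h.
have [c _ h] := sin_MVT xy.
by rewrite distrC h normrM [leRHS]distrC ler_piMl// cos_abs_le1.
Qed.

Lemma cos_lip x y : `|cos x - cos y| <= `|x - y|.
Proof.
wlog xy : x y / x < y => [h|].
  have [|yx|->] := ltgtP x y; [exact: h| |by rewrite !subrr].
  by rewrite distrC [leRHS]distrC h.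
have [c _ h] := cos_MVT xy.
by rewrite distrC h normrM [leRHS]distrC ler_piMl// normrN sin_abs_le1.
Qed.

Definition sinc x : R := if x == 0 then 1 else sin x / x.

Lemma sincE x : x * sinc x = sin x.
Proof.
rewrite /sinc; case: eqVneq => [->|x0]; first by rewrite sin0 mul0r.
by rewrite mulrC divfK.
Qed.

Lemma sincN x : sinc (- x) = sinc x.
Proof. by rewrite /sinc oppr_eq0; case: ifP => // _; rewrite sinN invrN mulrNN. Qed.

Lemma sinc_norm x : sinc `|x| = sinc x.
Proof. by case: (ger0P x) => // _; rewrite sincN. Qed.

(** For [0 < a < b], the mean value theorem on [[0, a]] and on [[a, b]] gives
    [sinc b - sinc a = (b - a) (cos c - cos e) / b] for some [c] and [e] in [[0, b]]. *)
Lemma sinc_lip x y : `|sinc x - sinc y| <= `|x - y|.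
Proof.
suff h a b : 0 <= a -> a < b -> `|sinc b - sinc a| <= b - a.
  rewrite -(sinc_norm x) -(sinc_norm y).
  apply: le_trans (ler_dist_dist x y).
  have [xy|yx|->] := ltgtP `|x| `|y|; last by rewrite !subrr.
  - by rewrite distrC [leRHS]distrC [leRHS]ger0_norm ?subr_ge0 ?(ltW xy)// h.
  - by rewrite [leRHS]ger0_norm ?subr_ge0 ?(ltW yx)// h.
move=> a0 ab; have b0 : 0 < b by exact: le_lt_trans ab.
have [d /andP[d0 db]] := sin_MVT b0; rewrite sin0 !subr0 => sb.
have [->|a_neq0] := eqVneq a 0.
  rewrite {2}/sinc eqxx /sinc gt_eqF// sb mulfK ?gt_eqF// subr0 -cos0.
  by apply: le_trans (cos_lip _ _) _; rewrite subr0 gtr0_norm// ltW.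
have {a0}a0 : 0 < a by rewrite lt_neqAle eq_sym a_neq0.
have [c /andP[ac cb] ce] := sin_MVT ab.
have [e /andP[e0 ea]] := sin_MVT a0; rewrite sin0 !subr0 => sa.
have -> : sinc b - sinc a = (b - a) * (cos c - cos e) / b.
  rewrite /sinc !gt_eqF//; have -> : sin b = cos c * (b - a) + cos e * a by rewrite -ce -sa; ring.
  by rewrite sa; field; rewrite !gt_eqF.
rewrite normrM normfV (gtr0_norm b0) ler_pdivrMr// normrM gtr0_norm ?subr_gt0//.
rewrite ler_wpM2l ?subr_ge0 ?(ltW ab)//; apply: le_trans (cos_lip _ _) _.
by rewrite ger0_norm; lra.
Qed.

End Expi.

Section FejerKernel.
Context (R : realType).
Implicit Types t r : R.

(** Its Fourier transform is, up to a constant, the triangle function supported by [[-1, 1]]. *)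
Definition fejer t : R := sinc (t / 2) ^+ 2.

Lemma fejer_ge0 t : 0 <= fejer t. Proof. exact: sqr_ge0. Qed.

Lemma sinc_le1 (x : R) : `|sinc x| <= 1.
Proof.
have h a : 0 < a -> `|sinc a| <= 1.
  move=> a0; rewrite /sinc gt_eqF// normrM normfV (gtr0_norm a0) ler_pdivrMr// mul1r.
  by have := sin_lip a 0; rewrite sin0 !subr0 (gtr0_norm a0).
rewrite -sinc_norm; have := normr_ge0 x; rewrite le_eqVlt => /predU1P[<-|/h//].
by rewrite /sinc eqxx normr1.
Qed.

Lemma fejer_le t : fejer t <= 5 * wgt t.
Proof.
rewrite /wgt /oneDsqr /fejer ler_pdivlMr; last by rewrite ltr_pwDl// sqr_ge0.
have h1 : sinc (t / 2) ^+ 2 <= 1.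
  by have := sinc_le1 (t / 2); rewrite ler_norml => /andP[? ?]; nra.
have h2 : (t / 2 * sinc (t / 2)) ^+ 2 <= 1.
  by rewrite sincE; have := sin_abs_le1 (t / 2); rewrite ler_norml => /andP[? ?]; nra.
move: h1 h2; rewrite exprMn expr_div_n; lra.
Qed.

Lemma fejer_ge t : `|t| <= 1 -> 4^-1 <= fejer t.
Proof.
move=> t1; have := sinc_lip 0 (t / 2); rewrite {1}/sinc eqxx sub0r normrN normrM.
rewrite [`|2^-1|]ger0_norm ?invr_ge0// => h.
have h2 : 2^-1 <= sinc (t / 2) by move: h; rewrite ler_norml => /andP[? ?]; lra.
rewrite /fejer; nra.
Qed.

Lemma fejer_half t : fejer t = fejer (t / 2) * ((1 + cos (t / 2)) / 2).
Proof.
have ct : (1 + cos (t / 2)) / 2 = cos (t / 4) ^+ 2.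
  have -> : t / 2 = t / 4 *+ 2 by rewrite mulr2n; field.
  by rewrite cos_mulr2n mulr2n; field.
rewrite ct /fejer -exprMn; congr (_ ^+ 2).
have -> : t / 2 / 2 = t / 4 by field.
rewrite /sinc; have [->|t0] := eqVneq t 0; first by rewrite !mul0r eqxx cos0 mulr1.
rewrite !mulf_eq0 (negPf t0) !invr_eq0 !pnatr_eq0 /=.
have -> : t / 2 = t / 4 *+ 2 by rewrite mulr2n; field.
by rewrite mulr2n sinD; field; rewrite t0 -mulr2n mulrn_eq0.
Qed.

(** The factor [h] is what summation by parts gains. The decay in [t] is kept because
    [t * sinc (t / 2)] is bounded and Lipschitz, like the sine. *)
Lemma fejer_lip t (h : R) : 0 < h <= 1 ->
  `|fejer t - expR (- h) * fejer (t - h)| <= 36 * h * wgt t.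
Proof.
move=> /andP[h0 h1].
have -> : fejer t - expR (- h) * fejer (t - h) =
  (fejer t - fejer (t - h)) + (1 - expR (- h)) * fejer (t - h) by ring.
apply: le_trans (ler_normD _ _) _.
have e1 : `|(1 - expR (- h)) * fejer (t - h)| <= 15 * h * wgt t.
  have e0 : 0 <= 1 - expR (- h) <= h.
    by rewrite subr_ge0 -{1}expR0 ler_expR oppr_le0 (ltW h0) /=; have := expR_ge1Dx (- h); lra.
  case/andP: e0 => e0 e1; rewrite ger0_norm; last by rewrite mulr_ge0// fejer_ge0.
  have f5 : fejer (t - h) <= 15 * wgt t.
    have := fejer_le (t - h); have : wgt (t - h) <= 3 * wgt t.
      by apply: wgt_shift; rewrite addrC addKr normrN ger0_norm// ltW.
    lra.
  rewrite mulrAC [15 * _ * h]mulrC.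
  by rewrite ler_pM// fejer_ge0.
suff e2 : `|fejer t - fejer (t - h)| <= 21 * h * wgt t.
  by apply: le_trans (lerD e2 e1) _; rewrite -mulrDl -mulrDl -natrD.
rewrite /fejer.
set s := sinc (t / 2); set s' := sinc ((t - h) / 2).
have k1 : `|s| <= 1 by exact: sinc_le1.
have k2 : `|s'| <= 1 by exact: sinc_le1.
have k3 : `|s - s'| <= h.
  apply: le_trans (sinc_lip _ _) _; rewrite (_ : _ - _ = h / 2); last by field.
  by rewrite ger0_norm; lra.
have k4 : `|t * s| <= 2.
  have -> : t * s = 2 * sin (t / 2) by rewrite -sincE /s; field.
  by rewrite normrM ger0_norm//; have := sin_abs_le1 (t / 2); lra.
have k5 : `|(t - h) * s'| <= 2.
  have -> : (t - h) * s' = 2 * sin ((t - h) / 2) by rewrite -sincE /s'; field.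
  by rewrite normrM ger0_norm//; have := sin_abs_le1 ((t - h) / 2); lra.
have k6 : `|t * s - (t - h) * s'| <= h.
  have -> : t * s - (t - h) * s' = 2 * (sin (t / 2) - sin ((t - h) / 2)).
    by rewrite -!sincE /s /s'; field.
  rewrite normrM ger0_norm//; have := sin_lip (t / 2) ((t - h) / 2).
  rewrite (_ : _ / _ - _ = h / 2); last by field.
  by rewrite [`|h / 2|]ger0_norm; lra.
have k7 : `|t * (s - s')| <= 2 * h.
  have -> : t * (s - s') = (t * s - (t - h) * s') - h * s' by ring.
  apply: le_trans (ler_normB _ _) _.
  have : `|h * s'| <= h by rewrite normrM gtr0_norm// ler_piMr// ltW.
  lra.
have k8 : `|t * s'| <= 3.
  have -> : t * s' = (t - h) * s' + h * s' by ring.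
  apply: le_trans (ler_normD _ _) _.
  have : `|h * s'| <= 1 by rewrite normrM gtr0_norm// mulr_ile1// ltW.
  lra.
rewrite /wgt /oneDsqr ler_pdivlMr; last by rewrite ltr_pwDl// sqr_ge0.
rewrite -[1 + t ^+ 2]ger0_norm; last by rewrite addr_ge0// sqr_ge0.
rewrite -normrM.
have -> : (s ^+ 2 - s' ^+ 2) * (1 + t ^+ 2) =
  (s - s') * (s + s') + (t * (s - s')) * (t * s + t * s') by ring.
apply: le_trans (ler_normD _ _) _; rewrite !normrM.
apply: (@le_trans _ _ (h * 2 + (2 * h) * 5)); last by lra.
apply: lerD; apply: ler_pM => //.
- by apply: le_trans (ler_normD _ _) _; lra.
- by rewrite -normrM.
- by apply: le_trans (ler_normD _ _) _; lra.
Qed.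

Lemma continuous_fejer : continuous fejer.
Proof.
move=> t; apply: (@continuous_comp _ _ _ (fun t => sinc (t / 2)) (fun x => x ^+ 2)).
  apply/cvgrPdist_lt => e e0.
  have := nbhsx_ballx t e e0; rewrite nbhs_nearE; apply: filterS => s ts.
  apply: le_lt_trans (sinc_lip _ _) _; rewrite -mulrBl normrM [`|2^-1|]ger0_norm ?invr_ge0//.
  have {}ts : `|t - s| < e by [].
  by have := normr_ge0 (t - s); lra.
exact: exprn_continuous.
Qed.

Definition kappa r t : R := r * fejer (r * t).

Lemma kappa_half r t : kappa r t = kappa (r / 2) t * (1 + cos (r / 2 * t)).
Proof. by rewrite /kappa fejer_half (_ : r * t / 2 = r / 2 * t); field. Qed.

Lemma big_double (V : nmodType) (F : nat -> V) N :
  \sum_(k < N.*2) F k = \sum_(i < N) F i.*2 + \sum_(i < N) F i.*2.+1.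
Proof.
elim: N => [|N IH]; first by rewrite !big_ord0 addr0.
by rewrite doubleS !big_ord_recr /= IH -[LHS]addrA addrACA.
Qed.

(** The Fourier transform of [kappa r] is a triangle on [[-r, r]], the sum of three
    translates of a triangle of half its width, with heights in ratio 1 : 2 : 1; iterate. In
    time this is the double angle formula. The vanishing of [w] at both ends makes the
    induction go through. *)
Lemma kappa_refine r n : exists w : nat -> R,
  [/\ w 0%N = 0, forall i, (2 ^ n.+1 <= i)%N -> w i = 0, forall i, 0 <= w i <= 1 &
   forall t, (kappa r t)%:C =
     \sum_(i < (2 ^ n.+1)%N) (w i * kappa (r / 2 ^+ n) t)%:C * expi ((- r + i%:R * (r / 2 ^+ n)) * t)].
Proof.
elim: n => [|n [w [w0 wN w01 IH]]].
  (* at level 0 the grid points are - r and 0, and all the mass sits at 0 *)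
  exists (fun i => (i == 1%N)%:R); split=> // [[|[|i]]//|[|[|i]]|t]; rewrite ?lexx ?ler01//.
  by rewrite !big_ord_recl big_ord0 /= mul0r rmorph0 mul0r add0r addr0 !mul1r expr0 divr1 addrC subrr mul0r expi0 mulr1.
(* linear interpolation of the coarse weights *)
pose N := (2 ^ n.+1)%N; pose w' i := if odd i then (w i./2 + w i./2.+1) / 2 else w i./2.
exists w'; split.
- by rewrite /w' /= w0.
- move=> i; rewrite expnS mul2n => Ni; have hi : (2 ^ n.+1 <= i./2)%N by rewrite geq_half_double.
  by rewrite /w' !wN// ?addr0 ?mul0r ?if_same// ltnW.
- move=> i; rewrite /w'; case: ifP => _ //; have := w01 i./2; have := w01 i./2.+1; lra.
move=> t; rewrite IH; set rho := r / 2 ^+ n; set rho' := r / 2 ^+ n.+1.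
have rhoE : rho = 2 * rho' by rewrite /rho /rho' exprS; field; rewrite expf_neq0.
pose e (k : R) : R[i] := (kappa rho' t)%:C * expi ((- r + k * rho') * t).
transitivity (\sum_(i < N) ((w i)%:C * e (i.*2)%:R + (w i / 2)%:C * e ((i.*2)%:R + 1) + (w i / 2)%:C * e ((i.*2)%:R - 1))).
  apply: eq_bigr => i _; rewrite kappa_half (_ : rho / 2 = rho'); last by rewrite rhoE; field.
  rewrite mulrA [X in X * _]rmorphM /= -expi_half [X in X * _ * _]rmorphM /=.
  rewrite /e -muln2 natrM.
  have -> : (- r + (i%:R * 2 + 1) * rho') * t = (- r + i%:R * rho) * t + rho' * t by rewrite rhoE; ring.
  have -> : (- r + (i%:R * 2 - 1) * rho') * t = (- r + i%:R * rho) * t - rho' * t by rewrite rhoE; ring.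
  have -> : (- r + (i%:R * 2) * rho') * t = (- r + i%:R * rho) * t by rewrite rhoE; ring.
  have h2 (a : R) : (a / 2)%:C = a%:C * 2^-1 :> R[i] by rewrite rmorphM /= fmorphV /= rmorph_nat.
  by rewrite !expiD h2; move: (kappa rho' t)%:C => K; ring.
rewrite expnS mul2n
  (big_double (fun k => (w' k * kappa rho' t)%:C * expi ((- r + k%:R * rho') * t)) N).
rewrite !big_split /= -addrA; congr (_ + _).
  by apply: eq_bigr => i _; rewrite /w' odd_double doubleK rmorphM /= -mulrA.
transitivity (\sum_(i < N) ((w i / 2)%:C * e ((i.*2)%:R + 1) + (w i.+1 / 2)%:C * e ((i.*2)%:R + 1))).
  rewrite big_split /=; congr (_ + _).
  have -> : \sum_(i < N) (w i / 2)%:C * e ((i.*2)%:R - 1) =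
    \sum_(i < N.+1) (w i / 2)%:C * e ((i.*2)%:R - 1).
    by rewrite big_ord_recr /= wN// mul0r rmorph0 mul0r addr0.
  rewrite big_ord_recl /= w0 mul0r rmorph0 mul0r add0r; apply: eq_bigr => i _.
  by rewrite /bump leq0n add1n doubleS; congr (_ * e _); rewrite -addn2 natrD; ring.
apply: eq_bigr => i _; rewrite /w' /= odd_double /= uphalf_double /e.
rewrite -[(i.*2).+1%:R]natr1 -mulrDl mulrA; congr (_ * _).
by rewrite -rmorphD /= -rmorphM /= [in RHS]mulrDl.
Qed.

End FejerKernel.

(** * Gaussian test functions *)

Section GaussianTestFunctions.
Context (R : realType).
Implicit Types (P : {poly R}) (c t : R).
Local Notation gauss := (@gauss_fun R).

Lemma is_derive_poly_gauss P c t :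
  is_derive t 1 (fun s => P.[s] * gauss (s + c))
    ((P^`() - 2%:P * ('X + c%:P) * P).[t] * gauss (t + c)).
Proof.
have d1 : is_derive t 1 (fun s : R => - (s + c) ^+ 2) (- (2 * (t + c))).
  by apply: is_derive_eq; rewrite addr0 /GRing.scale /=; ring.
have d2 : is_derive t 1 (fun s : R => gauss (s + c)) (- (2 * (t + c)) * gauss (t + c)).
  by apply: (is_derive_eq (is_derive1_comp (is_derive_expR _) d1)); rewrite mulrC.
apply: is_derive_eq; rewrite !hornerE /=.
transitivity (P.[t] * (- (2 * (t + c)) * gauss (t + c)) + gauss (t + c) * P^`().[t]) => //.
ring.
Qed.

Lemma gauss_pow_bounded (i : nat) : exists K, forall t, `|t ^+ i| * gauss t <= K.
Proof.
exists (1 + i`!%:R) => t.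
have h : (t ^+ 2) ^+ i * gauss t <= i`!%:R.
  case: i => [|i]; first by rewrite expr0 mul1r gauss_fun_le1.
  have := @expR_ge1Dxn R (t ^+ 2) i (sqr_ge0 t); rewrite /gauss_fun expRN.
  move=> e; rewrite ler_pdivrMr ?expR_gt0// mulrC -ler_pdivrMr ?ltr0n ?fact_gt0//.
  by apply: le_trans e; rewrite lerDr.
have : `|t ^+ i| <= 1 + (t ^+ 2) ^+ i.
  rewrite -exprM mulnC exprM; have := sqr_ge0 (`|t ^+ i| - 1).
  by rewrite -[(t ^+ i) ^+ 2]real_normK ?num_real//; nra.
move=> /(ler_wpM2r (gauss_fun_ge0 t)) /le_trans; apply.
by rewrite mulrDl mul1r lerD// gauss_fun_le1.
Qed.

Lemma poly_gauss_bounded P c : exists K, forall t, `|P.[t]| * gauss (t + c) <= K.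
Proof.
suff [K hK] : exists K, forall t, `|(P \Po ('X - c%:P)).[t]| * gauss t <= K.
  exists K => t; have := hK (t + c).
  by rewrite horner_comp !hornerE addrK.
move: (P \Po _) => {}P; have /choice[K hK] := gauss_pow_bounded.
exists (\sum_(i < size P) `|P`_i| * K i) => t.
rewrite horner_coef (le_trans (ler_wpM2r (gauss_fun_ge0 t) (ler_norm_sum _ _ _)))//.
rewrite mulr_suml ler_sum// => i _.
by rewrite normrM -mulrA ler_wpM2l.
Qed.

Lemma cvg_scalec (X : normedModType R[i]) T (F : set_system T) (FF : Filter F)
    (u : T -> R) (l : R) (x : X) :
  u @ F --> l -> (u t)%:C *: x @[t --> F] --> l%:C *: x.
Proof.
move=> ul; apply/cvg_rnormBP.
under eq_fun do rewrite -scalerBl -rmorphB /= rnormZr.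
rewrite -(mul0r (rnorm x)); apply: cvgM; last exact: cvg_cst.
by apply/norm_cvg0P; rewrite -(subrr l); apply: cvgB => //; exact: cvg_cst.
Qed.

Section TestFunction.
Context (X : completeNormedModType R[i]) (N : nat) (a : nat -> X).
Implicit Types Q : nat -> {poly R}.

(** Combinations of translated Gaussians with polynomial factors. The factors are there for
    the sake of derivation, which preserves this shape; only [Q = 1] is transformed below. *)
Definition test Q (t : R) : X :=
  \sum_(j < N) ((Q j).[t] * gauss (t + j%:R))%:C *: a j.

Definition test_step Q (j : nat) : {poly R} :=
  (Q j)^`() - 2%:P * ('X + j%:R%:P) * Q j.

Lemma test_derive Q t :
  difference_quotient (test Q) t h @[h --> 0^'] --> test (test_step Q) t.
Proof.
rewrite (_ : difference_quotient (test Q) t = fun h => \sum_(j < N)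
    (h^-1 * ((Q j).[t + h] * gauss (t + h + j%:R) - (Q j).[t] * gauss (t + j%:R)))%:C *: a j).
  apply: cvg_big => [|j _]; first exact: add_continuous.
  apply: cvg_scalec.
  have [d <-] := is_derive_poly_gauss (Q j) j%:R t.
  rewrite [X in X @ _ --> _](_ : _ = fun h => h^-1 *: (((fun s => (Q j).[s] * gauss (s + j%:R)) \o shift t) (h *: 1) -
     (Q j).[t] * gauss (t + j%:R))) //.
  by apply/funext => h; rewrite /= [_%:A]mulr1 [h + t]addrC.
apply/funext => h; rewrite /difference_quotient /test -sumrB scaler_sumr.
by apply: eq_bigr => j _; rewrite -scalerBl -rmorphB /= scalerA -rmorphM.
Qed.

Lemma iter_rderive_test Q k : iter k (@rderive R X) (test Q) = test (iter k test_step Q).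
Proof.
elim: k => [//|k IH]; rewrite !iterS IH; apply/funext => t.
by apply: rlim; exact: test_derive.
Qed.

Lemma test_schwartz Q : schwartz (test Q).
Proof.
move=> k; rewrite iter_rderive_test; move: (iter k _ Q) => {}Q; split.
  by move=> t; apply: cvgP; exact: test_derive.
move=> m; have /choice[K hK] (j : nat) := poly_gauss_bounded ('X^m * Q j) j%:R.
exists (\sum_(j < N) K j * rnorm (a j)) => t.
rewrite /test (le_trans (ler_wpM2l _ (rnorm_sum _ _ _)))//.
rewrite mulr_sumr ler_sum// => j _; rewrite rnormZr mulrA ler_wpM2r ?rnorm_ge0//.
apply: le_trans (hK j t); rewrite !hornerE normrM mulrA normrM normrX.
by rewrite [`|gauss _|]ger0_norm// gauss_fun_ge0.
Qed.

End TestFunction.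

End GaussianTestFunctions.

(** * Fourier transforms of Gaussian test functions *)

Section AffineSubstitution.
Context (R : realType).

Lemma nint_affine (G : R -> R) (r b : R) : 0 < r -> continuous G -> (forall t, 0 <= G t) ->
  nint G = nint (fun t => r * G (r * t + b)).
Proof.
move=> r0 cG G0; pose F (t : R) := r * t + b.
have dF (t : R) : is_derive t 1 F r.
  by apply: is_derive_eq; rewrite addr0 [_%:A]mulr1.
have F' : F^`()%classic = fun=> r.
  by apply/funext => t; rewrite derive1E; have [_ ->] := dF t.
rewrite /nint (@increasing_ge0_integration_by_substitutionT _ F)//.
- by apply: eq_integral => t _; rewrite /= F' /= mulrC.
- by move=> x y xy; rewrite /F ltrD2r ltr_pM2l.
- by rewrite F' => t; exact: cvg_cst.
- by rewrite F'; exact: is_cvg_cst.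
- by rewrite F'; exact: is_cvg_cst.
- apply/cvgrNyPle => M; exists ((M - b) / r); split; first exact: num_real.
  by move=> x; rewrite ltr_pdivlMr// => h; rewrite /F -lerBrDr mulrC ltW.
- apply/cvgryPge => M; exists ((M - b) / r); split; first exact: num_real.
  by move=> x; rewrite ltr_pdivrMr// => h; rewrite /F -lerBlDr mulrC ltW.
Qed.

End AffineSubstitution.

Section ComplexContinuity.
Context (R : realType).

Lemma Re_normc_le (z : R[i]) : complex.Re `|z| <= `|complex.Re z| + `|complex.Im z|.
Proof.
rewrite normc_def /= -[leRHS]ger0_norm ?addr_ge0// -sqrtr_sqr ler_wsqrtr//.
rewrite sqrrD !real_normK ?num_real// lerD2r lerDl.
by rewrite mulrn_wge0// mulr_ge0.
Qed.

Lemma expi_lip (x y : R) : complex.Re `|expi x - expi y| <= 2 * `|x - y|.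
Proof.
apply: le_trans (Re_normc_le _) _; rewrite /expi /=.
by have := cos_lip x y; have := sin_lip x y; lra.
Qed.

Lemma cvg_expi T (F : set_system T) (FF : Filter F) (u : T -> R) (l : R) :
  u @ F --> l -> expi (u t) @[t --> F] --> (expi l : R[i]^o).
Proof.
move=> /cvgrPdist_lt ul; apply/(@cvg_rnormP R (R[i]^o)) => e e0.
have e2 : 0 < e / 2 by rewrite divr_gt0.
apply: filterS (ul _ e2) => t; rewrite distrC => h.
by apply: le_lt_trans (expi_lip _ _) _; lra.
Qed.

Lemma cvg_complexR T (F : set_system T) (FF : Filter F) (u : T -> R) (l : R) :
  u @ F --> l -> (u t)%:C @[t --> F] --> (l%:C : R[i]^o).
Proof.
move=> /cvgrPdist_lt ul; apply/(@cvg_rnormP R (R[i]^o)) => e e0.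
apply: filterS (ul _ e0) => t; rewrite distrC => h.
suff : complex.Re `|(u t)%:C - l%:C : R[i]| < e by [].
by rewrite -rmorphB normc_def /= expr0n addr0 sqrtr_sqr.
Qed.

Context (X : normedModType R[i]).

Lemma continuous_expiZ (u : R -> R) (f : R -> X) : continuous u -> continuous f ->
  continuous (fun t => expi (u t) *: f t).
Proof. by move=> cu cf t; apply: cvgZ; [apply: cvg_expi; exact: cu|exact: cf]. Qed.

Lemma continuous_realZ (u : R -> R) (f : R -> X) : continuous u -> continuous f ->
  continuous (fun t => (u t)%:C *: f t).
Proof. by move=> cu cf t; apply: cvgZ; [apply: cvg_complexR; exact: cu|exact: cf]. Qed.

Lemma continuous_rnorm (f : R -> X) : continuous f -> continuous (fun t => rnorm (f t)).
Proof. by move=> cf t; apply: cvg_rnorm; exact: cf. Qed.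

Lemma continuous_cst (x : X) : continuous (fun _ : R => x).
Proof. by move=> t; exact: cvg_cst. Qed.

Lemma rnorm_expiB (x y : R) (v : X) :
  rnorm (expi x *: v - expi y *: v) <= 2 * `|x - y| * rnorm v.
Proof. by rewrite -scalerBl rnormZ ler_wpM2r ?rnorm_ge0// expi_lip. Qed.

End ComplexContinuity.

Section FourierOfTestFunctions.
Context (R : realType) (X : completeNormedModType R[i]).
Local Notation gauss := (@gauss_fun R).

(** The integrand of the Fourier transform at [b] of the Gaussian with value [x] at 0. *)
Definition gauss_wave (x : X) (b t : R) : X := expi (- (b * t)) *: ((gauss t)%:C *: x).

Lemma rnorm_gauss_wave x b t : rnorm (gauss_wave x b t) = gauss t * rnorm x.
Proof. by rewrite rnorm_expi rnormZr ger0_norm// gauss_fun_ge0. Qed.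

Lemma gauss_wgt c : exists K : R, 0 < K /\ forall t, gauss (t + c) <= K * wgt t.
Proof.
have [K hK] := poly_gauss_bounded (1 + 'X^2) c.
exists (`|K| + 1); split=> [|t]; first by rewrite ltr_wpDl.
rewrite /wgt ler_pdivlMr; last by rewrite (lt_le_trans ltr01)// oneDsqr_ge1.
have := hK t; rewrite !hornerE ger0_norm ?addr_ge0 ?sqr_ge0// mulrC /oneDsqr.
by move=> /le_trans; apply; rewrite (le_trans (ler_norm _))// lerDl.
Qed.

Lemma continuous_gauss_wave_shift x b c : continuous (fun t => gauss_wave x b (t + c)).
Proof.
have cc : continuous (fun t : R => t + c).
  by move=> t; apply: cvgD; [exact: cvg_id|exact: cvg_cst].
apply: continuous_expiZ.
  move=> t; apply: cvgN; apply: cvgM; [exact: cvg_cst|exact: cc].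
apply: continuous_realZ; last exact: continuous_cst.
by move=> t; apply: continuous_comp; [exact: cc|exact: continuous_gauss_fun].
Qed.

Lemma wdominated_gauss_wave_shift x b c : wdominated (fun t => gauss_wave x b (t + c)).
Proof.
have [K [K0 hK]] := gauss_wgt c; exists (K * rnorm x) => t.
by rewrite rnorm_gauss_wave mulrAC ler_wpM2r ?rnorm_ge0.
Qed.

Lemma gauss_wave_shift0 x b : (fun t => gauss_wave x b (t + 0)) = gauss_wave x b.
Proof. by apply/funext => t; rewrite addr0. Qed.

Lemma continuous_gauss_wave x b : continuous (gauss_wave x b).
Proof. by rewrite -gauss_wave_shift0; exact: continuous_gauss_wave_shift. Qed.

Lemma wdominated_gauss_wave x b : wdominated (gauss_wave x b).
Proof. by rewrite -gauss_wave_shift0; exact: wdominated_gauss_wave_shift. Qed.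

(** Translating a Gaussian multiplies its Fourier transform by a character, so a sum of
    translates is transformed into a trigonometric polynomial times a fixed profile. *)
Lemma fourier_test N (a : nat -> X) b :
  fourier (test N a (fun=> 1)) b =
  bochner_integral (gauss_wave (\sum_(j < N) expi (b * j%:R) *: a j) b).
Proof.
pose c (j : 'I_N) := expi (b * j%:R).
have [_ _ h1] := bochner_sum (index_enum 'I_N) c
  (fun j => @continuous_gauss_wave_shift (a j) b j%:R)
  (fun j => @wdominated_gauss_wave_shift (a j) b j%:R).
have [_ _ h2] := bochner_sum (index_enum 'I_N) c
  (fun j => @continuous_gauss_wave (a j) b) (fun j => @wdominated_gauss_wave (a j) b).
transitivity (\sum_(j < N) c j *: bochner_integral (gauss_wave (a j) b)); last first.
  rewrite -h2; congr bochner_integral; apply/funext => t.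
  rewrite /gauss_wave !scaler_sumr; apply: eq_bigr => j _.
  by rewrite -/(c j) !scalerA -mulrA mulrC.
transitivity (\sum_(j < N) c j *: bochner_integral (fun t => gauss_wave (a j) b (t + j%:R))).
  rewrite -h1 /fourier; congr bochner_integral; apply/funext => t.
  rewrite /test scaler_sumr; apply: eq_bigr => j _.
  rewrite /gauss_wave /c hornerC mul1r [in RHS]scalerA -expiD; congr (expi _ *: _).
  by rewrite mulrDr opprD addrCA subrr addr0.
apply: eq_bigr => j _.
by rewrite (bochner_shift j%:R (@continuous_gauss_wave (a j) b) (@wdominated_gauss_wave (a j) b)).
Qed.

(** At frequency 0 the transform is [x] times the integral of the Gaussian, and it is
    Lipschitz in the frequency. *)
Lemma fourier_gauss_lower : exists c d : R, [/\ 0 < c, 0 < d <= 1 &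
  forall x b, `|b| <= d -> c * rnorm x <= rnorm (bochner_integral (gauss_wave x b))].
Proof.
have [K0 hK0] := poly_gauss_bounded ((1 + 'X^2) * 'X : {poly R}) 0.
pose K := `|K0| + 1.
have K_gt0 : 0 < K by rewrite ltr_wpDl.
have hK t : `|t| * gauss t <= K * wgt t.
  rewrite /wgt ler_pdivlMr; last by rewrite (lt_le_trans ltr01)// oneDsqr_ge1.
  have := hK0 t; rewrite addr0 !hornerE normrM ger0_norm ?addr_ge0 ?sqr_ge0//.
  move=> h; rewrite /oneDsqr mulrC mulrA; apply: le_trans h _.
  by rewrite (le_trans (ler_norm _))// lerDl.
have pi0 := @pi_gt0 R.
pose s := Num.sqrt (pi : R); have s0 : 0 < s by rewrite sqrtr_gt0.
pose d := Num.min 1 (s / (4 * K * pi)).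
have q0 : 0 < s / (4 * K * pi) by rewrite divr_gt0 ?mulr_gt0.
have d0 : 0 < d by rewrite /d; case: (ltP 1 _).
exists (s / 2), d; split; [by rewrite divr_gt0|by rewrite d0 ge_min lexx|move=> x b bd].
have c0 := @continuous_gauss_wave x 0; have cb := @continuous_gauss_wave x b.
have w0 := @wdominated_gauss_wave x 0; have wb := @wdominated_gauss_wave x b.
pose D t := (-1 : R[i]) *: gauss_wave x 0 t + gauss_wave x b t.
have cD : continuous D by exact: continuous_linear_comb.
have wD : wdominated D by exact: wdominated_linear_comb.
have bD : bochner_integral D = bochner_integral (gauss_wave x b) - bochner_integral (gauss_wave x 0).
  by rewrite bochner_linear_comb// scaleN1r addrC.
have g0E : gauss_wave x 0 = fun t => (gauss t)%:C *: x.
  by apply/funext => t; rewrite /gauss_wave mul0r oppr0 expi0 scale1r.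
have low : s * rnorm x <= rnorm (bochner_integral (gauss_wave x 0)).
  rewrite -lee_fin g0E; apply: le_trans (rnorm_bochner_collinear _ _ _).
  - rewrite (eq_nint (g := fun t => rnorm x * gauss t)); last by move=> t; rewrite mulrC.
    rewrite nintZ ?rnorm_ge0//; last exact: gauss_fun_ge0.
      by rewrite /nint integralT_gauss -EFinM mulrC.
    exact: measurable_gauss_fun.
  - by rewrite -g0E.
  - by rewrite -g0E.
  - exact: gauss_fun_ge0.
have upp : rnorm (bochner_integral D) <= s / 2 * rnorm x.
  rewrite -lee_fin; apply: le_trans (rnorm_bochner_le cD wD) _.
  apply: (@le_trans _ _ (nint (fun t => 2 * d * K * rnorm x * wgt t))).
    apply: le_nint.
    - apply: continuous_measurable_fun; exact: continuous_rnorm.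
    - apply: measurable_funM => //; exact: measurable_wgt.
    - move=> t; rewrite rnorm_ge0 /D scaleN1r addrC /gauss_wave.
      apply: le_trans (rnorm_expiB _ _ _) _.
      rewrite mul0r oppr0 subr0 normrN normrM rnormZr (ger0_norm (gauss_fun_ge0 t)).
      rewrite (_ : 2 * (`|b| * `|t|) * (gauss t * rnorm x) =
        (2 * rnorm x) * (`|b| * (`|t| * gauss t))); last by ring.
      rewrite (_ : 2 * d * K * rnorm x * wgt t = (2 * rnorm x) * (d * (K * wgt t))); last by ring.
      rewrite ler_wpM2l ?mulr_ge0 ?rnorm_ge0// ler_pM// ?mulr_ge0 ?gauss_fun_ge0//.
  rewrite nintZ ?nint_wgt; last 3 first.
  - exact: measurable_wgt.
  - exact: wgt_ge0.
  - by rewrite !mulr_ge0 ?rnorm_ge0 ?ltW.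
  rewrite -EFinM lee_fin mulrAC ler_wpM2r ?rnorm_ge0//.
  have : d <= s / (4 * K * pi) by rewrite /d ge_min lexx orbT.
  by rewrite ler_pdivlMr ?mulr_gt0//; lra.
have := le_trans (ler_norm _) (ler_rdist (bochner_integral (gauss_wave x 0)) (bochner_integral (gauss_wave x b))).
rewrite rdistC -bD; lra.
Qed.

End FourierOfTestFunctions.

(** * From Fourier type to trigonometric polynomials *)

Section PowerMean.
Context (R : realType).
Implicit Types (p q : R).

(** Jensen's inequality for weights of total mass at most 1: apply Young's inequality to
    each [alpha j] and the power [p - 1] of the mean. *)
Lemma powR_convex_sum p N (w alpha : nat -> R) : 1 < p ->
  (forall j, 0 <= w j) -> (forall j, 0 <= alpha j) -> \sum_(j < N) w j <= 1 ->
  (\sum_(j < N) w j * alpha j) `^ p <= \sum_(j < N) w j * alpha j `^ p.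
Proof.
move=> p1 w0 al0 w1; have p0 : 0 < p by apply: lt_trans p1.
pose q := p / (p - 1); have pB0 : 0 < p - 1 by rewrite subr_gt0.
have q0 : 0 < q by rewrite divr_gt0.
have pq : p^-1 + q^-1 = 1 by rewrite /q; field; rewrite !gt_eqF.
set A := \sum_(j < N) w j * alpha j; set S := \sum_(j < N) w j * alpha j `^ p.
have A0 : 0 <= A by apply: sumr_ge0 => j _; rewrite mulr_ge0.
suff : A `^ p <= S / p + A `^ p / q.
  have -> : A `^ p / q = A `^ p * (1 - p^-1) by rewrite -pq addrC addKr.
  move=> h; have : A `^ p / p <= S / p by lra.
  by rewrite ler_pM2r ?invr_gt0.
have bq : (A `^ (p - 1)) `^ q = A `^ p.
  by rewrite -powRrM /q; congr (_ `^ _); field; rewrite gt_eqF.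
rewrite -{1}(mulr_powRB1 A0 p0) {1}/A mulr_suml.
apply: (@le_trans _ _ (\sum_(j < N) w j * (alpha j `^ p / p + A `^ p / q))).
  apply: ler_sum => j _; rewrite -mulrA ler_wpM2l//.
  by rewrite -bq conjugate_powR// powR_ge0.
under eq_bigr do rewrite mulrDr mulrA.
rewrite big_split /= -mulr_suml -mulr_suml lerD// ler_piMl//.
by rewrite divr_ge0 ?powR_ge0// ltW.
Qed.

(** Comparison of the sum with the integral of [wgt], cell by cell. *)
Lemma wgt_translates_sum (t : R) N : \sum_(j < N) wgt (t + j%:R) <= 3 * pi.
Proof.
rewrite -lee_fin.
have -> : \sum_(j < N) wgt (t + j%:R) = \sum_(j < N) 1 * wgt (t + j%:R).
  by apply: eq_bigr => j _; rewrite mul1r.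
rewrite -(@integral_step _ t 1 ltr01 N (fun j => wgt (t + j%:R))); last by move=> k; exact: wgt_ge0.
rewrite -/(nint _) EFinM -nint_wgt -nintZ//; [|exact: measurable_wgt|exact: wgt_ge0].
apply: le_nint.
- exact: measurable_step.
- by apply: measurable_funM => //; exact: measurable_wgt.
- move=> s; rewrite /step; case: ifPn => [|_]; last by rewrite lexx mulr_ge0 ?wgt_ge0.
  rewrite cell_lt// => /(cell_inside ltr01)[_]; rewrite !mul1r -natr1 => h1 h2.
  by rewrite wgt_ge0 wgt_shift// ler_norml; apply/andP; split; lra.
Qed.

End PowerMean.

Section HausdorffYoung.
Context (R : realType) (X : completeNormedModType R[i]) (p : R).
Hypotheses (p1 : 1 < p) (hX : fourier_type X p).
Local Notation mu := (@lebesgue_measure R).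
Local Notation gauss := (@gauss_fun R).

Let p0 : 0 < p. Proof. exact: lt_trans p1. Qed.
Let pB0 : 0 < p - 1. Proof. by rewrite subr_gt0. Qed.
Let q := p / (p - 1).
Let q0 : 0 < q. Proof. by rewrite divr_gt0. Qed.

Let hoelderE : hoelder_conjugate p%:E = q%:E.
Proof.
rewrite /hoelder_conjugate /= eqe gt_eqF// -EFinB inver subr_eq0 gt_eqF//.
Qed.

Definition lpsum N (a : nat -> X) : R := \sum_(j < N) rnorm (a j) `^ p.

Definition lpnorm N (a : nat -> X) : R := lpsum N a `^ p^-1.

Lemma lpsum_ge0 N a : 0 <= lpsum N a.
Proof. by apply: sumr_ge0 => j _; exact: powR_ge0. Qed.

Lemma LpX_normE (r : R) (f : R -> X) : 0 < r ->
  (LpX_norm r%:E f `^ r)%E = nint (fun t => rnorm (f t) `^ r).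
Proof.
move=> r0; rewrite /LpX_norm powR_Lnorm ?gt_eqF//; apply: eq_integral => t _.
by rewrite /= ger0_norm ?rnorm_ge0.
Qed.

Lemma continuous_test N (a : nat -> X) : continuous (test N a (fun=> 1)).
Proof.
move=> t; apply: cvg_big => [|j _]; first exact: add_continuous.
apply: cvgZ; last exact: cvg_cst.
apply: cvg_complexR; under eq_fun do rewrite hornerC mul1r.
rewrite hornerC mul1r; apply: continuous_comp; last exact: continuous_gauss_fun.
by apply: cvgD; [exact: cvg_id|exact: cvg_cst].
Qed.

Lemma measurable_powR_continuous (f : R -> R) (r : R) : measurable_fun setT f ->
  measurable_fun setT (fun t => f t `^ r).
Proof. by move=> mf; apply: (measurableT_comp (measurable_powR r)). Qed.

(** The translates of a Gaussian by integers overlap so little that a combination of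
    them is controlled in the mean of order [p] by its coefficients. *)
Lemma nint_test_le : exists C : R, 0 < C /\ forall N (a : nat -> X),
  (nint (fun t => rnorm (test N a (fun=> 1%R) t) `^ p)%R <= (C * lpsum N a)%:E)%E.
Proof.
have [K [K0 hK]] := @gauss_wgt R 0.
pose G := K * (3 * pi); have G0 : 0 < G by rewrite !mulr_gt0 ?pi_gt0.
have sumG t N : \sum_(j < N) gauss (t + j%:R) <= G.
  apply: (@le_trans _ _ (\sum_(j < N) K * wgt (t + j%:R))).
    by apply: ler_sum => j _; have := hK (t + j%:R); rewrite addr0.
  by rewrite -mulr_sumr ler_wpM2l ?(ltW K0)// wgt_translates_sum.
pose C := G `^ p / G * Num.sqrt pi.
exists C; split; first by rewrite mulr_gt0 ?divr_gt0 ?powR_gt0 ?sqrtr_gt0 ?pi_gt0.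
move=> N a.
have pw t : rnorm (test N a (fun=> 1) t) `^ p <=
    \sum_(j < N) G `^ p / G * rnorm (a j) `^ p * gauss (t + j%:R).
  have w1 : \sum_(j < N) gauss (t + j%:R) / G <= 1.
    by rewrite -mulr_suml ler_pdivrMr// mul1r.
  have := powR_convex_sum p1 (w := fun j => gauss (t + j%:R) / G) (alpha := fun j => rnorm (a j))
    (fun j => divr_ge0 (gauss_fun_ge0 _) (ltW G0)) (fun j => rnorm_ge0 _) w1.
  move=> /(ler_wpM2l (powR_ge0 G p)); rewrite -powRM ?(ltW G0)//; last first.
    by apply: sumr_ge0 => j _; rewrite !mulr_ge0 ?gauss_fun_ge0 ?rnorm_ge0// invr_ge0 ltW.
  move=> h; apply: (le_trans _ (le_trans h _)).
    apply: ge0_ler_powR; rewrite ?nnegrE ?rnorm_ge0 ?(ltW p0)//.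
      rewrite mulr_ge0 ?(ltW G0)//; apply: sumr_ge0 => j _.
      by rewrite !mulr_ge0 ?gauss_fun_ge0 ?rnorm_ge0// invr_ge0 ltW.
    rewrite /test (le_trans (rnorm_sum _ _ _))// mulr_sumr ler_sum// => j _.
    rewrite rnormZr hornerC mul1r ger0_norm ?gauss_fun_ge0//.
    by rewrite mulrA mulrCA mulfV ?gt_eqF// mulr1.
  by rewrite mulr_sumr ler_sum// => j _; rewrite le_eqVlt; apply/orP; left; apply/eqP; ring.
have mg (j : nat) : measurable_fun setT (fun t : R => gauss (t + j%:R)).
  apply: continuous_measurable_fun => t.
  apply: continuous_comp; last exact: continuous_gauss_fun.
  by apply: cvgD; [exact: cvg_id|exact: cvg_cst].
have c0 (j : nat) : 0 <= G `^ p / G * rnorm (a j) `^ p.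
  by rewrite !mulr_ge0 ?powR_ge0// invr_ge0 ltW.
apply: (@le_trans _ _ (nint (fun t : R => \sum_(j < N) G `^ p / G * rnorm (a j) `^ p * gauss (t + j%:R))%R)).
  apply: le_nint => [||t]; last by rewrite powR_ge0 pw.
  - apply: measurable_powR_continuous; apply: continuous_measurable_fun.
    by apply: continuous_rnorm; exact: continuous_test.
  - by apply: measurable_sum => j; apply: measurable_funM.
rewrite /nint; under eq_integral do rewrite -sumEFin.
rewrite ge0_integral_sum//; last 2 first.
- by move=> j; apply/measurable_EFinP; apply: measurable_funM => //; exact: mg.
- by move=> j t _; rewrite lee_fin mulr_ge0 ?gauss_fun_ge0.
rewrite /lpsum mulr_sumr -sumEFin; apply: lee_sum => j _.
rewrite -/(nint _) nintZ//; last by move=> t; exact: gauss_fun_ge0.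
have -> : nint (fun t => gauss (t + j%:R)) = (Num.sqrt pi)%:E.
  rewrite -integralT_gauss -[RHS]/(nint gauss) (nint_affine (G := gauss) j%:R ltr01).
  - by apply: eq_nint => t; rewrite !mul1r.
  - exact: continuous_gauss_fun.
  - exact: gauss_fun_ge0.
by rewrite -EFinM lee_fin le_eqVlt; apply/orP; left; apply/eqP; rewrite /C; ring.
Qed.

Definition trigpoly N (a : nat -> X) (b : R) : X := \sum_(j < N) expi (b * j%:R) *: a j.

Lemma continuous_trigpoly N a : continuous (trigpoly N a).
Proof.
move=> b; apply: cvg_big => [|j _]; first exact: add_continuous.
apply: cvgZ; last exact: cvg_cst.
by apply: cvg_expi; apply: cvgM; [exact: cvg_id|exact: cvg_cst].
Qed.

Lemma nint_indic_itv (d : R) : 0 < d -> nint (\1_(`[- d, d]%classic : set R)) = (2 * d)%:E.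
Proof.
have mI : measurable (`[- d, d]%classic : set R) by exact: measurable_itv.
move=> d0; rewrite /nint integral_indic; [|by []|exact: mI].
rewrite setIT; apply: etrans (lebesgue_measure_itv _) _ => /=.
by rewrite lte_fin gtrN// -EFinB; congr EFin; ring.
Qed.

Lemma measurable_indic_itv (d : R) : measurable_fun setT (\1_(`[- d, d]%classic : set R) : R -> R).
Proof.
have mI : measurable (`[- d, d]%classic : set R) by exact: measurable_itv.
exact: measurable_indic mI.
Qed.

(** Near frequency 0 the trigonometric polynomial is dominated by the Fourier transform of
    the corresponding sum of Gaussians, which Fourier type bounds in [L^q]. After
    normalisation by [lpnorm], the inequality [u <= 1 + u ^ q] passes from [L^q] to [L^1] on
    the bounded interval. *)
Lemma hausdorff_young_local : exists d C : R, [/\ 0 < d <= 1, 0 <= C & forall N (a : nat -> X),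
  (nint (fun b => \1_(`[- d, d]%classic : set R) b * rnorm (trigpoly N a b))%R <=
    (C * lpnorm N a)%:E)%E].
Proof.
have [F [[hL _ [K hK]] hS]] := hX; rewrite hoelderE in hL hK.
have [c [d [c0 d01 hc]]] := fourier_gauss_lower X.
have [C1 [C10 hC1]] := nint_test_le.
have d0 : 0 < d by case/andP: d01.
pose K' := `|K| * C1 `^ p^-1.
have K'0 : 0 <= K' by rewrite mulr_ge0 ?powR_ge0.
exists d, (c^-1 * (2 * d + K' `^ q)); split => //.
  by rewrite mulr_ge0 ?invr_ge0 ?(ltW c0)// addr_ge0 ?powR_ge0// mulr_ge0// ltW.
move=> N a; set h := test N a (fun=> 1).
have Lh : (LpX_norm p%:E h <= ((C1 * lpsum N a) `^ p^-1)%:E)%E.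
  rewrite /LpX_norm unlock /= -poweR_EFin; apply: gt0_ler_poweR.
  - by rewrite invr_ge0 ltW.
  - by rewrite in_itv /= leey andbT; apply: integral_ge0 => t _; rewrite lee_fin powR_ge0.
  - by rewrite in_itv /= leey andbT lee_fin mulr_ge0 ?lpsum_ge0// ltW.
  apply: le_trans (hC1 N a); rewrite le_eqVlt; apply/orP; left; apply/eqP.
  by apply: eq_integral => t _; rewrite /= ger0_norm ?rnorm_ge0.
have hh : LpX p%:E h.
  split; first by apply: strongly_measurable_continuous; exact: continuous_test.
  by apply: le_lt_trans Lh _; exact: ltry.
pose B := lpnorm N a; have B0 : 0 <= B by exact: powR_ge0.
have LF : (LpX_norm q%:E (F h) <= (K' * B)%:E)%E.
  apply: le_trans (hK _ hh) _.
  apply: (@le_trans _ _ (`|K|%:E * LpX_norm p%:E h)%E).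
    by apply: lee_wpmul2r; [exact: Lnorm_ge0|rewrite lee_fin ler_norm].
  apply: le_trans (lee_wpmul2l _ Lh) _; first by rewrite lee_fin.
  rewrite -EFinM lee_fin /K' /B /lpnorm powRM ?lpsum_ge0 ?(ltW C10)//.
  by rewrite mulrA.
have [mF _] := hL _ hh.
pose V b := rnorm (F h b); have V0 b : 0 <= V b by exact: rnorm_ge0.
have mV : measurable_fun setT V by exact: measurable_rnorm.
have intV : (nint (fun b => V b `^ q)%R <= ((K' * B) `^ q)%:E)%E.
  rewrite -LpX_normE// -poweR_EFin; apply: gt0_ler_poweR => //; first exact: ltW.
  - by rewrite in_itv /= leey andbT; exact: Lnorm_ge0.
  - by rewrite in_itv /= leey andbT lee_fin mulr_ge0.
have mY : measurable_fun setT (fun b => \1_(`[- d, d]%classic : set R) b * rnorm (trigpoly N a b)).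
  apply: measurable_funM; first exact: measurable_indic_itv.
  by apply: continuous_measurable_fun; apply: continuous_rnorm; exact: continuous_trigpoly.
have i0 b : 0 <= \1_(`[- d, d]%classic : set R) b :> R by rewrite indicE.
have [B_eq0|B_neq0] := eqVneq B 0.
  have a0 (j : 'I_N) : a j = 0.
    move/eqP: B_eq0; rewrite powR_eq0 => /andP[/eqP S0 _].
    have := psumr_eq0P (fun (j : 'I_N) _ => powR_ge0 (rnorm (a j)) p) S0 => /(_ j isT)/powR_eq0_eq0.
    exact: rnorm_eq0.
  rewrite -/B B_eq0 mulr0 (eq_nint (g := fun=> 0)); last first.
    by move=> b; rewrite /trigpoly big1 ?rnorm0 ?mulr0// => j _; rewrite a0 scaler0.
  by rewrite /nint integral0.
have {B0}B0 : 0 < B by rewrite lt_neqAle eq_sym B_neq0.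
pose f2 b := B / c * (\1_(`[- d, d]%classic : set R) b + (B^-1 `^ q) * V b `^ q).
have mq : measurable_fun setT (fun b => B^-1 `^ q * V b `^ q).
  by apply: measurable_funM => //; exact: measurable_powR_continuous.
have f20 b : 0 <= \1_(`[- d, d]%classic : set R) b + (B^-1 `^ q) * V b `^ q.
  by rewrite addr_ge0// mulr_ge0 ?powR_ge0.
have ms : measurable_fun setT (fun b => \1_(`[- d, d]%classic : set R) b + (B^-1 `^ q) * V b `^ q).
  by apply: measurable_funD => //; exact: measurable_indic_itv.
apply: (@le_trans _ _ (nint f2)).
  apply: ae_ge0_le_integral => //.
  - by move=> b _; rewrite lee_fin mulr_ge0// rnorm_ge0.
  - by apply/measurable_EFinP.
  - by move=> b _; rewrite lee_fin mulr_ge0// divr_ge0 ?ltW.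
  - by apply/measurable_EFinP; apply: measurable_funM.
  have Fae := ae_filter_ringOfSetsType mu.
  apply: (@filterS _ _ Fae _ _ _ (hS h (test_schwartz _ _ _))) => b Fh _; rewrite lee_fin.
  rewrite /f2 !indicE; case: (boolP (b \in _)) => [|_]; last first.
    rewrite !mul0r add0r; apply: mulr_ge0; first by rewrite divr_ge0 ?ltW.
    by rewrite mulr_ge0 ?powR_ge0.
  rewrite inE /= in_itv /= -ler_norml => bd; rewrite mul1r.
  have Yb : c * rnorm (trigpoly N a b) <= V b by rewrite /V Fh fourier_test; exact: hc.
  apply: (@le_trans _ _ (V b / c)); first by rewrite ler_pdivlMr// mulrC.
  rewrite mulrAC ler_wpM2r ?invr_ge0 ?(ltW c0)// mulrC -ler_pdivrMr//.
  rewrite -powRM ?invr_ge0 ?(ltW B0)// [B^-1 * _]mulrC.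
  have [vb|vb] := lerP 1 (V b / B).
    apply: (@le_trans _ _ ((V b / B) `^ q)); last by rewrite lerDr.
    by rewrite le1r_powR// /q ler_pdivlMr// mul1r gerBl.
  by apply: le_trans (ltW vb) _; rewrite lerDl powR_ge0.
rewrite /f2 nintZ//; last by rewrite divr_ge0 ?ltW.
rewrite nintD//; last by move=> b; rewrite mulr_ge0 ?powR_ge0.
rewrite nintZ ?powR_ge0//; last 2 first.
- exact: measurable_powR_continuous.
- by move=> b; exact: powR_ge0.
rewrite nint_indic_itv//.
apply: (@le_trans _ _ ((B / c)%:E * ((2 * d)%:E + (B^-1 `^ q)%:E * ((K' * B) `^ q)%:E))%E).
  apply: lee_wpmul2l; first by rewrite lee_fin divr_ge0 ?ltW.
  by apply: leeD => //; apply: lee_wpmul2l => //; rewrite lee_fin powR_ge0.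
rewrite -(EFinM (B^-1 `^ q)) -(EFinD (2 * d)) -(EFinM (B / c)) lee_fin -powRM ?invr_ge0 ?mulr_ge0 ?(ltW B0)//.
  rewrite [B^-1 * _]mulrC mulfK// -/B le_eqVlt; apply/orP; left; apply/eqP.
  by field; rewrite gt_eqF.
exact: powR_ge0.
Qed.

End HausdorffYoung.

Section WeightedHausdorffYoung.
Context (R : realType) (X : completeNormedModType R[i]) (p : R).
Hypotheses (p1 : 1 < p) (hX : fourier_type X p).
Local Notation mu := (@lebesgue_measure R).

Lemma trigpoly_shift N (a : nat -> X) (t s : R) :
  trigpoly N a (t + s) = trigpoly N (fun j => expi (t * j%:R) *: a j) s.
Proof.
apply: eq_bigr => j _.
by rewrite scalerA -expiD mulrDl addrC.
Qed.

Lemma lpnorm_expi N (a : nat -> X) (u : nat -> R) :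
  lpnorm p N (fun j => expi (u j) *: a j) = lpnorm p N a.
Proof.
by rewrite /lpnorm /lpsum; congr (_ `^ _); apply: eq_bigr => j _; rewrite rnorm_expi.
Qed.

(** The local estimate is invariant under translation, hence can be averaged against
    any integrable weight that varies slowly. *)
Lemma hausdorff_young_weighted : exists C : R, 0 <= C /\ forall N (a : nat -> X),
  (nint (fun t => wgt t * rnorm (trigpoly N a t))%R <= (C * lpnorm p N a)%:E)%E.
Proof.
have [d [C [/andP[d0 d1] C0 hC]]] := hausdorff_young_local p1 hX.
have pi0 := @pi_gt0 R.
exists (3 * (pi * C) / (2 * d)); split.
  by rewrite divr_ge0 ?mulr_ge0 ?(ltW pi0) ?(ltW d0).
move=> N a; pose y t := rnorm (trigpoly N a t).
have cy : continuous y by apply: continuous_rnorm; exact: continuous_trigpoly.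
have y0 t : 0 <= y t by exact: rnorm_ge0.
have my : measurable_fun setT y by exact: continuous_measurable_fun.
pose I : set R := `[- d, d]%classic.
have mI : measurable_fun setT (\1_I : R -> R) by exact: measurable_indic_itv.
have I0 s : 0 <= \1_I s :> R by rewrite indicE.
(* integrate over the translation parameter and the time, in both orders *)
pose f (z : R * R) : \bar R := (\1_I z.2 * (wgt z.1 * y (z.1 + z.2)))%:E.
have mf : measurable_fun setT f.
  apply/measurable_EFinP; apply: measurable_funM.
    by apply: measurableT_comp => //; exact: measurable_snd.
  apply: measurable_funM.
    by apply: measurableT_comp; [exact: measurable_wgt|exact: measurable_fst].
  apply: measurableT_comp => //.
  by apply: measurable_funD; [exact: measurable_fst|exact: measurable_snd].
have f0 z : (0 <= f z)%E by rewrite lee_fin !mulr_ge0 ?wgt_ge0.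
pose J := nint (fun t => wgt t * y t).
have cwy : continuous (fun t => wgt t * y t).
  by move=> t; apply: cvgM; [exact: continuous_wgt|exact: cy].
have wy0 t : 0 <= wgt t * y t by rewrite mulr_ge0 ?wgt_ge0.
have cys s : continuous (fun t => y (t + s)).
  move=> t; apply: continuous_comp; last exact: cy.
  by apply: cvgD; [exact: cvg_id|exact: cvg_cst].
have Jfin : J \is a fin_num.
  rewrite ge0_fin_numE ?nint_ge0//.
  pose M := \sum_(j < N) rnorm (a j).
  have M0 : 0 <= M by apply: sumr_ge0 => j _; exact: rnorm_ge0.
  apply: (@le_lt_trans _ _ (nint (fun t => M * wgt t))).
    apply: le_nint => [||t]; first exact: continuous_measurable_fun.
      by apply: measurable_funM => //; exact: measurable_wgt.
    rewrite wy0 mulrC ler_wpM2r ?wgt_ge0// (le_trans (rnorm_sum _ _ _))//.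
    by apply: ler_sum => j _; rewrite rnorm_expi.
  rewrite nintZ//; [|exact: measurable_wgt|exact: wgt_ge0].
  by rewrite nint_wgt -EFinM ltry.
have lower : ((2 * d / 3)%:E * J <= \int[mu]_s \int[mu]_t f (t, s))%E.
  have -> : ((2 * d / 3)%:E * J = nint (fun s => (fine J / 3) * \1_I s)%R)%E.
    rewrite nintZ//; last by rewrite divr_ge0// fine_ge0// nint_ge0.
    by rewrite nint_indic_itv// -[in LHS](fineK Jfin) -!EFinM; congr EFin; ring.
  apply: ge0_le_integral => //.
  - by move=> s _; rewrite lee_fin mulr_ge0// divr_ge0// fine_ge0// nint_ge0.
  - by apply/measurable_EFinP; apply: measurable_funM.
  - exact: (measurable_fun_fubini_tonelli_G (m1 := mu)).
  move=> s _; have [sI|sI] := boolP (s \in I); last first.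
    rewrite indicE (negPf sI) mulr0; apply: integral_ge0 => t _; exact: f0.
  rewrite indicE sI mulr1.
  have -> : (\int[mu]_t f (t, s))%E = nint (fun t => wgt t * y (t + s)).
    by apply: eq_integral => t _; rewrite /f /= indicE sI mul1r.
  have -> : (fine J / 3)%:E = (3^-1%:E * J)%E by rewrite -[in RHS](fineK Jfin) -EFinM mulrC.
  have -> : J = nint (fun t => wgt (t + s) * y (t + s)).
    by rewrite /J (nint_affine s ltr01 cwy wy0); apply: eq_nint => t; rewrite !mul1r.
  have cws : continuous (fun t => wgt (t + s) * y (t + s)).
    move=> t; apply: cvgM; last exact: cys.
    apply: (@continuous_comp _ _ _ (fun t : R => t + s) (@wgt R)); last exact: continuous_wgt.
    by apply: cvgD; [exact: cvg_id|exact: cvg_cst].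
  have mws := continuous_measurable_fun cws.
  rewrite -nintZ//.
  apply: le_nint.
  - exact: measurable_funM.
  - apply: measurable_funM; first exact: measurable_wgt.
    by apply: continuous_measurable_fun.
  move=> t; apply/andP; split; first by rewrite mulr_ge0// mulr_ge0 ?wgt_ge0.
  rewrite mulrA ler_wpM2r// ler_pdivrMl// wgt_shift//.
  rewrite addrAC subrr add0r; move: sI; rewrite inE /I /= in_itv /= -ler_norml => /le_trans; apply.
  exact: d1.
have upper : (\int[mu]_s \int[mu]_t f (t, s) <= (pi * C * lpnorm p N a)%:E)%E.
  rewrite -(fubini_tonelli (m1 := mu) (m2 := mu))//.
  have -> : ((pi * C * lpnorm p N a)%:E = nint (fun t => (C * lpnorm p N a) * wgt t)%R)%E.
    rewrite nintZ; [|exact: measurable_wgt|exact: wgt_ge0|by rewrite mulr_ge0 ?powR_ge0].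
    by rewrite nint_wgt -EFinM; congr EFin; ring.
  apply: ge0_le_integral => //.
  - by move=> t _; apply: integral_ge0 => s _; exact: f0.
  - exact: (measurable_fun_fubini_tonelli_F (m2 := mu)).
  - by apply/measurable_EFinP; apply: measurable_funM => //; exact: measurable_wgt.
  move=> t _; rewrite -(lpnorm_expi N a (fun j => t * j%:R)) mulrC EFinM.
  pose g s := \1_I s * rnorm (trigpoly N (fun j => expi (t * j%:R) *: a j) s).
  have -> : (\int[mu]_s f (t, s) = \int[mu]_s ((wgt t)%:E * (g s)%:E))%E.
    by apply: eq_integral => s _; rewrite /f /= -EFinM; congr EFin; rewrite /g /y trigpoly_shift mulrCA.
  rewrite ge0_integralZl_EFin ?wgt_ge0//; last 2 first.
  - by move=> s _; rewrite lee_fin mulr_ge0// rnorm_ge0.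
  - apply/measurable_EFinP; apply: measurable_funM => //; apply: continuous_measurable_fun.
    by apply: continuous_rnorm; exact: continuous_trigpoly.
  by apply: lee_wpmul2l; [rewrite lee_fin wgt_ge0|exact: hC].
have := le_trans lower upper.
rewrite -/y -/J -(fineK Jfin) -EFinM !lee_fin => h.
rewrite -mulrA mulrCA -ler_pdivrMl; last by rewrite invr_gt0 mulr_gt0.
lra.
Qed.

(** Dilation and modulation reduce an arbitrary arithmetic progression of frequencies to the
    integers, without changing the norms of the coefficients. *)
Lemma hausdorff_young_scaled : exists C : R, 0 <= C /\
  forall N (a : nat -> X) (r b : R), 0 < r ->
  (nint (fun t => r * wgt (r * t) * rnorm (\sum_(i < N) expi ((b + i%:R * r) * t) *: a i)%R)%R <=
     (C * lpnorm p N a)%:E)%E.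
Proof.
have [C [C0 hC]] := hausdorff_young_weighted; exists C; split=> // N a r b r0.
apply: le_trans (hC N a).
rewrite [leRHS](nint_affine (G := fun t => wgt t * rnorm (trigpoly N a t)) 0 r0).
- rewrite le_eqVlt; apply/orP; left; apply/eqP; apply: eq_nint => t.
  rewrite addr0 -mulrA; congr (_ * (_ * _)).
  rewrite -[RHS](rnorm_expi (b * t)); congr rnorm; rewrite /trigpoly scaler_sumr.
  apply: eq_bigr => i _; rewrite scalerA -expiD; congr (expi _ *: _).
  by rewrite mulrDl -mulrA mulrC [i%:R * _]mulrC [r * t * _]mulrC.
- move=> t; apply: cvgM; first exact: continuous_wgt.
  by apply: cvg_rnorm; exact: continuous_trigpoly.
- by move=> t; rewrite mulr_ge0 ?wgt_ge0 ?rnorm_ge0.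
Qed.

End WeightedHausdorffYoung.

(** * The rescaled semigroup *)

Section RescaledSemigroup.
Context (R : realType) (X : completeNormedModType R[i]).
Context (T : R -> X -> X) (K : R).
Hypotheses (hT : C0_semigroup T) (K0 : 0 <= K)
  (TK : forall t x, 0 <= t -> rnorm (T t x) <= K * rnorm x).

Lemma semigroup_lin t (a : R[i]) x y : 0 <= t -> T t (a *: x + y) = a *: T t x + T t y.
Proof. by case: hT => h _ _ _ /h[l _]; exact: l. Qed.

Lemma semigroup0 t : 0 <= t -> T t 0 = 0.
Proof.
move=> t0; have := semigroup_lin (-1) 0 0 t0.
by rewrite scaler0 addr0 scaleN1r addNr.
Qed.

Lemma semigroupZ t (a : R[i]) x : 0 <= t -> T t (a *: x) = a *: T t x.
Proof. by move=> t0; have := semigroup_lin a x 0 t0; rewrite semigroup0// !addr0. Qed.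

Lemma semigroupD t x y : 0 <= t -> T t (x + y) = T t x + T t y.
Proof. by move=> t0; have := semigroup_lin 1 x y t0; rewrite !scale1r. Qed.

Lemma semigroupB t x y : 0 <= t -> T t (x - y) = T t x - T t y.
Proof. by move=> t0; rewrite semigroupD// -scaleN1r semigroupZ// scaleN1r. Qed.

Lemma semigroup_sum t (I : Type) (s : seq I) (F : I -> X) : 0 <= t ->
  T t (\sum_(i <- s) F i) = \sum_(i <- s) T t (F i).
Proof.
by move=> t0; elim: s => [|i s IH]; rewrite ?big_nil ?semigroup0// !big_cons semigroupD// IH.
Qed.

Lemma semigroup_at0 x : T 0 x = x. Proof. by case: hT. Qed.

Lemma semigroup_add s t x : 0 <= s -> 0 <= t -> T (s + t) x = T s (T t x).
Proof. by case: hT => _ _ h _; exact: h. Qed.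

Lemma semigroup_modulus x (e : R) : 0 < e -> exists d : R, 0 < d /\
  forall t, 0 <= t <= d -> rnorm (T t x - x) <= e.
Proof.
move=> e0; case: hT => _ _ _ /(_ x)/cvg_rnormP/(_ e e0) [d /= d0 hd].
exists (d / 2); split=> [|t /andP[t0 td]]; first by rewrite divr_gt0.
move: t0; rewrite le_eqVlt => /predU1P[<-|t0].
  by rewrite semigroup_at0 subrr rnorm0 ltW.
apply/ltW/hd => //=; rewrite sub0r normrN gtr0_norm// (le_lt_trans td)//.
by rewrite ltr_pdivrMr// ltr_pMr// ltr1n.
Qed.

Context (r b : R) (r0 : 0 < r).

(** [e^(- l t) T(t)] for [l = r - i b]. *)
Definition rescaled (t : R) (x : X) : X := (expR (- (r * t)))%:C *: (expi (b * t) *: T t x).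

Lemma rescaledD t x y : 0 <= t -> rescaled t (x + y) = rescaled t x + rescaled t y.
Proof. by move=> t0; rewrite /rescaled semigroupD// !scalerDr. Qed.

Lemma rescaledZ t (a : R[i]) x : 0 <= t -> rescaled t (a *: x) = a *: rescaled t x.
Proof.
by move=> t0; rewrite /rescaled semigroupZ// !scalerA; congr (_ *: _); rewrite mulrC mulrA.
Qed.

Lemma rescaledB t x y : 0 <= t -> rescaled t (x - y) = rescaled t x - rescaled t y.
Proof. by move=> t0; rewrite rescaledD// -scaleN1r rescaledZ// scaleN1r. Qed.

Lemma rescaled0 t : 0 <= t -> rescaled t 0 = 0.
Proof. by move=> t0; rewrite /rescaled semigroup0// !scaler0. Qed.

Lemma rescaled_sum t (I : Type) (s : seq I) (F : I -> X) : 0 <= t ->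
  rescaled t (\sum_(i <- s) F i) = \sum_(i <- s) rescaled t (F i).
Proof.
by move=> t0; elim: s => [|i s IH]; rewrite ?big_nil ?rescaled0// !big_cons rescaledD// IH.
Qed.

Lemma rescaled_at0 x : rescaled 0 x = x.
Proof. by rewrite /rescaled !mulr0 oppr0 expR0 expi0 semigroup_at0 !scale1r. Qed.

Lemma rescaled_add s t x : 0 <= s -> 0 <= t -> rescaled (s + t) x = rescaled s (rescaled t x).
Proof.
move=> s0 t0; rewrite /rescaled semigroup_add// !semigroupZ// !mulrDr opprD expRD expiD rmorphM /= !scalerA.
by congr (_ *: _); rewrite -!mulrA; congr (_ * _); rewrite mulrCA.
Qed.

Lemma rnorm_rescaled t x : 0 <= t -> rnorm (rescaled t x) <= K * expR (- (r * t)) * rnorm x.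
Proof.
move=> t0; rewrite /rescaled rnormZr rnorm_expi ger0_norm ?expR_ge0//.
by rewrite mulrAC [leRHS]mulrC ler_wpM2l ?expR_ge0// TK.
Qed.

Lemma rnorm_rescaled_le t x : 0 <= t -> rnorm (rescaled t x) <= K * rnorm x.
Proof.
move=> t0; apply: le_trans (rnorm_rescaled _ t0) _.
rewrite ler_wpM2r ?rnorm_ge0// ler_piMr//.
by rewrite -expR0 ler_expR oppr_le0 mulr_ge0// ltW.
Qed.

Lemma rescaled_modulus x (e : R) : 0 < e -> exists d : R, 0 < d /\
  forall t, 0 <= t <= d -> rnorm (rescaled t x - x) <= e.
Proof.
move=> e0; have e2 : 0 < e / 2 by rewrite divr_gt0.
have [d1 [d10 hd1]] := semigroup_modulus x e2.
pose C := (r + 2 * `|b|) * (rnorm x) + 1.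
have C0 : 0 < C.
  by rewrite ltr_wpDl// mulr_ge0 ?rnorm_ge0// addr_ge0 ?(ltW r0)// mulr_ge0.
exists (Num.min d1 (e / 2 / C)); split.
  by rewrite lt_min d10 divr_gt0.
move=> t /andP[t0]; rewrite le_min => /andP[td1 tC].
have -> : rescaled t x - x = (expR (- (r * t)))%:C *: (expi (b * t) *: (T t x - x)) +
    ((expR (- (r * t)))%:C *: (expi (b * t) *: x - expi 0 *: x) + (expR (- (r * t)) - 1)%:C *: x).
  rewrite /rescaled expi0 scale1r !scalerBr rmorphB /= scalerBl scale1r.
  by rewrite !addrA subrK subrK.
have E1 : 0 <= expR (- (r * t)) <= 1.
  by rewrite expR_ge0 -expR0 ler_expR oppr_le0 mulr_ge0// ltW.
have E2 : 1 - expR (- (r * t)) <= r * t by have := expR_ge1Dx (- (r * t)); lra.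
apply: le_trans (rnormD _ _) _.
have h1 : rnorm ((expR (- (r * t)))%:C *: (expi (b * t) *: (T t x - x))) <= e / 2.
  rewrite rnormZr rnorm_expi ger0_norm; last by case/andP: E1.
  by apply: le_trans (hd1 t _); [rewrite ler_piMl ?rnorm_ge0//; case/andP: E1|rewrite t0].
suff h2 : rnorm ((expR (- (r * t)))%:C *: (expi (b * t) *: x - expi 0 *: x) +
    (expR (- (r * t)) - 1)%:C *: x) <= e / 2 by lra.
apply: (@le_trans _ _ (C * t)); last by move: tC; rewrite ler_pdivlMr// mulrC.
apply: le_trans (rnormD _ _) _; rewrite !rnormZr ger0_norm; last by case/andP: E1.
rewrite distrC ger0_norm; last by rewrite subr_ge0; case/andP: E1.
apply: (@le_trans _ _ (2 * (`|b| * t) * rnorm x + (r * t) * rnorm x)).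
  apply: lerD; last by rewrite ler_wpM2r ?rnorm_ge0.
  apply: (@le_trans _ _ (rnorm (expi (b * t) *: x - expi 0 *: x))).
    by rewrite ler_piMl ?rnorm_ge0//; case/andP: E1.
  by apply: le_trans (rnorm_expiB _ _ _) _; rewrite subr0 normrM (ger0_norm t0).
by rewrite /C; have := rnorm_ge0 x; lra.
Qed.

Lemma rescaled_telescope (h : R) n y : 0 <= h ->
  y - rescaled (n%:R * h) y = \sum_(i < n) rescaled (i%:R * h) (y - rescaled h y).
Proof.
move=> h0; elim: n => [|n IH]; first by rewrite mul0r rescaled_at0 subrr big_ord0.
have nh : 0 <= n%:R * h by rewrite mulr_ge0.
by rewrite big_ord_recr /= -IH rescaledB// -natr1 mulrDl mul1r rescaled_add// addrA subrK.
Qed.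

(** Telescoping [y] into [sum_(i < n) e^(-i l h) T(i h) (y - e^(-l h) T(h) y)] plus a
    remainder is the Neumann series for [1 - e^(-l h) T(h)], which gives this quantitative
    injectivity. *)
Lemma rescaled_gap (h : R) y : 0 < h ->
  (1 - expR (- (r * h))) * rnorm y <= K * rnorm (y - rescaled h y).
Proof.
move=> h0; set q := expR (- (r * h)).
have q0 : 0 <= q by exact: expR_ge0.
have q1 : q < 1 by rewrite /q -expR0 ltr_expR oppr_lt0 mulr_gt0.
have qn (n : nat) : expR (- (r * (n%:R * h))) = q ^+ n.
  by rewrite /q mulrCA -mulrN mulrC expRM_natr.
apply/ler_addgt0Pr => e e0.
have [N _ hN] : \forall n \near \oo, q ^+ n * (K * rnorm y) < e.
  have /cvgrPdist_lt/(_ e e0) : q ^+ n * (K * rnorm y) @[n --> \oo] --> (0 : R).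
    rewrite -(mul0r (K * rnorm y)); apply: cvgM; last exact: cvg_cst.
    by apply: cvg_expr; rewrite ger0_norm.
  apply: filterS => n; rewrite sub0r normrN; apply: le_lt_trans; exact: ler_norm.
have {}hN := hN N (leqnn N).
have h1 : rnorm y <= \sum_(i < N) K * q ^+ i * rnorm (y - rescaled h y) + q ^+ N * (K * rnorm y).
  have e1 : rnorm y <= rnorm (y - rescaled (N%:R * h) y) + rnorm (rescaled (N%:R * h) y).
    by rewrite -{1}[y](subrK (rescaled (N%:R * h) y)) rnormD.
  apply: le_trans e1 _; rewrite (rescaled_telescope _ _ (ltW h0)); apply: lerD.
    apply: le_trans (rnorm_sum _ _ _) _; apply: ler_sum => i _.
    by rewrite -qn rnorm_rescaled// mulr_ge0// ltW.
  rewrite (_ : q ^+ N * (K * rnorm y) = K * q ^+ N * rnorm y); last by rewrite mulrCA mulrA.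
  by rewrite -qn rnorm_rescaled// mulr_ge0// ltW.
have h2 : (1 - q) * \sum_(i < N) K * q ^+ i * rnorm (y - rescaled h y) <= K * rnorm (y - rescaled h y).
  rewrite (_ : \sum_(i < N) _ = (\sum_(i < N) q ^+ i) * (K * rnorm (y - rescaled h y))); last first.
    by rewrite mulr_suml; apply: eq_bigr => i _; rewrite mulrCA -mulrA.
  have gs : (1 - q) * (\sum_(i < N) q ^+ i) = 1 - q ^+ N.
    by rewrite -opprB mulNr -subrX1 opprB.
  rewrite [leLHS]mulrA [X in X * _ <= _]gs.
  by rewrite ler_piMl ?mulr_ge0 ?rnorm_ge0// gerBl exprn_ge0.
have : (1 - q) * rnorm y <= K * rnorm (y - rescaled h y) + (1 - q) * (q ^+ N * (K * rnorm y)).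
  by apply: le_trans (lerD h2 (lexx _)); rewrite -mulrDr ler_wpM2l// subr_ge0 ltW.
move=> /le_trans; apply; rewrite lerD2l; apply: le_trans (ltW hN).
by rewrite ler_piMl ?mulr_ge0 ?exprn_ge0 ?rnorm_ge0// gerBl.
Qed.

End RescaledSemigroup.

(** * Resolvents as derivatives of the rescaled semigroup *)

Section Resolvent.
Context (R : realType) (X : completeNormedModType R[i]).
Context (T : R -> X -> X) (D : set X) (A : X -> X) (K : R).
Hypotheses (hT : C0_semigroup T) (K0 : 0 <= K)
  (TK : forall t x, 0 <= t -> rnorm (T t x) <= K * rnorm x)
  (hA : is_generator T D A).

(** The vector [y] is the value at [x] of the resolvent of [A] at [r - i b]. Existence
    and uniqueness of [y] come later, so this is stated as a relation. The sign makes [b] the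
    frequency of the kernel paired with this resolvent. *)
Definition resolves (r b : R) (y x : X) : Prop := D y /\ (r +i* (- b)) *: y - A y = x.

Lemma cvg_complex U (F : set_system U) (FF : Filter F) (u v : U -> R) (k l : R) :
  u @ F --> k -> v @ F --> l -> (u t +i* v t) @[t --> F] --> ((k +i* l) : R[i]^o).
Proof.
move=> /cvgrPdist_lt uk /cvgrPdist_lt vl; apply/(@cvg_rnormP R (R[i]^o)) => e e0.
have e2 : 0 < e / 2 by rewrite divr_gt0.
apply: filterS2 (uk _ e2) (vl _ e2) => t; rewrite distrC => h1; rewrite distrC => h2.
apply: le_lt_trans (Re_normc_le ((u t +i* v t) - (k +i* l))) _ => /=; lra.
Qed.

(** [e^(- l h)] for [l = r - i b]. *)
Definition decay (r b h : R) : R[i] := (expR (- (r * h)))%:C * expi (b * h).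

Lemma rescaled_decay r b h y : rescaled T r b h y = decay r b h *: T h y.
Proof. by rewrite /rescaled scalerA. Qed.

Lemma decayE r b h : decay r b h = (expR (- (r * h)) * cos (b * h)) +i* (expR (- (r * h)) * sin (b * h)).
Proof. by rewrite /decay /expi; simpc. Qed.

Lemma decay_cvg1 r b : decay r b h @[h --> 0^'+] --> (1 : R[i]^o).
Proof.
have lin (c : R) : c * h @[h --> 0^'+] --> (0 : R).
  apply: cvg_at_right_filter; rewrite -[X in _ --> X](mulr0 c).
  by apply: cvgM; [exact: cvg_cst|exact: cvg_id].
have e1 : expR (- (r * h)) @[h --> 0^'+] --> (1 : R).
  rewrite -(@expR0 R); apply: continuous_cvg; first exact: continuous_expR.
  by rewrite -[X in _ --> X]oppr0; apply: cvgN; exact: lin.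
have c1 : cos (b * h) @[h --> 0^'+] --> (1 : R).
  by rewrite -(@cos0 R); apply: continuous_cvg; [exact: continuous_cos|exact: lin].
have s1 : sin (b * h) @[h --> 0^'+] --> (0 : R).
  by rewrite -[X in _ --> X](@sin0 R); apply: continuous_cvg; [exact: continuous_sin|exact: lin].
rewrite (funext (decayE r b)); apply: (@cvg_complex _ _ _ _ _ 1 0).
  by rewrite -[X in _ --> X](mul1r 1); exact: cvgM.
by rewrite -[X in _ --> X](mul1r 0); exact: cvgM.
Qed.

Lemma decay_derive r b : (h^-1)%:C * (1 - decay r b h) @[h --> 0^'+] --> ((r +i* (- b)) : R[i]^o).
Proof.
have e1 : is_derive (0 : R) 1 (fun h : R => expR (- (r * h))) (- r).
  have d : is_derive (0 : R) 1 (fun h : R => - (r * h)) (- r).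
    by apply: is_derive_eq; rewrite [_%:A]mulr1.
  by apply: (is_derive_eq (is_derive1_comp (is_derive_expR _) d)); rewrite mulr0 oppr0 expR0 mul1r.
have lb : is_derive (0 : R) 1 (fun h : R => b * h) b.
  by apply: is_derive_eq; rewrite [_%:A]mulr1.
have c1 : is_derive (0 : R) 1 (fun h : R => cos (b * h)) 0.
  by apply: (is_derive_eq (is_derive1_comp (is_derive_cos _) lb)); rewrite mulr0 sin0 oppr0 mul0r.
have s1 : is_derive (0 : R) 1 (fun h : R => sin (b * h)) b.
  by apply: (is_derive_eq (is_derive1_comp (is_derive_sin _) lb)); rewrite mulr0 cos0 mul1r.
have quot (f : R -> R) (df : R) : is_derive (0 : R) 1 f df -> h^-1 * (f h - f 0) @[h --> 0^'+] --> df.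
  move=> [d <-]; apply: cvg_dnbhs_at_right.
  rewrite [X in X @ _ --> _](_ : _ = fun h => h^-1 *: ((f \o shift 0) (h *: 1) - f 0)) //.
  by apply/funext => h; rewrite /= [_%:A]mulr1 addr0.
have dc : is_derive (0 : R) 1 (fun h => expR (- (r * h)) * cos (b * h)) (- r).
  apply: (is_derive_eq (is_deriveM e1 c1)).
  by rewrite !mulr0 oppr0 expR0 cos0 scaler0 add0r scale1r.
have ds : is_derive (0 : R) 1 (fun h => expR (- (r * h)) * sin (b * h)) b.
  apply: (is_derive_eq (is_deriveM e1 s1)).
  by rewrite !mulr0 oppr0 expR0 sin0 scale0r addr0 scale1r.
have ec := quot _ _ dc; have es := quot _ _ ds.
rewrite [X in X @ _ --> _](_ : _ = fun h =>
  (- (h^-1 * (expR (- (r * h)) * cos (b * h) - 1))) +i* (- (h^-1 * (expR (- (r * h)) * sin (b * h))))); last first.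
  apply/funext => h; rewrite decayE; apply/eqP; rewrite eq_complex; simpc => /=.
  by apply/andP; split=> //; apply/eqP; ring.
apply: cvg_complex.
  rewrite -[X in _ --> X](opprK r); apply: cvgN; move: ec.
  by rewrite !mulr0 oppr0 expR0 cos0 mulr1.
by apply: cvgN; move: es; rewrite !mulr0 sin0 mulr0; under eq_fun do rewrite subr0.
Qed.

(** The rescaled semigroup has generator [A - l], so resolving the equation for [A] amounts to
    having derivative [- x] at 0 along it. In this form the equation is tested by sums over a
    grid. *)
Lemma resolves_derive r b y x : resolves r b y x ->
  (h^-1)%:C *: (y - rescaled T r b h y) @[h --> 0^'+] --> x.
Proof.
move=> [Dy <-]; case: hA => _ /(_ y Dy) Ay.
rewrite [X in X @ _ --> _](_ : _ = fun h => ((h^-1)%:C * (1 - decay r b h)) *: y -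
    decay r b h *: ((h^-1)%:C *: (T h y - y))).
  apply: cvgB; first by apply: cvgZ; [exact: decay_derive|exact: cvg_cst].
  by rewrite -[A y]scale1r; apply: cvgZ => //; exact: decay_cvg1.
apply/funext => h; rewrite rescaled_decay.
move: (decay r b h) (h^-1)%:C (T h y) => e c z.
by rewrite mulrBr mulr1 scalerBl (scalerA e c) (mulrC e c) !scalerBr scalerA opprB addrA subrK.
Qed.

Lemma derive_resolves r b y x : (h^-1)%:C *: (y - rescaled T r b h y) @[h --> 0^'+] --> x ->
  resolves r b y x.
Proof.
move=> yx; case: hA => hD hAy.
have Ty : (h^-1)%:C *: (T h y - y) @[h --> 0^'+] --> (r +i* (- b)) *: y - x.
  have d1 : (decay r b h)^-1 @[h --> 0^'+] --> (1 : R[i]^o).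
    by rewrite -[1]invr1; apply: cvgV; [exact: oner_neq0|exact: decay_cvg1].
  rewrite [X in X @ _ --> _](_ : _ = fun h => (decay r b h)^-1 *:
      (((h^-1)%:C * (1 - decay r b h)) *: y - (h^-1)%:C *: (y - rescaled T r b h y))).
    rewrite -[_ - x]scale1r; apply: cvgZ; first exact: d1.
    by apply: cvgB => //; apply: cvgZ; [exact: decay_derive|exact: cvg_cst].
  apply/funext => h; rewrite rescaled_decay.
  have d0 : decay r b h != 0.
    apply/eqP => d0; have := norm_expi (b * h).
    have : expi (b * h) = 0.
      apply/eqP; have /eqP := d0; rewrite mulf_eq0 => /orP[|//].
      by rewrite -(rmorph0 (real_complex R)) (inj_eq (@complexI R)) gt_eqF// expR_gt0.
    by move=> ->; rewrite normr0 /= => /eqP; rewrite eq_sym oner_eq0.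
  move: (decay r b h) d0 (h^-1)%:C (T h y) => e e0 c z.
  rewrite mulrBr mulr1 scalerBl (scalerBr c y) opprB [in RHS]addrC [in RHS]addrA subrK.
  by rewrite (scalerA c) -scalerBr scalerA mulrCA mulVf// mulr1.
have Dy : D y by apply/hD; apply: cvgP Ty.
split=> //; have -> : A y = (r +i* (- b)) *: y - x := rcvg_unique _ (hAy _ Dy) Ty.
by rewrite opprB addrCA subrr addr0.
Qed.

(** The limit of [rescaled_gap] as [h] tends to 0. *)
Lemma resolves_bound r b y x : 0 < r -> resolves r b y x -> r * rnorm y <= K * rnorm x.
Proof.
move=> r0 /resolves_derive yx.
rewrite leNgt; apply/negP => lt; have e0 : 0 < (r * rnorm y - K * rnorm x) by rewrite subr_gt0.
have h1 : K * rnorm ((h^-1)%:C *: (y - rescaled T r b h y)) + r * r * h * rnorm y @[h --> 0^'+] -->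
    K * rnorm x + 0.
  apply: cvgD; first by apply: cvgM; [exact: cvg_cst|exact: cvg_rnorm].
  apply: cvg_at_right_filter; rewrite -[X in _ --> X](mul0r (rnorm y)); apply: cvgM; last exact: cvg_cst.
  by rewrite -[X in _ --> X](mulr0 (r * r)); apply: cvgM; [exact: cvg_cst|exact: cvg_id].
move/cvgrPdist_lt/(_ _ e0): h1 => [d /= d0 hd].
pose h := Num.min (d / 2) 1; have h0 : 0 < h by rewrite lt_min divr_gt0 ?ltr01.
have hd2 : h < d.
  by rewrite (@le_lt_trans _ _ (d / 2)) ?ge_min ?lexx// ltr_pdivrMr// ltr_pMr// ltr1n.
have := hd h; rewrite /= sub0r normrN gtr0_norm// => /(_ hd2 h0).
rewrite addr0 distrC => /(le_lt_trans (ler_norm _)).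
rewrite rnormZr gtr0_norm ?invr_gt0// mulrCA.
have gap := rescaled_gap hT K0 TK b r0 y h0.
(* exp(-v) <= 1 - v + v^2 on the positive reals, from exp(v) >= 1 + v *)
have q2 : r - r * r * h <= h^-1 * (1 - expR (- (r * h))).
  rewrite ler_pdivlMl//.
  have rh : 0 < 1 + r * h by rewrite ltr_pwDl// mulr_ge0 ?ltW.
  have : expR (- (r * h)) <= (1 + r * h)^-1.
    by rewrite expRN lef_pV2 ?posrE ?expR_gt0// expR_ge1Dx.
  suff : (1 + r * h)^-1 <= 1 - r * h + (r * h) * (r * h) by lra.
  rewrite -[leLHS]mul1r ler_pdivrMr//.
  have : 0 <= (r * h) * (r * h) * (r * h) by rewrite !mulr_ge0 ?ltW.
  lra.
have : (r - r * r * h) * rnorm y <= h^-1 * (K * rnorm (y - rescaled T r b h y)).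
  apply: le_trans (ler_wpM2r (rnorm_ge0 _) q2) _.
  by rewrite -mulrA ler_wpM2l// invr_ge0 ltW.
lra.
Qed.

End Resolvent.

(** * Existence of resolvents *)

Section ResolventExistence.
Context (R : realType) (X : completeNormedModType R[i]).
Context (T : R -> X -> X) (D : set X) (A : X -> X) (K : R).
Hypotheses (hT : C0_semigroup T) (K0 : 0 <= K)
  (TK : forall t x, 0 <= t -> rnorm (T t x) <= K * rnorm x)
  (hA : is_generator T D A).
Context (r b : R) (r0 : 0 < r) (x : X).
Local Notation rescaled := (rescaled T r b).

Let mesh (m : nat) : R := 2^-1 ^+ m.

Let mesh_gt0 m : 0 < mesh m. Proof. by rewrite exprn_gt0. Qed.

Let mesh_le1 m : mesh m <= 1.
Proof. by rewrite exprn_ile1// invf_le1// ler1n. Qed.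

Let mesh_mul m k : mesh m = (2 ^ k)%:R * mesh (m + k)%N.
Proof.
by rewrite /mesh natrX exprD mulrCA -exprMn mulfV ?pnatr_eq0// expr1n mulr1.
Qed.

Let len m : R := (4 ^ m)%:R * mesh m.

(** A Riemann sum for the Laplace transform of the orbit, with mesh [2 ^- m] on the
    interval [[0, 2 ^ m]]. *)
Definition laplace_sum (m : nat) : X :=
  \sum_(n < (4 ^ m)%N) (mesh m)%:C *: rescaled (n%:R * mesh m) x.

Let nmesh_ge0 (n m : nat) : 0 <= n%:R * mesh m.
Proof. by rewrite mulr_ge0// ltW. Qed.

Lemma laplace_sum_step m :
  laplace_sum m - rescaled (mesh m) (laplace_sum m) = (mesh m)%:C *: (x - rescaled (len m) x).
Proof.
have m0 := ltW (mesh_gt0 m).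
rewrite /laplace_sum rescaled_sum// -sumrB /len (rescaled_telescope hT r b _ x m0) scaler_sumr.
apply: eq_bigr => i _; rewrite rescaledZ// -scalerBr rescaledB//; congr (_ *: (_ - _)).
by rewrite -!rescaled_add// addrC.
Qed.

Lemma tail_small m : rnorm (rescaled (len m) x) <= K * rnorm x / r * mesh m.
Proof.
have lE : len m = (2 ^ m)%:R.
  rewrite /len /mesh (_ : 4 = 2 * 2)%N// expnMn natrM -mulrA natrX -exprMn mulfV ?pnatr_eq0//.
  by rewrite expr1n mulr1.
have l0 : 0 < len m by rewrite lE ltr0n expn_gt0.
apply: le_trans (rnorm_rescaled TK r b x (ltW l0)) _.
rewrite mulrAC -[leRHS]mulrA ler_wpM2l ?mulr_ge0 ?rnorm_ge0//.
rewrite expRN -[mesh m]invrK -invfM lef_pV2 ?posrE ?expR_gt0 ?mulr_gt0 ?invr_gt0//.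
have -> : (mesh m)^-1 = len m by rewrite lE /mesh exprVn invrK natrX.
by have := expR_ge1Dx (r * len m); lra.
Qed.

Let C := K * rnorm x / r.
Let C0 : 0 <= C. Proof. by rewrite divr_ge0 ?mulr_ge0 ?rnorm_ge0// ltW. Qed.

(** The discrete form of [y - S(u) y], as the integral of [S(t) x] over [[0, u]], hence close
    to [u x], when [y] is the Laplace transform and [S] the rescaled semigroup. *)
Lemma laplace_sum_increment m N (s : R) :
  (forall i, (i < N)%N -> rnorm (rescaled (i%:R * mesh m) x - x) <= s) ->
  rnorm (laplace_sum m - rescaled (N%:R * mesh m) (laplace_sum m) - (N%:R * mesh m)%:C *: x)
    <= N%:R * mesh m * (s + K * (C * mesh m)).
Proof.
move=> hs; have m0 := ltW (mesh_gt0 m).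
rewrite (rescaled_telescope hT r b _ _ m0) laplace_sum_step.
have -> : (N%:R * mesh m)%:C *: x = \sum_(i < N) (mesh m)%:C *: x.
  by rewrite sumr_const card_ord mulr_natl rmorphMn /= scalerMnl.
rewrite -sumrB; apply: le_trans (rnorm_sum _ _ _) _.
rewrite -[leRHS]mulrA -[N in N%:R * _]card_ord mulr_natl -sumr_const.
apply: ler_sum => i _; rewrite rescaledZ// -scalerBr rnormZr ger0_norm// ler_wpM2l//.
rewrite rescaledB// addrAC; apply: le_trans (rnormB _ _) _; apply: lerD; first exact: hs.
apply: le_trans (rnorm_rescaled_le K0 TK b r0 _ (nmesh_ge0 _ _)) _.
by rewrite ler_wpM2l// tail_small.
Qed.

(** The sums at two levels have nearly the same increment over one step of the coarser grid,
    and [rescaled_gap] bounds a vector by its increment. *)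
Lemma laplace_sum_cvg : cvg (laplace_sum m @[m --> \oo]).
Proof.
apply: rcauchy_cvg => e e0.
pose G := K * (1 + r) / r + 1.
have G0 : 0 < G by rewrite ltr_wpDl// divr_ge0 ?mulr_ge0 ?addr_ge0 ?(ltW r0).
pose e' := e / G / 6; have e'0 : 0 < e' by rewrite !divr_gt0.
have [d [d0 hd]] := rescaled_modulus hT b r0 x e'0.
have mesh0 : mesh m @[m --> \oo] --> (0 : R).
  by apply: cvg_expr; rewrite ger0_norm// invf_lt1// ltr1n.
have KC0 : 0 < K * C + C + 1 by rewrite ltr_wpDl// (addr_ge0 (mulr_ge0 K0 C0) C0).
have dC : 0 < Num.min d (e' / (K * C + C + 1)) by rewrite lt_min d0 divr_gt0.
have [N _ hN] := (cvgrPdist_lt _ _).1 mesh0 _ dC.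
have key m k : (N <= m)%N -> rnorm (laplace_sum (m + k) - laplace_sum m) <= e / 2.
  move=> /hN; rewrite /= sub0r normrN gtr0_norm// lt_min => /andP[md mC].
  have m0 := ltW (mesh_gt0 m).
  set y := laplace_sum m; set y' := laplace_sum (m + k).
  have h1 : rnorm (y' - rescaled (mesh m) y' - (mesh m)%:C *: x) <=
      mesh m * (e' + K * (C * mesh (m + k))).
    rewrite (mesh_mul m k); apply: laplace_sum_increment => i ik.
    apply: hd; rewrite nmesh_ge0 /= (le_trans _ (ltW md))// (mesh_mul m k).
    by rewrite ler_wpM2r ?(ltW (mesh_gt0 _))// ler_nat ltnW.
  have h2 : rnorm ((y' - y) - rescaled (mesh m) (y' - y)) <= mesh m * (2 * e').
    have -> : (y' - y) - rescaled (mesh m) (y' - y) = (y' - rescaled (mesh m) y' - (mesh m)%:C *: x) +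
        (mesh m)%:C *: rescaled (len m) x.
      rewrite [_ *: rescaled (len m) x](_ : _ = (mesh m)%:C *: x - (y - rescaled (mesh m) y)); last first.
        by rewrite laplace_sum_step scalerBr opprB addrC subrK.
      by rewrite subrKA rescaledB// !opprB addrACA [RHS]addrACA [- y - _]addrC.
    apply: le_trans (rnormD _ _) _; rewrite rnormZr gtr0_norm//.
    have h3 := tail_small m; rewrite -/C in h3.
    have h4 : mesh (m + k) <= mesh m.
      by rewrite (mesh_mul m k) ler_peMl ?(ltW (mesh_gt0 _))// ler1n expn_gt0.
    have h5 : (K * C + C + 1) * mesh m < e'.
      by rewrite mulrC -ltr_pdivlMr.
    apply: (@le_trans _ _ (mesh m * (e' + K * (C * mesh (m + k)) + C * mesh m))).
      by rewrite [leRHS]mulrDr lerD// ler_wpM2l.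
    rewrite ler_wpM2l//.
    have : K * (C * mesh (m + k)) <= K * (C * mesh m) by rewrite !ler_wpM2l.
    lra.
  have := rescaled_gap hT K0 TK b r0 (y' - y) (mesh_gt0 m).
  have q1 : r * mesh m / (1 + r) <= 1 - expR (- (r * mesh m)).
    have rm : 0 < 1 + r * mesh m by rewrite ltr_pwDl// mulr_ge0// ltW.
    have e1 : expR (- (r * mesh m)) <= (1 + r * mesh m)^-1.
      by rewrite expRN lef_pV2 ?posrE ?expR_gt0// expR_ge1Dx.
    have e2 : (1 + r * mesh m)^-1 <= 1 - r * mesh m / (1 + r).
      rewrite -[leLHS]mul1r ler_pdivrMr//.
      have r1 : 0 < 1 + r by rewrite ltr_pwDl// ltW.
      have -> : (1 - r * mesh m / (1 + r)) * (1 + r * mesh m) =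
         1 + r * mesh m * (r * (1 - mesh m)) / (1 + r) by field; rewrite gt_eqF.
      by rewrite lerDl !mulr_ge0 ?invr_ge0 ?subr_ge0 ?mesh_le1 ?(ltW r0) ?(ltW r1).
    lra.
  move=> gap; have := le_trans (ler_wpM2r (rnorm_ge0 (y' - y)) q1) gap.
  move=> /le_trans/(_ (ler_wpM2l K0 h2)) h6.
  have r1 : 0 < 1 + r by rewrite ltr_pwDl// ltW.
  have h7 : rnorm (y' - y) <= K * (1 + r) / r * (2 * e').
    have rm : 0 < r * mesh m / (1 + r) by rewrite divr_gt0 ?mulr_gt0.
    rewrite -(ler_pM2l rm); apply: le_trans h6 _; rewrite le_eqVlt; apply/orP; left; apply/eqP.
    by field; rewrite !gt_eqF.
  apply: le_trans h7 _; apply: (@le_trans _ _ (G * (2 * e'))).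
    by rewrite ler_wpM2r ?lerDl// mulr_ge0// ltW.
  have -> : G * (2 * e') = e / 3 by rewrite /e'; field; rewrite gt_eqF.
  lra.
exists N => m n Nm Nn.
have := rdist_trans (laplace_sum N) (laplace_sum m) (laplace_sum n).
have := key N (m - N)%N (leqnn N); have := key N (n - N)%N (leqnn N).
rewrite !subnKC// [X in _ -> _ -> _ <= _ + X -> _]rdistC; lra.
Qed.

(** The limit of the Laplace sums inherits their increments, hence has derivative [x] along
    the rescaled semigroup. *)
Lemma resolves_exists : exists y, resolves D A r b y x.
Proof.
set y := lim (laplace_sum m @[m --> \oo]); exists y.
have ycvg : laplace_sum m @[m --> \oo] --> y by exact: laplace_sum_cvg.
apply: (derive_resolves hA); apply/cvg_rnormP => e e0.
have e2 : 0 < e / 2 by rewrite divr_gt0.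
have [d [d0 hd]] := rescaled_modulus hT b r0 x e2.
suff claim h : 0 < h <= d -> rnorm (y - rescaled h y - h%:C *: x) <= h * (e / 2).
  exists d => //= h /=; rewrite sub0r normrN => hd' h0; rewrite gtr0_norm// in hd'.
  have -> : (h^-1)%:C *: (y - rescaled h y) - x = (h^-1)%:C *: (y - rescaled h y - h%:C *: x).
    by rewrite [in RHS]scalerBr scalerA -rmorphM /= mulVf ?gt_eqF// scale1r.
  rewrite rnormZr gtr0_norm ?invr_gt0//.
  apply: (@le_lt_trans _ _ (h^-1 * (h * (e / 2)))).
    by rewrite ler_wpM2l ?invr_ge0 ?(ltW h0)// claim// h0 ltW.
  by rewrite mulKf ?gt_eqF// ltr_pdivrMr// ltr_pMr// ltr1n.
move=> /andP[h0 hdle]; apply/ler_addgt0Pr => eta eta0.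
pose Q := (1 + K + K * (1 + K) + h * (K * C) + K + rnorm x + 1).
have Q0 : 0 < Q.
  have := mulr_ge0 (ltW h0) (mulr_ge0 K0 C0); have := rnorm_ge0 x; have := mulr_ge0 K0 K0.
  by rewrite /Q; have := K0; lra.
pose z := eta / Q; have z0 : 0 < z by rewrite divr_gt0.
have [d1 [d10 hd1]] := rescaled_modulus hT b r0 y z0.
have mesh0 : mesh m @[m --> \oo] --> (0 : R).
  by apply: cvg_expr; rewrite ger0_norm// invf_lt1// ltr1n.
have dz : 0 < Num.min d1 z by rewrite lt_min d10.
have [N1 _ hN1] := (cvgrPdist_lt _ _).1 mesh0 _ dz.
have [N2 _ hN2] := (cvg_rnormP _ _ _).1 ycvg _ z0.
have := hN1 _ (leq_maxl N1 N2); have /= := hN2 _ (leq_maxr N1 N2).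
move: (maxn N1 N2) => m ym; rewrite sub0r normrN gtr0_norm// lt_min => /andP[md1 mz].
set Y := laplace_sum m in ym *.
have m0 := ltW (mesh_gt0 m).
pose N := Num.trunc (h / mesh m).
have /andP[N1' N2'] : N%:R <= h / mesh m < N.+1%:R by apply: truncn_itv; rewrite divr_ge0 ?ltW.
rewrite ler_pdivlMr// in N1'; rewrite ltr_pdivrMr// -natr1 mulrDl mul1r in N2'.
pose u := h - N%:R * mesh m.
have u0 : 0 <= u by rewrite subr_ge0.
have um : u <= mesh m by rewrite /u; lra.
have hE : h = N%:R * mesh m + u by rewrite /u addrC subrK.
have nm0 := nmesh_ge0 N m.
have p1 : rnorm ((y - Y) - rescaled h (y - Y)) <= (1 + K) * z.
  apply: le_trans (rnormB _ _) _.
  have := rnorm_rescaled_le K0 TK b r0 (y - Y) (ltW h0).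
  by rewrite rdistC in ym; have := ler_wpM2l K0 (ltW ym); lra.
have p2 : rnorm (Y - rescaled (N%:R * mesh m) Y - (N%:R * mesh m)%:C *: x) <=
    h * (e / 2) + h * (K * C) * z.
  have : rnorm (Y - rescaled (N%:R * mesh m) Y - (N%:R * mesh m)%:C *: x) <=
    N%:R * mesh m * (e / 2 + K * (C * mesh m)).
    apply: laplace_sum_increment => i iN; apply: hd.
    rewrite nmesh_ge0 /= (le_trans _ hdle)// (le_trans _ N1')//.
    by rewrite ler_wpM2r// ler_nat ltnW.
  move=> /le_trans; apply; rewrite -(mulrA h) -mulrDr; apply: ler_pM => //.
    exact: (addr_ge0 (ltW e2) (mulr_ge0 K0 (mulr_ge0 C0 m0))).
  by rewrite lerD2l -(mulrA K); apply: (ler_wpM2l K0); apply: (ler_wpM2l C0); exact: ltW.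
have p3 : rnorm (rescaled (N%:R * mesh m) Y - rescaled h Y) <= K * (1 + K) * z + K * z.
  rewrite hE rescaled_add// -rescaledB//.
  apply: le_trans (rnorm_rescaled_le K0 TK b r0 _ nm0) _.
  rewrite -(mulrA K) -mulrDr ler_wpM2l//.
  have -> : Y - rescaled u Y = ((Y - y) - rescaled u (Y - y)) - (rescaled u y - y).
    by rewrite rescaledB// !opprB addrACA subrK [_ - _ - rescaled u y]addrAC subrr add0r.
  apply: le_trans (rnormB _ _) _; apply: lerD.
    apply: le_trans (rnormB _ _) _.
    have := rnorm_rescaled_le K0 TK b r0 (Y - y) u0.
    by have := ler_wpM2l K0 (ltW ym); lra.
  by apply: hd1; rewrite u0 (le_trans um)// ltW.
have p4 : rnorm (u%:C *: x) <= rnorm x * z.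
  by rewrite rnormZr ger0_norm// mulrC ler_wpM2l ?rnorm_ge0// (le_trans um)// ltW.
have -> : y - rescaled h y - h%:C *: x = ((y - Y) - rescaled h (y - Y)) +
  (Y - rescaled (N%:R * mesh m) Y - (N%:R * mesh m)%:C *: x) + (rescaled (N%:R * mesh m) Y - rescaled h Y) - u%:C *: x.
  rewrite {2}hE rmorphD /= scalerDl rescaledB ?(ltW h0)//.
  move: (rescaled h y) (rescaled h Y) (rescaled (N%:R * mesh m) Y) (_ *: x) (_ *: x) => a1 a2 a3 a4 a5.
  rewrite opprD addrA; congr (_ - _).
  rewrite (addrAC Y) -(addrA (y - Y - _)) subrKA [y - Y - _]addrAC -(addrA Y) subrKA.
  by rewrite opprB [a2 - a1]addrC (addrA y) [- a5 - a2]addrC addrA addrK.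
apply: le_trans (rnormB _ _) _; apply: le_trans (lerD (rnormD _ _) (lexx _)) _.
apply: le_trans (lerD (lerD (rnormD _ _) (lexx _)) (lexx _)) _.
have : z * Q = eta by rewrite /z divfK// gt_eqF.
rewrite /Q; lra.
Qed.

End ResolventExistence.

(** * Orbits seen through a kernel *)

Section KappaBounds.
Context (R : realType).
Implicit Types (r t : R).

Lemma kappa_ge0 r t : 0 <= r -> 0 <= kappa r t.
Proof. by move=> r0; rewrite mulr_ge0// fejer_ge0. Qed.

Lemma kappa_le r t : 0 <= r -> kappa r t <= 5 * (r * wgt (r * t)).
Proof. by move=> r0; rewrite /kappa [leRHS]mulrCA ler_wpM2l// fejer_le. Qed.

Lemma wgt_dilate r t : 0 < r -> wgt (r * t) <= (1 + r ^- 2) * wgt t.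
Proof.
move=> r0; have p (s : R) : 0 < oneDsqr s by rewrite (lt_le_trans ltr01)// oneDsqr_ge1.
rewrite /wgt ler_pdivlMr// mulrC ler_pdivrMr// /oneDsqr exprMn.
have r2 : 0 < r ^+ 2 by rewrite exprn_gt0.
have -> : (1 + r ^- 2) * (1 + r ^+ 2 * t ^+ 2) = 1 + t ^+ 2 + (r ^- 2 + r ^+ 2 * t ^+ 2).
  by field; rewrite gt_eqF.
rewrite lerDl; apply: addr_ge0; first by rewrite invr_ge0 ltW.
by rewrite mulr_ge0 ?sqr_ge0.
Qed.

Lemma continuous_kappa r : continuous (kappa r).
Proof.
move=> t; apply: cvgM; first exact: cvg_cst.
apply: (@continuous_comp _ _ _ (fun t => r * t) (@fejer R)); last exact: continuous_fejer.
by apply: cvgM; [exact: cvg_cst|exact: cvg_id].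
Qed.

Lemma nint_wgt_dilate r : 0 < r -> nint (fun t => r * wgt (r * t)) = (pi : R)%:E.
Proof.
move=> r0; rewrite -nint_wgt [RHS](nint_affine 0 r0 (@continuous_wgt R) (@wgt_ge0 R)).
by apply: eq_nint => t; rewrite addr0.
Qed.

Lemma continuous_wgt_dilate r : continuous (fun t => r * wgt (r * t)).
Proof.
move=> t; apply: cvgM; first exact: cvg_cst.
apply: (@continuous_comp _ _ _ (fun t => r * t) (@wgt R)); last exact: continuous_wgt.
by apply: cvgM; [exact: cvg_cst|exact: cvg_id].
Qed.

(** The scale [r] of the kernel is the size of its derivative, and also the decay rate of
    the rescaled semigroup; this makes the bound uniform in [r]. *)
Lemma kappa_lip r t (h : R) : 0 < r -> 0 < h -> r * h <= 1 ->
  `|h^-1 * (kappa r t - expR (- (r * h)) * kappa r (t - h))| <= 36 * r * (r * wgt (r * t)).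
Proof.
move=> r0 h0 rh; have := @fejer_lip R (r * t) (r * h); rewrite mulr_gt0// rh => /(_ isT) H.
have -> : h^-1 * (kappa r t - expR (- (r * h)) * kappa r (t - h)) =
    (h^-1 * r) * (fejer (r * t) - expR (- (r * h)) * fejer (r * t - r * h)).
  by rewrite /kappa (mulrBr r t h); ring.
have hr : 0 <= h^-1 * r by rewrite mulr_ge0 ?invr_ge0 ?ltW.
rewrite normrM (ger0_norm hr); apply: le_trans (ler_wpM2l hr H) _.
by rewrite le_eqVlt; apply/orP; left; apply/eqP; field; rewrite gt_eqF.
Qed.

End KappaBounds.

Section Windows.
Context (R : realType) (X : completeNormedModType R[i]).
Implicit Types (f g : R -> X).

Definition bounded_by f (M : R) := forall t, rnorm (f t) <= M.

Definition window (k : R -> R) (b : R) f (t : R) : X := (k t)%:C *: (expi (b * t) *: f t).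

Lemma rnorm_window k b f t : rnorm (window k b f t) = `|k t| * rnorm (f t).
Proof. by rewrite /window rnormZr rnorm_expi. Qed.

Lemma continuous_window k b f : continuous k -> continuous f -> continuous (window k b f).
Proof.
move=> ck cf; apply: continuous_realZ => //; apply: continuous_expiZ => //.
by move=> t; apply: cvgM; [exact: cvg_cst|exact: cvg_id].
Qed.

Lemma wdominated_window k b f (C M : R) : (forall t, `|k t| <= C * wgt t) ->
  bounded_by f M -> wdominated (window k b f).
Proof.
move=> kC fM; exists (C * M) => t; rewrite rnorm_window mulrAC.
by apply: ler_pM => //; exact: rnorm_ge0.
Qed.

End Windows.

Section Orbits.
Context (R : realType) (X : completeNormedModType R[i]).
Context (T : R -> X -> X) (K : R).
Hypotheses (hT : C0_semigroup T) (K0 : 0 <= K)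
  (TK : forall t x, 0 <= t -> rnorm (T t x) <= K * rnorm x).

(** The orbit is frozen before time 0, to be bounded and uniformly continuous on the line.
    The frozen part meets only the tail of the kernels. *)
Definition trajectory (x : X) (t : R) : X := T (Num.max t 0) x.

Let max_ge0 (t : R) : 0 <= Num.max t 0. Proof. by rewrite le_max lexx orbT. Qed.

Lemma orbit_ge0 x t : 0 <= t -> trajectory x t = T t x.
Proof. by move=> t0; rewrite /trajectory max_l. Qed.

Lemma rnorm_orbit x t : rnorm (trajectory x t) <= K * rnorm x.
Proof. exact: TK. Qed.

Lemma orbit_diff x s t : s <= t ->
  rnorm (trajectory x t - trajectory x s) <= K * rnorm (T (Num.max t 0 - Num.max s 0) x - x).
Proof.
move=> st; have mst : Num.max s 0 <= Num.max t 0.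
  by rewrite ge_max le_max st le_max lexx orbT.
have d0 : 0 <= Num.max t 0 - Num.max s 0 by rewrite subr_ge0.
have tE : Num.max t 0 = Num.max s 0 + (Num.max t 0 - Num.max s 0) by rewrite addrC subrK.
by rewrite /trajectory {1}tE (semigroup_add hT _ (max_ge0 s) d0) -(semigroupB hT _ _ (max_ge0 s)) TK.
Qed.

Lemma orbit_uniform x (e : R) : 0 < e -> exists d : R, 0 < d /\
  forall s t, `|s - t| <= d -> rnorm (trajectory x s - trajectory x t) <= e.
Proof.
move=> e0; have e1 : 0 < e / (K + 1) by rewrite divr_gt0// ltr_wpDl.
have [d [d0 hd]] := semigroup_modulus hT x e1; exists d; split=> // s t.
wlog st : s t / s <= t => [H|].
  have [st|ts] := leP s t; first exact: H.
  by rewrite distrC rdistC => h; apply: H => //; exact: ltW.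
rewrite distrC ger0_norm ?subr_ge0// rdistC => h.
apply: le_trans (orbit_diff x st) _.
apply: (@le_trans _ _ (K * (e / (K + 1)))).
  apply: ler_wpM2l => //; apply: hd; apply/andP; split.
    by rewrite subr_ge0 ge_max le_max st le_max lexx orbT.
  apply: le_trans h; rewrite /Num.max; case: ltP => t0; case: ltP => s0; lra.
rewrite mulrCA ler_piMr ?(ltW e0)// ler_pdivrMr ?ltr_wpDl// mul1r lerDl//.
Qed.

Lemma continuous_orbit x : continuous (trajectory x).
Proof.
move=> t; apply/cvg_rnormP => e e0; have e2 : 0 < e / 2 by rewrite divr_gt0.
have [d [d0 hd]] := orbit_uniform x e2.
have := nbhsx_ballx t d d0; rewrite nbhs_nearE; apply: filterS => s ts.
apply: (@le_lt_trans _ _ (e / 2)); last by rewrite ltr_pdivrMr// ltr_pMr// ltr1n.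
by apply: hd; rewrite distrC ltW.
Qed.

Lemma continuous_orbit_shift x (s : R) : continuous (fun t => trajectory x (s + t)).
Proof.
move=> t; apply: (@continuous_comp _ _ _ (fun t => s + t) (trajectory x)).
  by apply: cvgD; [exact: cvg_cst|exact: cvg_id].
exact: continuous_orbit.
Qed.

Lemma bounded_orbit_shift x s : bounded_by (fun t => trajectory x (s + t)) (K * rnorm x).
Proof. by move=> t; exact: rnorm_orbit. Qed.

Lemma kappa_wgt (r : R) : 0 < r -> exists C, forall t, `|kappa r t| <= C * wgt t.
Proof.
move=> r0; exists (5 * (r * (1 + r ^- 2))) => t.
rewrite ger0_norm; last exact: kappa_ge0 (ltW r0).
apply: le_trans (kappa_le _ (ltW r0)) _.
by rewrite -!mulrA ler_wpM2l// ler_wpM2l ?(ltW r0)// wgt_dilate.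
Qed.

(** The part of the orbit of [x] near time [s] whose frequencies lie within [r] of [- b]. *)
Definition spectral_part (r b : R) (x : X) (s : R) : X :=
  bochner_integral (window (kappa r) b (fun t => trajectory x (s + t))).

Lemma spectral_window (r b : R) x s : 0 < r ->
  continuous (window (kappa r) b (fun t => trajectory x (s + t))) /\
  wdominated (window (kappa r) b (fun t => trajectory x (s + t))).
Proof.
move=> r0; have [C hC] := kappa_wgt r0; split.
  by apply: continuous_window; [exact: continuous_kappa|exact: continuous_orbit_shift].
exact: wdominated_window hC (bounded_orbit_shift x s).
Qed.

(** The part of the kernel that meets, at time [s], the frozen part of an orbit. *)
Definition kappa_tail (r s t : R) : R := if t < - s then kappa r t else 0.

Lemma measurable_kappa_tail r s : measurable_fun setT (kappa_tail r s).
Proof.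
rewrite (_ : kappa_tail r s = fun t => kappa r t * \1_(`]-oo, (- s)[%classic : set R) t).
  apply: measurable_funM.
    by apply: continuous_measurable_fun; exact: continuous_kappa.
  have mI : measurable (`]-oo, (- s)[%classic : set R) by exact: measurable_itv.
  exact: measurable_indic mI.
apply/funext => t; rewrite /kappa_tail indicE; case: ifPn => ts.
  by rewrite mem_set ?mulr1//= in_itv.
by rewrite memNset ?mulr0//= in_itv/=; exact/negP.
Qed.

Lemma kappa_tail_cvg0 (r : R) : 0 < r -> nint (kappa_tail r M%:R) @[M --> \oo] --> 0%E.
Proof.
move=> r0; have [C hC] := kappa_wgt r0; apply: (@nint_wgt_cvg0 _ _ C).
- by move=> n; exact: measurable_kappa_tail.
- move=> n t; rewrite /kappa_tail; case: ifP => _.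
    by rewrite (kappa_ge0 _ (ltW r0)) /= (le_trans (ler_norm _)).
  by rewrite lexx /= (le_trans _ (hC t)).
- move=> t; apply/cvgrPdist_lt => e e0; exists (Num.bound `|t|) => // n /= nt.
  rewrite /kappa_tail ifF ?subrr ?normr0//; apply/negbTE; rewrite -leNgt lerNl.
  have := archi_boundP (normr_ge0 t); have : (Num.bound `|t|)%:R <= n%:R :> R by rewrite ler_nat.
  have := ler_norm (- t); rewrite normrN; lra.
Qed.

End Orbits.

(** * Summation by parts *)

Section SpectralSums.
Context (R : realType) (X : completeNormedModType R[i]).
Context (T : R -> X -> X) (D : set X) (A : X -> X) (K : R).
Hypotheses (hT : C0_semigroup T) (K0 : 0 <= K)
  (TK : forall t x, 0 <= t -> rnorm (T t x) <= K * rnorm x)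
  (hA : is_generator T D A).
Local Notation trajectory := (trajectory T).

(** Tends to [x] with [h] when [y] is the resolvent of [x]; see [resolves_derive]. *)
Definition residual (r b h : R) (y : X) : X := (h^-1)%:C *: (y - rescaled T r b h y).

(** At nonnegative times, the orbit of [residual]. *)
Definition orbit_quot (r b h : R) (y : X) (t : R) : X :=
  (h^-1)%:C *: (trajectory y t - decay r b h *: trajectory y (t + h)).

(** The transpose of [orbit_quot]. *)
Definition kappa_quot (r h t : R) : R :=
  h^-1 * (kappa r t - expR (- (r * h)) * kappa r (t - h)).

Section OneStep.
Context (r h : R) (r0 : 0 < r) (h0 : 0 < h) (h1 : h <= 1) (rh1 : r * h <= 1).

Lemma continuous_kappa_shift : continuous (fun t => kappa r (t - h)).
Proof.
move=> t; apply: (@continuous_comp _ _ _ (fun t => t - h) (kappa r)).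
  by apply: cvgB; [exact: cvg_id|exact: cvg_cst].
exact: continuous_kappa.
Qed.

Lemma continuous_kappa_quot : continuous (kappa_quot r h).
Proof.
move=> t; apply: cvgM; first exact: cvg_cst.
apply: cvgB; first exact: continuous_kappa.
by apply: cvgM; [exact: cvg_cst|exact: continuous_kappa_shift].
Qed.

Lemma kappa_shift_wgt : exists C, forall t, `|kappa r (t - h)| <= C * wgt t.
Proof.
have [C hC] := kappa_wgt r0; exists (C * 3) => t; apply: le_trans (hC _) _.
have C0 : 0 <= C.
  by have := le_trans (normr_ge0 _) (hC 0); rewrite pmulr_lge0// wgt_gt0.
rewrite -mulrA ler_wpM2l// wgt_shift// addrC addKr normrN ger0_norm//.
exact: ltW.
Qed.

Lemma kappa_quot_wgt : exists C, forall t, `|kappa_quot r h t| <= C * wgt t.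
Proof.
exists (36 * r * (r * (1 + r ^- 2))) => t; apply: le_trans (kappa_lip t r0 h0 rh1) _.
by rewrite -!mulrA !ler_wpM2l ?(ltW r0)// wgt_dilate.
Qed.

(** Summation by parts: the difference quotient is moved from the orbit to the kernel by
    translating the integral. *)
Lemma spectral_by_parts b y s :
  bochner_integral (window (kappa r) b (fun t => orbit_quot r b h y (s + t))) =
  bochner_integral (window (kappa_quot r h) b (fun t => trajectory y (s + t))).
Proof.
have [c1 d1] := spectral_window hT K0 TK b y s r0.
pose G := window (fun t => kappa r (t - h)) b (fun t => trajectory y (s + t)).
have cG : continuous G.
  apply: continuous_window; first exact: continuous_kappa_shift.
  exact: (continuous_orbit_shift hT K0 TK).
have dG : wdominated G.
  have [C hC] := kappa_shift_wgt.
  exact: (@wdominated_window _ _ (fun t => kappa r (t - h)) b _ _ _ hC (bounded_orbit_shift TK y s)).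
have GE t : G (t + h) = expi (b * h) *: window (kappa r) b (fun t => trajectory y ((s + h) + t)) t.
  rewrite /G /window addrK mulrDr expiD !scalerA; congr (_ *: trajectory y _); last by ring.
  by rewrite mulrA mulrC mulrA.
have [c2 d2] := spectral_window hT K0 TK b y (s + h) r0.
have c3 : continuous (fun t => G (t + h)).
  by rewrite (funext GE) => t; apply: cvgZl_tmp; exact: c2.
have d3 : wdominated (fun t => G (t + h)).
  rewrite (funext GE); case: d2 => C hC; exists C => t.
  by rewrite rnorm_expi.
pose a := - (h^-1 * expR (- (r * h))).
have -> : window (kappa r) b (fun t => orbit_quot r b h y (s + t)) =
    fun t => a%:C *: G (t + h) + (1 *: 0 + (h^-1)%:C *: window (kappa r) b (fun t => trajectory y (s + t)) t).
  apply/funext => t; rewrite scaler0 add0r /orbit_quot /G /window addrK.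
  rewrite -(addrA s t h) /decay /a mulrDr expiD.
  move: (kappa r t) (trajectory y (s + t)) (trajectory y (s + (t + h))) => k u v.
  rewrite !scalerBr [LHS]addrC !scalerA -scaleNr.
  congr (_ *: _ + _ *: _); last by ring.
  by rewrite rmorphN rmorphM /=; ring.
have c4 : continuous (fun t => (h^-1)%:C *: window (kappa r) b (fun t => trajectory y (s + t)) t).
  by move=> t; apply: cvgZl_tmp; exact: c1.
have c0 : continuous (fun _ : R => 0 : X) by move=> t; exact: cvg_cst.
have d0 := @wdominated0 R X.
have c5 := continuous_linear_comb (a := (h^-1)%:C) c1 c0.
have d5 := wdominated_linear_comb (h^-1)%:C d1 d0.
transitivity (a%:C *: bochner_integral G +
  bochner_integral (fun t => (h^-1)%:C *: window (kappa r) b (fun t => trajectory y (s + t)) t + 0)).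
  rewrite -(bochner_shift h cG dG) -bochner_linear_comb//.
  congr bochner_integral; apply/funext => t.
  by rewrite scaler0 add0r addr0.
rewrite -bochner_linear_comb//; congr bochner_integral; apply/funext => t.
rewrite addr0 /G /window /kappa_quot /a.
move: (trajectory y (s + t)) (kappa r t) (kappa r (t - h)) => u k k'.
rewrite !scalerA -scalerDl; congr (_ *: _).
rewrite mulrBr rmorphB rmorphN !rmorphM /=; ring.
Qed.

(** The two orbits agree up to the residual at nonnegative times; the frozen part of the
    orbits, reached only through the tail of the kernel, is bounded crudely. *)
Lemma spectral_replace b x y s : 0 <= s ->
  ((rnorm (spectral_part T r b x s -
     bochner_integral (window (kappa_quot r h) b (fun t => trajectory y (s + t)))))%:E <=
   (5 * pi * K * rnorm (x - residual r b h y))%:E +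
   (K * rnorm x + h^-1 * (2 * K * rnorm y))%:E * nint (kappa_tail r s))%E.
Proof.
move=> s0; rewrite -spectral_by_parts.
have h' : 0 <= h^-1 by rewrite invr_ge0 ltW.
have qB t : rnorm (orbit_quot r b h y t) <= h^-1 * (2 * K * rnorm y).
  rewrite /orbit_quot rnormZr ger0_norm// ler_wpM2l//.
  apply: le_trans (rnormB _ _) _.
  have o1 := rnorm_orbit TK y t; have o2 := rnorm_orbit TK y (t + h).
  have : rnorm (decay r b h *: trajectory y (t + h)) <= K * rnorm y.
    apply: le_trans o2; rewrite /decay -scalerA rnormZr rnorm_expi ger0_norm ?expR_ge0//.
    by rewrite ler_piMl ?rnorm_ge0// -expR0 ler_expR oppr_le0 mulr_ge0 ?ltW.
  lra.
have cq : continuous (fun t => orbit_quot r b h y (s + t)).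
  move=> t; apply: cvgZl_tmp; apply: cvgB.
    exact: (continuous_orbit_shift hT K0 TK).
  apply: cvgZl_tmp; under eq_fun do rewrite addrAC.
  by rewrite addrAC; exact: (continuous_orbit_shift hT K0 TK).
have [C hC] := kappa_wgt r0.
have [c1 d1] := spectral_window hT K0 TK b x s r0.
have c2 := @continuous_window _ _ _ b _ (@continuous_kappa R r) cq.
have d2 : wdominated (window (kappa r) b (fun t => orbit_quot r b h y (s + t))).
  by apply: (wdominated_window b hC) => t; exact: qB.
pose E t := (-1 : R[i]) *: window (kappa r) b (fun t => orbit_quot r b h y (s + t)) t +
   window (kappa r) b (fun t => trajectory x (s + t)) t.
have cE : continuous E by exact: continuous_linear_comb.
have dE : wdominated E by exact: wdominated_linear_comb.
have -> : spectral_part T r b x s -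
     bochner_integral (window (kappa r) b (fun t => orbit_quot r b h y (s + t))) = bochner_integral E.
  by rewrite bochner_linear_comb// scaleN1r addrC.
apply: le_trans (rnorm_bochner_le cE dE) _.
set e := rnorm (x - residual r b h y); set B := K * rnorm x + h^-1 * (2 * K * rnorm y).
have e0 : 0 <= e by exact: rnorm_ge0.
have B0 : 0 <= B by rewrite addr_ge0 ?mulr_ge0 ?rnorm_ge0.
have EE t : rnorm (E t) = kappa r t * rnorm (trajectory x (s + t) - orbit_quot r b h y (s + t)).
  rewrite /E scaleN1r addrC /window -!scalerBr rnormZr rnorm_expi ger0_norm//.
  exact: kappa_ge0 (ltW r0).
have bound t : rnorm (E t) <= 5 * K * e * (r * wgt (r * t)) + B * kappa_tail r s t.
  rewrite EE /kappa_tail; have k0 := kappa_ge0 t (ltW r0).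
  have k5 := kappa_le t (ltW r0).
  have w0 : 0 <= 5 * K * e * (r * wgt (r * t)).
    by rewrite !mulr_ge0 ?wgt_ge0 ?(ltW r0).
  case: ifPn => [ts|]; last rewrite -leNgt => ts.
    rewrite ler_wpDl// mulrC ler_wpM2r//; apply: le_trans (rnormB _ _) _.
    by apply: lerD => //; exact: rnorm_orbit.
  rewrite mulr0 addr0; have st : 0 <= s + t by lra.
  have -> : trajectory x (s + t) - orbit_quot r b h y (s + t) = T (s + t) (x - residual r b h y).
    have sth : 0 <= s + t + h by apply: addr_ge0 => //; exact: ltW.
    rewrite /orbit_quot !orbit_ge0// /residual.
    rewrite (semigroupB hT)// (semigroupZ hT)// (semigroupB hT)// rescaled_decay (semigroupZ hT)//.
    by rewrite (semigroup_add hT _ st (ltW h0)).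
  have : kappa r t * rnorm (T (s + t) (x - residual r b h y)) <= 5 * (r * wgt (r * t)) * (K * e).
    by apply: ler_pM => //; [exact: rnorm_ge0|exact: TK].
  by move=> /le_trans; apply; rewrite le_eqVlt; apply/orP; left; apply/eqP; ring.
have mw : measurable_fun setT (fun t => r * wgt (r * t)).
  by apply: continuous_measurable_fun; exact: continuous_wgt_dilate.
have mt := measurable_kappa_tail r s.
have t0 t : 0 <= kappa_tail r s t.
  by rewrite /kappa_tail; case: ifP => // _; exact: kappa_ge0 (ltW r0).
have w0 t : 0 <= r * wgt (r * t) by rewrite mulr_ge0 ?wgt_ge0// ltW.
have c0 : 0 <= 5 * K * e by rewrite !mulr_ge0.
apply: (@le_trans _ _ (nint (fun t => 5 * K * e * (r * wgt (r * t)) + B * kappa_tail r s t)%R)).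
  apply: le_nint => [||t]; last by rewrite rnorm_ge0 bound.
  - by apply: continuous_measurable_fun; exact: continuous_rnorm.
  - by apply: measurable_funD; apply: measurable_funM.
rewrite nintD; [|by apply: measurable_funM|by apply: measurable_funM|by move=> t; rewrite mulr_ge0|by move=> t; rewrite mulr_ge0].
rewrite (nintZ mw w0 c0) (nintZ mt t0 B0) nint_wgt_dilate// -EFinM; apply: leeD => //.
by rewrite lee_fin le_eqVlt; apply/orP; left; apply/eqP; ring.
Qed.

End OneStep.
End SpectralSums.

(** * Sums of spectral parts *)

Section SpectralSumBound.
Context (R : realType) (X : completeNormedModType R[i]) (p : R).
Context (T : R -> X -> X) (D : set X) (A : X -> X) (K : R).
Hypotheses (hT : C0_semigroup T) (K0 : 0 <= K)
  (TK : forall t x, 0 <= t -> rnorm (T t x) <= K * rnorm x)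
  (hA : is_generator T D A).
Context (C : R) (C0 : 0 <= C)
  (hC : forall N (a : nat -> X) (r b : R), 0 < r ->
    (nint (fun t => r * wgt (r * t) * rnorm (\sum_(i < N) expi ((b + i%:R * r) * t) *: a i)%R)%R <=
     (C * lpnorm p N a)%:E)%E).

(** Here the semigroup acts, at each time, on one value of a trigonometric polynomial; it
    is bounded by [K], and the mean of the polynomial by its coefficients. *)
Lemma by_parts_sum_le r h b N (y : nat -> X) (w : nat -> R) s :
  0 < r -> 0 < h -> h <= 1 -> r * h <= 1 ->
  rnorm (\sum_(i < N) (w i)%:C *:
     bochner_integral (window (kappa_quot r h) (b + i%:R * r) (fun t => trajectory T (y i) (s + t)))) <=
  36 * r * K * (C * lpnorm p N (fun i => (w i)%:C *: y i)).
Proof.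
move=> r0 h0 h1 rh1; have [Ck hCk] := kappa_quot_wgt r0 h0 rh1.
have [cF dF <-] := bochner_sum (index_enum 'I_N) (fun i : 'I_N => (w i)%:C)
  (fun i : 'I_N => @continuous_window _ _ _ (b + i%:R * r) _
    (@continuous_kappa_quot R r h) (@continuous_orbit_shift _ _ _ _ hT K0 TK (y i) s))
  (fun i : 'I_N => @wdominated_window _ _ _ (b + i%:R * r) _ _ _ hCk
    (bounded_orbit_shift TK (y i) s)).
rewrite -lee_fin; apply: le_trans (rnorm_bochner_le cF dF) _.
pose Y t := \sum_(i < N) expi ((b + i%:R * r) * t) *: ((w i)%:C *: y i).
have cY : continuous Y.
  move=> t; apply: cvg_big => [|i _]; first exact: add_continuous.
  apply: cvgZ; last exact: cvg_cst.
  by apply: cvg_expi; apply: cvgM; [exact: cvg_cst|exact: cvg_id].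
have m0 (t : R) : 0 <= Num.max t 0 by rewrite le_max lexx orbT.
have bound t : rnorm (\sum_(i < N) (w i)%:C *:
    window (kappa_quot r h) (b + i%:R * r) (fun t => trajectory T (y i) (s + t)) t) <=
    36 * r * K * (r * wgt (r * t) * rnorm (Y t)).
  have -> : \sum_(i < N) (w i)%:C *:
    window (kappa_quot r h) (b + i%:R * r) (fun t => trajectory T (y i) (s + t)) t =
    (kappa_quot r h t)%:C *: T (Num.max (s + t) 0) (Y t).
    rewrite /Y (semigroup_sum hT)// scaler_sumr; apply: eq_bigr => i _.
    rewrite /window /trajectory !(semigroupZ hT)// !scalerA; congr (_ *: _).
    by rewrite -mulrA mulrC.
  rewrite rnormZr; apply: (@le_trans _ _ ((36 * r * (r * wgt (r * t))) * (K * rnorm (Y t)))).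
    by apply: ler_pM => //; [exact: rnorm_ge0|exact: kappa_lip|exact: TK].
  by rewrite le_eqVlt; apply/orP; left; apply/eqP; ring.
have cw : continuous (fun t => r * wgt (r * t) * rnorm (Y t)).
  move=> t; apply: cvgM; first exact: continuous_wgt_dilate.
  by apply: cvg_rnorm; exact: cY.
have w0 t : 0 <= r * wgt (r * t) * rnorm (Y t).
  by rewrite mulr_ge0 ?rnorm_ge0// mulr_ge0 ?wgt_ge0// ltW.
have mw := continuous_measurable_fun cw.
have c0 : 0 <= 36 * r * K by rewrite !mulr_ge0// ltW.
apply: (@le_trans _ _ (nint (fun t => 36 * r * K * (r * wgt (r * t) * rnorm (Y t)))%R)).
  apply: le_nint => [||t]; last by rewrite rnorm_ge0 bound.
  - by apply: continuous_measurable_fun; exact: continuous_rnorm.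
  - exact: measurable_funM.
rewrite (nintZ mw w0 c0) (EFinM (36 * r * K) (C * _)); apply: lee_wpmul2l; first by rewrite lee_fin.
exact: hC.
Qed.

(** Pieces of an orbit at one frequency scale are summable to the power [p], each of them
    measured by a resolvent on the vertical line of abscissa [r]. *)
Lemma spectral_sum_le r b N (y : nat -> X) (w : nat -> R) x (e : R) :
  0 < r -> (forall i, 0 <= w i) ->
  (forall i, (i < N)%N -> w i = 0 \/ resolves D A r (b + i%:R * r) (y i) x) ->
  0 < e -> exists M0, forall M, (M0 <= M)%N ->
  rnorm (\sum_(i < N) (w i)%:C *: spectral_part T r (b + i%:R * r) x M%:R) <=
    36 * K * C * (r * lpnorm p N (fun i => (w i)%:C *: y i)) + e.
Proof.
move=> r0 w0 hy e0.
pose res (h : R) := \sum_(i < N) w i * rnorm (x - residual T r (b + i%:R * r) h (y i)).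
have res0 : res h @[h --> 0^'+] --> (0 : R).
  have z0 : \sum_(i < N) w i * 0 = 0 by rewrite big1// => i _; rewrite mulr0.
  rewrite -[X in _ --> X]z0; apply: cvg_big => [|i _]; first exact: add_continuous.
  have [->|hi] := hy i (ltn_ord i).
    by under eq_fun do rewrite mul0r; rewrite mul0r; exact: cvg_cst.
  apply: cvgM; first exact: cvg_cst.
  apply/cvg_rnorm0P; rewrite -[X in _ --> X](subrr x); apply: cvgB; first exact: cvg_cst.
  exact: (resolves_derive hA hi).
have e1 : 0 < e / (2 * (5 * pi * K + 1)).
  by rewrite divr_gt0// mulr_gt0// ltr_wpDl// !mulr_ge0// ltW// pi_gt0.
move/cvgrPdist_lt/(_ _ e1): res0 => [d /= d0 hd].
(* the resolvents determine the step [h]; the time [M] is chosen afterwards, since the tail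
   of the kernel is multiplied by [h^-1] *)
pose h := Num.min (d / 2) (Num.min 1 r^-1).
have h0 : 0 < h by rewrite !lt_min divr_gt0//= ltr01 invr_gt0.
have h1 : h <= 1 by rewrite /h !ge_min lexx orbT.
have rh : r * h <= 1 by rewrite -ler_pdivlMl// mulr1 /h !ge_min lexx !orbT.
have hd2 : h < d.
  by rewrite (@le_lt_trans _ _ (d / 2)) ?ge_min ?lexx// ltr_pdivrMr// ltr_pMr// ltr1n.
have resh : 5 * pi * K * res h <= e / 2.
  have res_ge0 : 0 <= res h by apply: sumr_ge0 => i _; rewrite mulr_ge0 ?rnorm_ge0.
  have := hd h; rewrite /= sub0r normrN gtr0_norm// => /(_ hd2 h0).
  rewrite sub0r normrN ger0_norm// => /ltW; rewrite ler_pdivlMr; last first.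
    by rewrite mulr_gt0// ltr_wpDl// !mulr_ge0// ltW// pi_gt0.
  lra.
pose Bi i := K * rnorm x + h^-1 * (2 * K * rnorm (y i)).
have Bi0 i : 0 <= Bi i by rewrite addr_ge0 ?mulr_ge0 ?rnorm_ge0// invr_ge0 ltW.
pose B := \sum_(i < N) w i * Bi i.
have B0 : 0 <= B by apply: sumr_ge0 => i _; rewrite mulr_ge0.
have e2 : 0 < e / (2 * (B + 1)) by rewrite divr_gt0// mulr_gt0// ltr_wpDl.
have tail0 (s : R) : (0 <= nint (kappa_tail r s))%E.
  by apply: nint_ge0 => t; rewrite /kappa_tail; case: ifP => // _; exact: kappa_ge0 (ltW r0).
have [M0 hM0] := (ecvg0P (fun n => tail0 n%:R)).1 (kappa_tail_cvg0 r0) _ e2.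
exists M0 => M /hM0 tM.
pose z i := bochner_integral (window (kappa_quot r h) (b + i%:R * r)
   (fun t => trajectory T (y i) (M%:R + t))).
have dz i : rnorm (spectral_part T r (b + i%:R * r) x M%:R - z i) <=
    5 * pi * K * rnorm (x - residual T r (b + i%:R * r) h (y i)) + Bi i * (e / (2 * (B + 1))).
  rewrite -lee_fin EFinD.
  apply: le_trans (spectral_replace hT K0 TK r0 h0 h1 (b + i%:R * r) x (y i) (ler0n _ M)) _.
  by apply: leeD => //; rewrite EFinM; apply: lee_wpmul2l; rewrite ?lee_fin ?Bi0.
have main := by_parts_sum_le b N y w M%:R r0 h0 h1 rh.
have -> : \sum_(i < N) (w i)%:C *: spectral_part T r (b + i%:R * r) x M%:R =
  \sum_(i < N) (w i)%:C *: (spectral_part T r (b + i%:R * r) x M%:R - z i) +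
  \sum_(i < N) (w i)%:C *: z i.
  by rewrite -big_split /=; apply: eq_bigr => i _; rewrite -scalerDr subrK.
apply: le_trans (rnormD _ _) _; rewrite addrC; apply: lerD.
  by apply: le_trans main _; rewrite le_eqVlt; apply/orP; left; apply/eqP; ring.
apply: le_trans (rnorm_sum _ _ _) _.
apply: (@le_trans _ _ (\sum_(i < N) (w i * (5 * pi * K * rnorm (x - residual T r (b + i%:R * r) h (y i))) +
    w i * Bi i * (e / (2 * (B + 1)))))).
  apply: ler_sum => i _; rewrite rnormZr ger0_norm// -(mulrA (w i) (Bi i)) -mulrDr ler_wpM2l//.
rewrite big_split /= -mulr_suml -/B.
have -> : \sum_(i < N) w i * (5 * pi * K * rnorm (x - residual T r (b + i%:R * r) h (y i))) =
    5 * pi * K * res h.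
  by rewrite /res mulr_sumr; apply: eq_bigr => i _; rewrite mulrCA.
have : B * (e / (2 * (B + 1))) <= e / 2.
  rewrite mulrA ler_pdivrMr; last by rewrite mulr_gt0// ltr_wpDl.
  nra.
lra.
Qed.

End SpectralSumBound.

(** * Comparison of resolvents and refinement of spectral parts *)

Section Nodes.
Context (R : realType) (X : completeNormedModType R[i]).
Context (T : R -> X -> X) (D : set X) (A : X -> X) (K : R).
Hypotheses (hT : C0_semigroup T) (K0 : 0 <= K)
  (TK : forall t x, 0 <= t -> rnorm (T t x) <= K * rnorm x)
  (hA : is_generator T D A).

Lemma resolves_diff r b y1 x1 y2 x2 : resolves D A r b y1 x1 -> resolves D A r b y2 x2 ->
  resolves D A r b (y1 - y2) (x1 - x2).
Proof.
move=> h1 h2; apply: (derive_resolves hA).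
have H := cvgB (resolves_derive hA h1) (resolves_derive hA h2).
refine (cvg_trans _ (H _)); apply: near_eq_cvg; near=> h.
have h0 : 0 <= h by apply/ltW; near: h; exact: nbhs_right_gt.
change ((h^-1)%:C *: (y1 - rescaled T r b h y1) - (h^-1)%:C *: (y2 - rescaled T r b h y2) =
  (h^-1)%:C *: (y1 - y2 - rescaled T r b h (y1 - y2))).
rewrite (rescaledB hT)// -scalerBr; congr (_ *: _).
by rewrite !opprD !opprK addrACA.
Unshelve. all: by end_near. Qed.

(** By the resolvent identity, resolvents at two points of the vertical line of abscissa [r]
    are comparable when the points are at distance [O(r)]. *)
Lemma resolves_comparison r b b' y y' x : 0 < r ->
  resolves D A r b y x -> resolves D A r b' y' x ->
  rnorm y' <= (1 + K * (`|b - b'| / r)) * rnorm y.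
Proof.
move=> r0 hy hy'.
have hy2 : resolves D A r b' y (x + (0 +i* (b - b')) *: y).
  case: hy => Dy <-; split=> //; rewrite addrAC -scalerDl; congr (_ *: _ - _).
  by apply/eqP; rewrite eq_complex /= addr0 eqxx /=; apply/eqP; ring.
have := resolves_bound hT K0 TK hA r0 (resolves_diff hy' hy2).
rewrite opprD addNKr rnormN rnormZ => h.
have -> : y' = y + (y' - y) by rewrite addrC subrK.
apply: le_trans (rnormD _ _) _; rewrite mulrDl mul1r lerD2l.
move: h; rewrite normc_def /= expr0n /= add0r sqrtr_sqr => h.
by rewrite mulrA mulrAC ler_pdivlMr// mulrC -mulrA.
Qed.

(** The resolvent at [r - i b], as in [resolves]. *)
Definition line_resolvent (x : X) (r b : R) : X := resolvent D A (r +i* (- b)) x.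

Lemma line_resolventP x r b : 0 < r -> resolves D A r b (line_resolvent x r b) x.
Proof.
move=> r0; have [y hy] := resolves_exists hT K0 TK hA b r0 x.
exact: (@xgetPex _ 0 [set y | D y /\ (r +i* (- b)) *: y - A y = x] (ex_intro _ y hy)).
Qed.

(** The band of frequencies within [r] of [- b] vanishes asymptotically along integer times. *)
Definition null_node (x : X) (r b : R) : Prop :=
  rnorm (spectral_part T r b x M%:R) @[M --> \oo] --> (0 : R).

Lemma spectral_refine (r : R) n : 0 < r -> exists w : nat -> R,
  (forall i, 0 <= w i <= 1) /\
  forall b x s, spectral_part T r b x s =
    \sum_(i < (2 ^ n.+1)%N) (w i)%:C *:
       spectral_part T (r / 2 ^+ n) (b - r + i%:R * (r / 2 ^+ n)) x s.
Proof.
move=> r0; have [w [_ _ w01 kE]] := kappa_refine r n; exists w; split=> // b x s.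
have rho0 : 0 < r / 2 ^+ n by rewrite divr_gt0// exprn_gt0.
pose W (i : 'I_(2 ^ n.+1)) := window (kappa (r / 2 ^+ n)) (b - r + i%:R * (r / 2 ^+ n))
  (fun t => trajectory T x (s + t)).
have [_ _ <-] := bochner_sum (index_enum 'I_(2 ^ n.+1)) (fun i : 'I_(2 ^ n.+1) => (w i)%:C)
  (fun i => (spectral_window hT K0 TK (b - r + i%:R * (r / 2 ^+ n)) x s rho0).1)
  (fun i => (spectral_window hT K0 TK (b - r + i%:R * (r / 2 ^+ n)) x s rho0).2).
congr bochner_integral; apply/funext => t.
rewrite /window kE scaler_suml; apply: eq_bigr => i _.
rewrite !scalerA; congr (_ *: _).
by rewrite rmorphM /= -[LHS]mulrA -expiD; congr (_ * expi _); ring.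
Qed.

Lemma null_node_sum x (I : Type) (s : seq I) (w r b : I -> R) :
  (forall i, w i = 0 \/ null_node x (r i) (b i)) ->
  rnorm (\sum_(i <- s) (w i)%:C *: spectral_part T (r i) (b i) x M%:R) @[M --> \oo] --> (0 : R).
Proof.
move=> h; apply/cvg_rnorm0P.
have z0 : \sum_(i <- s) (0 : X) = 0 by rewrite big1.
rewrite -[X in _ --> X]z0; apply: cvg_big => [|i _]; first exact: add_continuous.
have [->|hi] := h i; first by under eq_fun do rewrite scale0r; exact: cvg_cst.
rewrite -(scaler0 _ (w i)%:C); apply: cvgZ; first exact: cvg_cst.
exact/cvg_rnorm0P.
Qed.

End Nodes.

(** * The tree of dyadic frequency bands *)

Section Tree.
Context (R : realType) (X : completeNormedModType R[i]) (p : R) (p1 : 1 < p).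
Context (T : R -> X -> X) (D : set X) (A : X -> X) (K : R).
Hypotheses (hT : C0_semigroup T) (K0 : 0 <= K)
  (TK : forall t x, 0 <= t -> rnorm (T t x) <= K * rnorm x)
  (hA : is_generator T D A).
Context (x : X)
  (hx : forall beta : R, (alpha `^ ((p - 1) / p))%:C *: resolvent D A (alpha +i* beta) x
         @[alpha --> 0^'+] --> (0 : X)).
Local Notation null_node := (null_node T x).
Local Notation Y := (line_resolvent D A x).

(** The quantity that the hypothesis on [x] sends to 0 with [r]. *)
Definition growth (r b : R) : R := r `^ ((p - 1) / p) * rnorm (Y r b).

Lemma growth_ge0 r b : 0 <= growth r b.
Proof. by rewrite mulr_ge0 ?powR_ge0 ?rnorm_ge0. Qed.

Lemma growth_small b (e : R) : 0 < e -> exists d, 0 < d /\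
  forall r, 0 < r -> r < d -> growth r b < e.
Proof.
move=> e0; have /cvg_rnorm0P/cvgrPdist_lt/(_ _ e0)[d /= d0 hd] := hx (- b).
exists d; split=> // r r0 rd; have := hd r; rewrite /= !sub0r !normrN gtr0_norm// => /(_ rd r0).
by rewrite ger0_norm ?rnorm_ge0// rnormZr ger0_norm ?powR_ge0.
Qed.

Lemma growth_comparison r b b' c : 0 < r -> `|b - b'| <= c * r ->
  growth r b' <= (1 + K * c) * growth r b.
Proof.
move=> r0 bb; rewrite /growth mulrCA ler_wpM2l ?powR_ge0//.
have := resolves_comparison hT K0 TK hA r0 (line_resolventP hT K0 TK hA x b r0)
  (line_resolventP hT K0 TK hA x b' r0).
move=> /le_trans; apply; rewrite ler_wpM2r ?rnorm_ge0// lerD2l ler_wpM2l//.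
by rewrite ler_pdivrMr.
Qed.

(** Such a chain converges geometrically to some frequency [be], and stays within [O(r_k)] of
    it. Near [be] the hypothesis on [x] makes [growth] small at small scales, and comparison
    of resolvents transfers this to the chain. *)
Lemma steep_chain_false (f : nat -> R * R) :
  (forall k, [/\ 0 < (f k).1, (f k.+1).1 <= (f k).1 / 2,
     `|(f k.+1).2 - (f k).2| <= 2 * (f k).1 & 1 < growth (f k.+1).1 (f k.+1).2]) -> False.
Proof.
(* 4 = 2 (1 + 1/2 + 1/4 + ...): with this radius the intervals are nested *)
move=> hf; pose a k := (f k).2 - 4 * (f k).1; pose c k := (f k).2 + 4 * (f k).1.
have aS k : a k <= a k.+1.
  by have [_ h1 + _] := hf k; rewrite ler_distl /a => /andP[]; lra.
have cS k : c k.+1 <= c k.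
  by have [_ h1 + _] := hf k; rewrite ler_distl /c => /andP[]; lra.
have am : {homo a : m n / (m <= n)%N >-> m <= n} by apply: homo_leq => //; exact: le_trans.
have cm : {homo c : m n / (m <= n)%N >-> n <= m}.
  by apply: (@homo_leq _ c (fun u v => v <= u)) => // u v w vu wv; exact: le_trans wv vu.
have ac m n : a m <= c n.
  have [h _ _ _] := hf (maxn m n).
  apply: le_trans (am _ _ (leq_maxl m n)) _; apply: le_trans (cm _ _ (leq_maxr m n)).
  by rewrite /a /c; lra.
pose be := sup (range a).
have ha : has_sup (range a).
  by split; [exists (a 0%N); exists 0%N|exists (c 0%N) => _ [m _ <-]].
have abe m : a m <= be by apply: ub_le_sup; [case: ha|exists m].
have bec m : be <= c m by apply: ge_sup; [case: ha|move=> _ [k _ <-]].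
have bek k : `|be - (f k).2| <= 4 * (f k).1.
  have := abe k; have := bec k; rewrite /a /c ler_distl => *; apply/andP; lra.
have K4 : 0 < 1 + K * 4 by rewrite ltr_wpDr// mulr_ge0.
have e0 : 0 < (1 + K * 4)^-1 by rewrite invr_gt0.
have [d [d0 hd]] := growth_small be e0.
have fr k : (f k).1 <= (f 0%N).1 * 2^-1 ^+ k.
  elim: k => [|k IH]; first by rewrite expr0 mulr1.
  have [_ h _ _] := hf k; apply: le_trans h _.
  by rewrite exprSr mulrA ler_wpM2r// invr_ge0.
have g0 : geometric (f 0%N).1 (2^-1 : R) @ \oo --> (0 : R).
  by apply: cvg_geometric; rewrite ger0_norm// invf_lt1// ltr1n.
move/cvgrPdist_lt/(_ _ d0): g0 => [k _ /(_ k.+1 (leqnSn k))].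
rewrite sub0r normrN => /(le_lt_trans (ler_norm _)) hk.
have [_ _ _ big] := hf k; have [fk _ _ _] := hf k.+1.
have := growth_comparison fk (bek k.+1).
have := hd _ fk (le_lt_trans (fr k.+1) hk).
rewrite -(ltr_pM2l K4) mulfV ?gt_eqF// => h1 h2.
by have := lt_trans big (le_lt_trans h2 h1); rewrite ltxx.
Qed.

Lemma null_node_refine r b n : 0 < r ->
  (forall i, (i < 2 ^ n.+1)%N -> null_node (r / 2 ^+ n) (b - r + i%:R * (r / 2 ^+ n))) ->
  null_node r b.
Proof.
move=> r0 h; have [w [_ wE]] := spectral_refine hT K0 TK n r0.
rewrite /null_node; under eq_fun do rewrite wE.
apply: (@null_node_sum _ _ _ _ _ _ (fun i : 'I_(2 ^ n.+1) => w i) (fun=> r / 2 ^+ n)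
  (fun i => b - r + i%:R * (r / 2 ^+ n))) => i.
by right; exact: h.
Qed.

(** Only the descendants that contribute asymptotically are required to be moderate: this is
    what a descent along non-null nodes can provide. *)
Definition quiet_node (r b : R) : Prop := forall n i, (i < 2 ^ n.+1)%N ->
  ~ null_node (r / 2 ^+ n) (b - r + i%:R * (r / 2 ^+ n)) ->
  growth (r / 2 ^+ n) (b - r + i%:R * (r / 2 ^+ n)) <= 1.

Lemma descendant_dist (r : R) n i : 0 < r -> (i < 2 ^ n.+1)%N ->
  - r <= - r + i%:R * (r / 2 ^+ n) <= r.
Proof.
move=> r0 iN; have n0 : 0 < 2 ^+ n :> R by rewrite exprn_gt0.
have : 0 <= i%:R * (r / 2 ^+ n) by rewrite mulr_ge0// divr_ge0// ltW.
have : i%:R * (r / 2 ^+ n) <= 2 * r.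
  rewrite mulrA ler_pdivrMr// [leRHS]mulrAC -exprS -natrX ler_wpM2r ?(ltW r0)//.
  by rewrite ler_nat ltnW.
lra.
Qed.

(** Baire category on the tree of bands: were there no quiet node, every non-null node would
    have a non-null descendant with [growth > 1], whence an infinite chain of them. *)
Lemma exists_quiet_node r1 b1 : 0 < r1 -> ~ null_node r1 b1 ->
  exists r b, [/\ 0 < r, ~ null_node r b & quiet_node r b].
Proof.
move=> r10 bad1; apply: contrapT => none.
pose bad (u : R * R) := 0 < u.1 /\ ~ null_node u.1 u.2.
have next (u : R * R) : exists v : R * R, bad u ->
   [/\ bad v, v.1 <= u.1 / 2, `|v.2 - u.2| <= 2 * u.1 & 1 < growth v.1 v.2].
  have [[u0 ub]|nb] := pselect (bad u); last by exists u => /nb.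
  (* a descendant may have the scale of its ancestor: go down one level first *)
  have /existsNP[i /not_implyP[i4 cb]] : ~ (forall i, (i < 2 ^ 2)%N ->
      null_node (u.1 / 2 ^+ 1) (u.2 - u.1 + i%:R * (u.1 / 2 ^+ 1))).
    by move=> h; apply: ub; apply: (@null_node_refine _ _ 1%N).
  have := descendant_dist u0 i4.
  move: cb; rewrite -(addrA u.2).
  set r := u.1 / 2 ^+ 1; set c := _ + i%:R * r => cb cu.
  have r0 : 0 < r by rewrite divr_gt0// exprn_gt0.
  have : ~ quiet_node r (u.2 + c) by move=> q; apply: none; exists r, (u.2 + c).
  move=> /existsNP[n /existsNP[j /not_implyP[jn /not_implyP[jb /negP]]]].
  rewrite -ltNge => jg.
  have := descendant_dist r0 jn.
  move: jb jg; rewrite -(addrA (u.2 + c)).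
  set s := r / 2 ^+ n; set c' := _ + j%:R * s => jb jg cc.
  exists (s, u.2 + c + c') => _; split=> //=.
  - by split=> //=; rewrite divr_gt0// exprn_gt0.
  - rewrite ler_pdivrMr ?exprn_gt0//; apply: ler_peMr; first exact: ltW.
    by rewrite exprn_ege1// ler1n.
  - move: cu cc; rewrite /r expr1 => /andP[h1 h2] /andP[h3 h4].
    by rewrite ler_distl; apply/andP; split; lra.
have [g hg] := choice next; pose f k := iter k g (r1, b1).
have fbad k : bad (f k) by elim: k => [//|k IH]; case: (hg _ IH).
apply: (@steep_chain_false f) => k; have [_ h1 h2 h3] := hg _ (fbad k).
by split=> //; case: (fbad k).
Qed.

(** Null nodes do not contribute in the limit, and are discarded. *)
Definition node_mass (r b : R) : R := if `[< null_node r b >] then 0 else growth r b `^ p.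

(** The sum is the integral of a step function on an interval of length [2 r]. These functions
    are bounded by 1, and tend to 0 pointwise since [growth] varies little within a cell. *)
Lemma quiet_mass_cvg0 r b (e : R) : 0 < r -> quiet_node r b -> 0 < e ->
  exists n, \sum_(i < (2 ^ n.+1)%N)
    r / 2 ^+ n * node_mass (r / 2 ^+ n) (b - r + i%:R * (r / 2 ^+ n)) <= e.
Proof.
move=> r0 q e0; have p0 : 0 < p by rewrite (lt_trans ltr01).
have rho0 n : 0 < r / 2 ^+ n by rewrite divr_gt0// exprn_gt0.
pose c n i := if (i < 2 ^ n.+1)%N then
   node_mass (r / 2 ^+ n) (b - r + i%:R * (r / 2 ^+ n)) else 0.
have c01 n i : 0 <= c n i <= 1.
  rewrite /c /node_mass; case: ifP => [iN|]; last by rewrite lexx ler01.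
  case: asboolP => [|nn]; first by rewrite lexx ler01.
  rewrite powR_ge0/= -[leRHS](congr1 (@^~ p) (powR1 R)) ge0_ler_powR ?nnegrE ?growth_ge0 ?(ltW p0)//.
  exact: q.
pose F n := step 0 (r / 2 ^+ n) (2 ^ n.+1) 0 (c n).
have rN n : r / 2 ^+ n * (2 ^ n.+1)%:R = 2 * r.
  by rewrite natrX exprSr mulrA divfK 1?mulrC// gt_eqF// exprn_gt0.
have F0 : nint (F n) @[n --> \oo] --> 0%E.
  apply: (@nint_wgt_cvg0 _ _ (1 + (2 * r) ^+ 2)) => [n|n t|t].
  - exact: measurable_step.
  - rewrite /F /step; case: ifPn => h; last first.
      by rewrite lexx mulr_ge0 ?wgt_ge0// addr_ge0// sqr_ge0.
    have /andP[-> /le_trans] := c01 n (cell 0 (r / 2 ^+ n) (2 ^ n.+1) t); apply.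
    move: h; rewrite cell_lt// add0r rN => /andP[t0 t2].
    rewrite /wgt ler_pdivlMr ?mul1r; last by rewrite (lt_le_trans ltr01)// oneDsqr_ge1.
    by rewrite lerD2l lerXn2r ?nnegrE ?(ltW t2)// mulr_ge0// ltW.
  - have [tin|tout] := boolP ((0 <= t) && (t < 2 * r)); last first.
      rewrite (_ : (fun n => F n t) = fun=> 0); first exact: cvg_cst.
      apply/funext => n; rewrite /F /step cell_lt// add0r rN.
      by rewrite (negPf tout).
    apply/cvgrPdist_le => d d0.
    have K1 : 0 < 1 + K by rewrite ltr_wpDr.
    have dp : 0 < d `^ p^-1 / (1 + K) by rewrite divr_gt0// powR_gt0.
    have [s [s0 hs]] := growth_small (b - r + t) dp.
    have g0 : geometric r (2^-1 : R) @ \oo --> (0 : R).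
      by apply: cvg_geometric; rewrite ger0_norm// invf_lt1// ltr1n.
    move/cvgrPdist_lt/(_ _ s0): g0; apply: filterS => n.
    rewrite sub0r normrN /= exprVn => /(le_lt_trans (ler_norm _)) rs.
    have := @cell_inside _ 0 _ (rho0 n) (2 ^ n.+1) t.
    rewrite add0r rN => /(_ tin); rewrite /F /step => -[-> h1 h2].
    move: h1 h2; set k := cell _ _ _ _ => h1 h2.
    have /andP[ck _] := c01 n k; rewrite sub0r normrN ger0_norm//.
    rewrite /c /node_mass; case: ifP => _; last exact: ltW.
    case: asboolP => _; first exact: ltW.
    have -> : d = (d `^ p^-1) `^ p by rewrite -powRrM mulVf ?gt_eqF// powRr1// ltW.
    rewrite ge0_ler_powR ?nnegrE ?growth_ge0 ?powR_ge0 ?(ltW p0)//.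
    have close : `|(b - r + t) - (b - r + k%:R * (r / 2 ^+ n))| <= 1 * (r / 2 ^+ n).
      rewrite mul1r ler_distl; move: h1 h2; rewrite !add0r -[k.+1%:R]natr1 mulrDr mulr1.
      rewrite [r / 2 ^+ n * k%:R]mulrC => h1 h2; apply/andP; split; lra.
    apply: le_trans (growth_comparison (rho0 n) close) _.
    by rewrite mulr1 mulrC -ler_pdivlMr// ltW// hs.
have F_ge0 n t : 0 <= F n t.
  by rewrite /F /step; case: ifP => // _; case/andP: (c01 n (cell 0 (r / 2 ^+ n) (2 ^ n.+1) t)).
have [n /(_ n (leqnn n))] := (ecvg0P (fun n => nint_ge0 (F_ge0 n))).1 F0 _ e0.
rewrite /nint (integral_step _ (rho0 n)); last by move=> k; case/andP: (c01 n k).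
rewrite lee_fin => h; exists n; apply: le_trans h.
by apply: ler_sum => i _; rewrite /c ltn_ord.
Qed.

End Tree.

(** * Decay of all spectral parts *)

Section NullEverywhere.
Context (R : realType) (X : completeNormedModType R[i]) (p : R) (p1 : 1 < p).
Context (T : R -> X -> X) (D : set X) (A : X -> X) (K : R).
Hypotheses (hT : C0_semigroup T) (K0 : 0 <= K)
  (TK : forall t x, 0 <= t -> rnorm (T t x) <= K * rnorm x)
  (hA : is_generator T D A).
Context (C : R) (C0 : 0 <= C)
  (hC : forall N (a : nat -> X) (r b : R), 0 < r ->
    (nint (fun t => r * wgt (r * t) * rnorm (\sum_(i < N) expi ((b + i%:R * r) * t) *: a i)%R)%R <=
     (C * lpnorm p N a)%:E)%E).
Context (x : X)
  (hx : forall beta : R, (alpha `^ ((p - 1) / p))%:C *: resolvent D A (alpha +i* beta) x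
         @[alpha --> 0^'+] --> (0 : X)).
Local Notation null_node := (null_node T x).
Local Notation Y := (line_resolvent D A x).

Lemma growth_pow r b : 0 < r -> r `^ p * rnorm (Y r b) `^ p = r * growth p D A x r b `^ p.
Proof.
move=> r0; have p0 : p != 0 by rewrite gt_eqF// (lt_trans ltr01).
rewrite /growth powRM ?powR_ge0 ?rnorm_ge0// -powRrM divfK//.
rewrite mulrA; congr (_ * _).
by rewrite mulr_powRB1// ?(ltW r0)// (lt_trans ltr01).
Qed.

(** Split the band into its null descendants, finitely many at each level, and the other
    ones, which [spectral_sum_le] bounds by their masses. *)
Lemma quiet_node_null r b : 0 < r -> quiet_node p T D A x r b -> null_node r b.
Proof.
move=> r0 q; have p0 : 0 < p by rewrite (lt_trans ltr01).
pose B := 36 * K * C + 1.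
have B1 : 36 * K * C <= B by rewrite lerDl.
have B0 : 0 < B by rewrite ltr_wpDl// !mulr_ge0.
apply/cvgrPdist_le => e e0; have e3 : 0 < e / 3 by rewrite divr_gt0.
have e1 : 0 < (e / 3 / B) `^ p by rewrite powR_gt0// divr_gt0.
have [n hn] := quiet_mass_cvg0 p1 hT K0 TK hA hx r0 q e1.
have [w [w01 wE]] := spectral_refine hT K0 TK n r0.
move: hn wE; set rho := r / 2 ^+ n; set N := (2 ^ n.+1)%N => hn wE.
have rho0 : 0 < rho by rewrite divr_gt0// exprn_gt0.
pose c i := b - r + i%:R * rho.
(* [v] carries the weights of the non-null descendants, [v'] those of the null ones *)
pose v i : R := if `[< null_node rho (c i) >] then 0 else w i.
pose v' i : R := if `[< null_node rho (c i) >] then w i else 0.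
have v01 i : 0 <= v i <= 1 by rewrite /v; case: ifP => // _; rewrite lexx ler01.
have main := @spectral_sum_le _ _ p _ _ _ _ hT K0 TK hA _ hC rho (b - r) N
  (fun i => Y rho (c i)) v x (e / 3) rho0 (fun i => (andP (v01 i)).1)
  (fun i _ => or_intror (line_resolventP hT K0 TK hA x (c i) rho0)) e3.
have small : 36 * K * C * (rho * lpnorm p N (fun i => (v i)%:C *: Y rho (c i))) <= e / 3.
  have L : rho * lpnorm p N (fun i => (v i)%:C *: Y rho (c i)) <= e / 3 / B.
    have rhoE : rho = (rho `^ p) `^ p^-1 by rewrite -powRrM mulfV ?gt_eqF// powRr1// ltW.
    have -> : e / 3 / B = ((e / 3 / B) `^ p) `^ p^-1.
      by rewrite -powRrM mulfV ?gt_eqF// powRr1// ltW// divr_gt0.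
    have l0 : 0 <= lpsum p N (fun i => (v i)%:C *: Y rho (c i)).
      by apply: sumr_ge0 => i _; exact: powR_ge0.
    rewrite /lpnorm [X in X * _]rhoE -powRM ?powR_ge0//.
    apply: ge0_ler_powR; rewrite ?nnegrE ?invr_ge0 ?(ltW p0) ?(ltW e1)//.
      by rewrite mulr_ge0// powR_ge0.
    apply: le_trans hn; rewrite /lpsum mulr_sumr; apply: ler_sum => i _.
    rewrite /node_mass -/(c i) /v; case: asboolP => _.
      by rewrite scale0r rnorm0 powR0 ?gt_eqF// !mulr0.
    rewrite -growth_pow// ler_wpM2l ?powR_ge0//.
    apply: ge0_ler_powR; rewrite ?nnegrE ?rnorm_ge0 ?(ltW p0)//.
    have /andP[wi0 wi1] := w01 i.
    by rewrite rnormZr ger0_norm// ler_piMl// rnorm_ge0.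
  apply: le_trans (_ : B * (e / 3 / B) <= _); last by rewrite mulrC divfK// gt_eqF.
  by apply: ler_pM => //; rewrite ?mulr_ge0 ?powR_ge0// ltW.
have [M0 hM0] := main.
have /cvgrPdist_le/(_ _ e3)[M1 _ hM1] := @null_node_sum _ _ T x 'I_N (index_enum 'I_N)
  (fun i => v' i) (fun=> rho) (fun i => c i) (fun i => ltac:(rewrite /v'; case: asboolP; [right|left] => //)).
exists (maxn M0 M1) => // M /=; rewrite geq_max => /andP[/hM0 h0 /hM1 h1].
rewrite sub0r normrN ger0_norm ?rnorm_ge0// wE.
have -> : \sum_(i < N) (w i)%:C *: spectral_part T rho (b - r + i%:R * rho) x M%:R =
  \sum_(i < N) (v i)%:C *: spectral_part T rho (b - r + i%:R * rho) x M%:R +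
  \sum_(i < N) (v' i)%:C *: spectral_part T rho (c i) x M%:R.
  rewrite -big_split /=; apply: eq_bigr => i _.
  by rewrite /v /v' /c; case: asboolP => _; rewrite scale0r ?add0r ?addr0.
move: h1; rewrite sub0r normrN ger0_norm ?rnorm_ge0// => h1.
apply: le_trans (rnormD _ _) _; lra.
Qed.

Lemma null_everywhere r b : 0 < r -> null_node r b.
Proof.
move=> r0; apply: contrapT => bad.
have [r' [b' [r'0 nn q]]] := exists_quiet_node hT K0 TK hA hx r0 bad.
exact: nn (quiet_node_null r'0 q).
Qed.

End NullEverywhere.

(** * Recovering the orbit from its spectral parts *)

Section ApproximateIdentity.
Context (R : realType) (X : completeNormedModType R[i]).
Context (T : R -> X -> X) (K : R).
Hypotheses (hT : C0_semigroup T) (K0 : 0 <= K)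
  (TK : forall t x, 0 <= t -> rnorm (T t x) <= K * rnorm x).

Lemma nint_kappa_ge (r : R) : 0 < r -> ((4^-1)%:E <= nint (kappa r))%E.
Proof.
move=> r0; have rV0 : 0 < r^-1 by rewrite invr_gt0.
have r4 : 0 <= r / 4 by rewrite divr_ge0// ltW.
have := integral_step 0 rV0 1 (fun _ : nat => r4).
rewrite big_ord_recl big_ord0 addr0 mulrA mulVf ?gt_eqF// mul1r => <-.
apply: (@le_nint _ (step 0 r^-1 1 0 (fun=> r / 4)) (kappa r)) => [||t].
- exact: measurable_step.
- by apply: continuous_measurable_fun; exact: continuous_kappa.
- rewrite /step; case: ifPn => h; last by rewrite lexx kappa_ge0// ltW.
  rewrite r4 /kappa ler_wpM2l ?(ltW r0)// fejer_ge//.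
  move: h; rewrite cell_lt// add0r mulr1 => /andP[t0 tr].
  rewrite ger0_norm; last by rewrite mulr_ge0// ltW.
  by rewrite -ler_pdivlMl// mulr1 ltW.
Qed.

Lemma wgt_tail (r t d : R) : 0 < r -> 0 < d -> d <= `|t| ->
  r * wgt (r * t) <= r^-1 * (1 + d ^- 2) * wgt t.
Proof.
move=> r0 d0 dt; have t0 : 0 < `|t| by exact: lt_le_trans dt.
have t2 : 0 < t ^+ 2 by rewrite -(real_normK (num_real t)) exprn_gt0.
have dt2 : 1 <= d ^- 2 * t ^+ 2.
  rewrite mulrC ler_pdivlMr ?exprn_gt0// mul1r -(real_normK (num_real t)).
  by rewrite lerXn2r// ?nnegrE ltW.
have o1 : 0 < 1 + t ^+ 2 by rewrite ltr_pwDl// ltW.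
have r2 : 0 < r ^+ 2 by rewrite exprn_gt0.
have o2 : 0 < 1 + r ^+ 2 * t ^+ 2 by rewrite ltr_pwDl// mulr_ge0 ?ltW.
rewrite /wgt /oneDsqr exprMn ler_pdivrMr// mulrAC ler_pdivlMr//.
rewrite -(ler_pM2l r0) !mulrA mulfV ?gt_eqF// mul1r -expr2.
nra.
Qed.

(** The kernels have integrals bounded below and concentrate at the origin as [r] grows,
    while the orbit varies little on short intervals, uniformly in [s]. *)
Lemma orbit_le_spectral x (e : R) : 0 < e -> exists r, 0 < r /\
  forall s, 0 <= s -> rnorm (T s x) <= 4 * rnorm (spectral_part T r 0 x s) + e.
Proof.
move=> e0; have pi0 : 0 < (pi : R) := pi_gt0 R.
pose e1 := e / (40 * pi).
have e10 : 0 < e1 by rewrite divr_gt0// mulr_gt0.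
have [d [d0 hd]] := orbit_uniform hT K0 TK x e10.
pose B := 5 * (2 * K * rnorm x) * (1 + d ^- 2).
have B0 : 0 <= B.
  by rewrite !mulr_ge0 ?rnorm_ge0// addr_ge0// invr_ge0 sqr_ge0.
pose r := 8 * (B + 1) * pi / e.
have r0 : 0 < r by rewrite divr_gt0// mulr_gt0// mulr_gt0// ltr_wpDl.
have rV0 : 0 < r^-1 by rewrite invr_gt0.
exists r; split=> // s s0.
set y := T s x.
pose F := window (kappa r) 0 (fun t => trajectory T x (s + t)).
pose G t := (kappa r t)%:C *: y.
have [cF dF] := spectral_window hT K0 TK 0 x s r0.
have [Ck hCk] := kappa_wgt r0.
have GE : window (kappa r) 0 (fun=> y) = G.
  by apply/funext => t; rewrite /window mul0r expi0 scale1r.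
have cG : continuous G.
  rewrite -GE; apply: continuous_window; first exact: continuous_kappa.
  by move=> t; exact: cvg_cst.
have dG : wdominated G.
  by rewrite -GE; apply: (wdominated_window 0 hCk (M := rnorm y)) => t.
pose E t := (-1 : R[i]) *: F t + G t.
have cE : continuous E := continuous_linear_comb cF cG.
have dE : wdominated E := wdominated_linear_comb (-1 : R[i]) dF dG.
have bE : bochner_integral E = - spectral_part T r 0 x s + bochner_integral G.
  by rewrite /E bochner_linear_comb// scaleN1r.
have k0 t : 0 <= kappa r t := kappa_ge0 t (ltW r0).
have lower : rnorm y / 4 <= rnorm (bochner_integral G).
  rewrite -lee_fin; apply: le_trans (rnorm_bochner_collinear cG dG k0).
  under eq_nint do rewrite mulrC.
  rewrite nintZ ?rnorm_ge0//; last first.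
    by apply: continuous_measurable_fun; exact: continuous_kappa.
  rewrite EFinM; apply: lee_wpmul2l; first by rewrite lee_fin rnorm_ge0.
  exact: nint_kappa_ge.
have bound t : rnorm (E t) <= 5 * e1 * (r * wgt (r * t)) + r^-1 * B * wgt t.
  have -> : rnorm (E t) = kappa r t * rnorm (trajectory T x (s + 0) - trajectory T x (s + t)).
    rewrite /E /F /window scaleN1r mul0r expi0 scale1r addrC /G -scalerBr rnormZr ger0_norm//.
    by rewrite addr0 (orbit_ge0 T x s0).
  have k5 := kappa_le t (ltW r0).
  have w0 : 0 <= r * wgt (r * t) by rewrite mulr_ge0 ?wgt_ge0// ltW.
  have c1 : 0 <= r^-1 * B * wgt t by rewrite mulr_ge0 ?wgt_ge0// mulr_ge0// ltW.
  have c2 : 0 <= 5 * e1 * (r * wgt (r * t)) by rewrite mulr_ge0// mulr_ge0// ltW.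
  have [td|dt] := leP `|t| d.
    apply: ler_wpDr => //.
    have : kappa r t * rnorm (trajectory T x (s + 0) - trajectory T x (s + t)) <=
      5 * (r * wgt (r * t)) * e1.
      apply: ler_pM => //; first exact: rnorm_ge0.
      by apply: hd; rewrite addr0 opprD addNKr normrN.
    by move=> /le_trans; apply; rewrite mulrAC.
  apply: ler_wpDl => //.
  have : kappa r t * rnorm (trajectory T x (s + 0) - trajectory T x (s + t)) <=
      5 * (r^-1 * (1 + d ^- 2) * wgt t) * (2 * K * rnorm x).
    apply: ler_pM => //; first exact: rnorm_ge0.
      by apply: le_trans k5 _; rewrite ler_wpM2l// wgt_tail// ltW.
    apply: le_trans (rnormB _ _) _; have := rnorm_orbit TK x (s + 0).
    by have := rnorm_orbit TK x (s + t); lra.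
  by move=> /le_trans; apply; rewrite le_eqVlt /B; apply/orP; left; apply/eqP; ring.
have upper : rnorm (bochner_integral E) <= e / 4.
  have mw : measurable_fun setT (fun t => r * wgt (r * t)).
    by apply: continuous_measurable_fun; exact: continuous_wgt_dilate.
  have w0 t : 0 <= r * wgt (r * t) by rewrite mulr_ge0 ?wgt_ge0// ltW.
  have c1 : 0 <= 5 * e1 by rewrite mulr_ge0// ltW.
  have c2 : 0 <= r^-1 * B by rewrite mulr_ge0// ltW.
  rewrite -lee_fin; apply: le_trans (rnorm_bochner_le cE dE) _.
  apply: (@le_trans _ _ (nint (fun t => 5 * e1 * (r * wgt (r * t)) + r^-1 * B * wgt t)%R)).
    apply: le_nint => [||t]; last by rewrite rnorm_ge0 bound.
    - by apply: continuous_measurable_fun; exact: continuous_rnorm.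
    - apply: measurable_funD; apply: measurable_funM => //; exact: measurable_wgt.
  rewrite nintD; last 4 first.
  - exact: measurable_funM.
  - by apply: measurable_funM => //; exact: measurable_wgt.
  - by move=> t; rewrite mulr_ge0.
  - by move=> t; rewrite mulr_ge0 ?wgt_ge0.
  rewrite (nintZ mw w0 c1) (nintZ (@measurable_wgt R) (@wgt_ge0 R) c2).
  rewrite nint_wgt_dilate// nint_wgt -!EFinM -EFinD lee_fin.
  have -> : 5 * e1 * pi = e / 8.
    by rewrite /e1; move: (pi : R) pi0 => q q0; field; rewrite gt_eqF.
  have : r^-1 * B * pi <= e / 8.
    rewrite /r invf_div -mulrA mulrAC ler_pdivrMr; last first.
      by rewrite mulr_gt0// mulr_gt0// ltr_wpDl.
    have -> : e / 8 * (8 * (B + 1) * pi) = e * ((B + 1) * pi).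
      by move: (pi : R) => q; field.
    by rewrite ler_wpM2l ?(ltW e0)// ler_wpM2r ?(ltW pi0)// lerDl.
  lra.
have -> : rnorm (spectral_part T r 0 x s) = rnorm (bochner_integral G - bochner_integral E).
  by rewrite bE opprD opprK addrCA subrr addr0.
have := rnormD (bochner_integral G - bochner_integral E) (bochner_integral E).
rewrite subrK; lra.
Qed.

End ApproximateIdentity.

Section Stability.
Context (R : realType) (X : completeNormedModType R[i]) (T : R -> X -> X) (K : R).
Hypotheses (hT : C0_semigroup T) (K0 : 0 <= K)
  (TK : forall t x, 0 <= t -> rnorm (T t x) <= K * rnorm x).

Lemma null_orbit x : (forall r, 0 < r -> null_node T x r 0) ->
  rnorm (T t x) @[t --> +oo] --> (0 : R).
Proof.
move=> hx; apply/cvgrPdist_le => e e0.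
have e1 : 0 < e / (2 * (K + 1)) by rewrite divr_gt0// mulr_gt0// ltr_wpDl.
have [r [r0 hr]] := orbit_le_spectral hT K0 TK x e1.
have e2 : 0 < e / (8 * (K + 1)) by rewrite divr_gt0// mulr_gt0// ltr_wpDl.
have /cvgrPdist_le/(_ _ e2)[M _ /(_ M (leqnn M))] := hx r r0.
rewrite sub0r normrN ger0_norm ?rnorm_ge0// => hM.
near=> t; rewrite sub0r normrN ger0_norm ?rnorm_ge0//.
have Mt : M%:R <= t by near: t; exact: nbhs_pinfty_ge.
have tM : 0 <= t - M%:R by rewrite subr_ge0.
rewrite -[t](subrK M%:R) (semigroup_add hT _ tM (ler0n _ M)).
apply: le_trans (TK _ tM) _.
have h : rnorm (T M%:R x) <= e / (K + 1).
  apply: le_trans (hr _ (ler0n _ M)) _.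
  have -> : e / (K + 1) = 4 * (e / (8 * (K + 1))) + e / (2 * (K + 1)).
    by field; rewrite gt_eqF// ltr_wpDl.
  by rewrite lerD2r ler_wpM2l.
apply: le_trans (_ : K * (e / (K + 1)) <= _); first by rewrite ler_wpM2l.
by rewrite mulrA ler_pdivrMr ?ltr_wpDl// mulrC ler_wpM2l ?(ltW e0)// lerDl.
Unshelve. all: by end_near. Qed.

Lemma dense_stable (M : set X) : dense M ->
  (forall x, M x -> rnorm (T t x) @[t --> +oo] --> (0 : R)) -> stable_semigroup T.
Proof.
move=> dM hM x; apply/cvgrPdist_le => e e0.
have e1 : 0 < e / (2 * (K + 1)) by rewrite divr_gt0// mulr_gt0// ltr_wpDl.
have [z [xz Mz]] : exists z, rnorm (x - z) <= e / (2 * (K + 1)) /\ M z.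
  have b0 : (ball x (e / (2 * (K + 1)))%:C)^° !=set0.
    by exists x; apply: nbhsx_ballx; rewrite ltcR.
  have [z [/interior_subset xz Mz]] := dM _ b0 (@open_interior _ _).
  exists z; split=> //; move: xz; rewrite -ball_normE /= normE ltcR; exact: ltW.
have e2 : 0 < e / 2 by rewrite divr_gt0.
have /cvgrPdist_le/(_ _ e2) := hM _ Mz => H.
near=> t; rewrite sub0r normrN ger0_norm ?rnorm_ge0//.
have t0 : 0 <= t by near: t; exact: nbhs_pinfty_ge.
have : `|0 - rnorm (T t z)| <= e / 2 by near: t.
rewrite sub0r normrN ger0_norm ?rnorm_ge0// => h.
have -> : T t x = T t (x - z) + T t z by rewrite -(semigroupD hT)// subrK.
apply: le_trans (rnormD _ _) _.
have h2 : rnorm (T t (x - z)) <= e / 2.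
  apply: le_trans (TK _ t0) _; apply: le_trans (ler_wpM2l K0 xz) _.
  rewrite mulrA ler_pdivrMr ?mulr_gt0 ?ltr_wpDl//.
  have -> : e / 2 * (2 * (K + 1)) = e * (K + 1) by field.
  by rewrite mulrC ler_wpM2l ?(ltW e0)// lerDl.
lra.
Unshelve. all: by end_near. Qed.

End Stability.

Theorem theorem5p7 (R : realType) (X : completeNormedModType R[i])
    (T : R -> X -> X) (D : set X) (A : X -> X) (p : R)
    (hT : C0_semigroup T) (hbound : bounded_semigroup T)
    (hA : is_generator T D A)
    (hp1 : 1 < p) (hp2 : p <= 2) (hX : fourier_type X p)
    (hM : dense [set x : X | forall beta : R,
       (alpha `^ ((p - 1) / p))%:C *: resolvent D A (alpha +i* beta) x
         @[alpha --> 0^'+] --> (0 : X)]) :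
  stable_semigroup T.
Proof.
case: hbound => K1 TK1; pose K := Num.max K1 0.
have K0 : 0 <= K by rewrite le_max lexx orbT.
have TK t x : 0 <= t -> rnorm (T t x) <= K * rnorm x.
  move=> t0; apply: le_trans (TK1 _ _ t0) _.
  by rewrite ler_wpM2r ?rnorm_ge0// le_max lexx.
have [C [C0 hC]] := hausdorff_young_scaled hp1 hX.
apply: (dense_stable hT K0 TK hM) => x hx; apply: (null_orbit hT K0 TK) => r r0.
exact: (null_everywhere hp1 hT K0 TK hA C0 hC hx).
Qed.
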